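(* Set $D=\{0,1\}^m\smallsetminus\{\mathbf 0\}$ and let $(G_k)_{1\le k\le p}$ be separable real Hilbert spaces. For every $i\in\{1,\dots,m\}$, let $f_i\in\Gamma_0(H_i)$ and, for every $k\in\{1,\dots,p\}$, let $\tau_k\in(0,+\infty)$, let $g_k\colon G_k\to\mathbb R$ be a differentiable convex function with a $\tau_k$-Lipschitz-continuous gradient, and let $L_{ki}\colon H_i\to G_k$ be linear and bounded. It is assumed that $\min_{1\le k\le p}\sum_{i=1}^m\|L_{ki}\|^2>0$ and that the set $\mathbf F$ of solutions to the problem $$\underset{x_1\in H_1,\dots,x_m\in H_m}{\text{minimize}}\ \ \sum_{i=1}^mf_i(x_i)+\sum_{k=1}^pg_k\bigg(\sum_{i=1}^mL_{ki}x_i\bigg)$$ is nonempty. Let $$\vartheta\in\Bigg(0,\ \bigg(\sum_{k=1}^p\tau_k\bigg\|\sum_{i=1}^mL_{ki}L_{ki}^*\bigg\|\bigg)^{-1}\Bigg],$$ let $(\gamma_n)_{n\in\mathbb N}$ be a sequence in $(0,2\vartheta)$ such that $\inf_{n\in\mathbb N}\gamma_n>0$ and $\sup_{n\in\mathbb N}\gamma_n<2\vartheta$, and let $(\lambda_n)_{n\in\mathbb N}$ be a sequence in $(0,1]$ such that $\inf_{n\in\mathbb N}\lambda_n>0$. Let $\boldsymbol x_0$, $(\boldsymbol a_n)_{n\in\mathbb N}$, and $(\boldsymbol c_n)_{n\in\mathbb N}$ be $\mathbf H$-valued random variables, and let $(\boldsymbol\varepsilon_n)_{n\in\mathbb N}$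 be identically distributed $D$-valued random variables. Iterate, for $n=0,1,\dots$ and for $i=1,\dots,m$, $$\begin{aligned} r_{i,n}&=\varepsilon_{i,n}\bigg(x_{i,n}-\gamma_n\bigg(\sum_{k=1}^pL_{ki}^*\nabla g_k\Big(\sum_{j=1}^mL_{kj}x_{j,n}\Big)+c_{i,n}\bigg)\bigg)\\ x_{i,n+1}&=x_{i,n}+\varepsilon_{i,n}\lambda_n\big(\operatorname{prox}_{\gamma_nf_i}r_{i,n}+a_{i,n}-x_{i,n}\big).\end{aligned}$$ Set $(\forall n\in\mathbb N)$ $\mathcal E_n=\sigma(\boldsymbol\varepsilon_n)$. In addition, assume that: $\sum_{n\in\mathbb N}\sqrt{\mathsf E(\|\boldsymbol a_n\|^2\mid\mathcal X_n)}<+\infty$ and $\sum_{n\in\mathbb N}\sqrt{\mathsf E(\|\boldsymbol c_n\|^2\mid\mathcal X_n)}<+\infty$; for every $n\in\mathbb N$, $\mathcal E_n$ and $\mathcal X_n$ are independent; and $(\forall i\in\{1,\dots,m\})$ $\mathsf P[\varepsilon_{i,0}=1]>0$. Then $(\boldsymbol x_n)_{n\in\mathbb N}$ converges weakly $\mathsf P$-a.s. to an $\mathbf F$-valued random variable $\boldsymbol x$. If, furthermore, one of the following holds: (i) for every $\mathbf x\in\mathbf F$ and every $i\in\{1,\dots,m\}$, $\partial f_i$ is demiregular at $x_i$; (ii) the operator $\mathbf x\mapsto\big(\sum_{k=1}^pL_{ki}^*\nabla g_k(\sum_{j=1}^mL_{kj}x_j)\big)_{1\le i\le m}$ is demiregular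 at every point in $\mathbf F$; then $(\boldsymbol x_n)_{n\in\mathbb N}$ converges strongly $\mathsf P$-a.s. to $\boldsymbol x$.
   Context: $H_1,\dots,H_m$ are separable real Hilbert spaces and $\mathbf H=H_1\oplus\cdots\oplus H_m$ is their direct Hilbert sum; all norms are denoted $\|\cdot\|$, and $\mathbf x=(x_1,\dots,x_m)$ is a generic vector in $\mathbf H$. $(\Omega,\mathcal F,\mathsf P)$ is the underlying probability space; random variables with values in a Hilbert space are Borel-measurable maps from $\Omega$. For $\boldsymbol x_n=(x_{1,n},\dots,x_{m,n})$, $\mathcal X_n=\sigma(\boldsymbol x_0,\dots,\boldsymbol x_n)$. Components: $\boldsymbol a_n=(a_{i,n})_{1\le i\le m}$, $\boldsymbol c_n=(c_{i,n})_{1\le i\le m}$, $\boldsymbol\varepsilon_n=(\varepsilon_{i,n})_{1\le i\le m}$. $\Gamma_0(H)$ is the class of lower semicontinuous convex functions $f\colon H\to(-\infty,+\infty]$ with $f\not\equiv+\infty$; $\partial f$ is the convex subdifferential and $\operatorname{prox}_fx$ is the unique minimizer of $f+\|x-\cdot\|^2/2$. $L^*$ is the adjoint of $L$. For $A\colon H\to2^H$, $\operatorname{dom}A=\{x\in H:Ax\neq\varnothing\}$ and $\operatorname{gra}A=\{(x,u)\in H\times H:u\in Ax\}$; $A$ is demiregular at $x\in\operatorname{dom}A$ if, for every sequence $((x_n,u_n))_{n\in\mathbb N}$ in $\operatorname{gra}A$ and every $u\in Ax$ such that $x_n\rightharpoonup x$ (weakly) and $u_n\to u$ (strongly), we have $x_n\to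 x$ (strongly). Equalities and inequalities involving random variables are understood to hold $\mathsf P$-almost surely. *)

(* Defs.v *)
From HB Require Import structures.
From mathcomp Require Import all_boot all_order all_algebra.
From mathcomp Require Import all_classical all_reals all_analysis measurable_realfun.
From mathcomp Require Import ring lra.

Set Implicit Arguments.
Unset Strict Implicit.
Unset Printing Implicit Defensive.

Import Order.TTheory GRing.Theory Num.Theory.
Import numFieldNormedType.Exports.

Local Open Scope classical_set_scope.
Local Open Scope ring_scope.

HB.mixin Record isHilbert (R : realType) V & CompleteNormedModule R V := {
  dot : V -> V -> R ;
  dotC : forall x y : V, dot x y = dot y x ;
  dotDl : forall x y z : V, dot (x + y) z = dot x z + dot y z ;
  dotZl : forall (a : R) (x y : V), dot (a *: x) y = a * dot x y ;
  dot_normE : forall x : V, dot x x = `|x| ^+ 2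
}.

#[short(type="hilbertType")]
HB.structure Definition Hilbert (R : realType) :=
  {V of CompleteNormedModule R V & isHilbert R V}.

Definition separable (T : topologicalType) :=
  exists A : set T, countable A /\ dense A.

(* The direct Hilbert sum of a finite family: the norm is the l2 norm, and the
   topology is the one it generates. *)
Section hsum.
Context {R : realType} {I : finType}.

Definition hsum (H : I -> hilbertType R) : Type := forall i, H i.

Variable H : I -> hilbertType R.
Implicit Types x y z : hsum H.

HB.instance Definition _ := gen_eqMixin (hsum H).
HB.instance Definition _ := gen_choiceMixin (hsum H).

Let hsum0 : hsum H := fun=> 0.
Let hsum_opp x : hsum H := fun i => - x i.
Let hsum_add x y : hsum H := fun i => x i + y i.
Let hsum_scale (a : R) x : hsum H := fun i => a *: x i.

Let hsum_addA : associative hsum_add.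
Proof. by move=> x y z; apply: functional_extensionality_dep => i; exact: addrA. Qed.
Let hsum_addC : commutative hsum_add.
Proof. by move=> x y; apply: functional_extensionality_dep => i; exact: addrC. Qed.
Let hsum_add0 : left_id hsum0 hsum_add.
Proof. by move=> x; apply: functional_extensionality_dep => i; exact: add0r. Qed.
Let hsum_addN : left_inverse hsum0 hsum_opp hsum_add.
Proof. by move=> x; apply: functional_extensionality_dep => i; exact: addNr. Qed.

HB.instance Definition _ := GRing.isZmodule.Build (hsum H)
  hsum_addA hsum_addC hsum_add0 hsum_addN.

Let hsum_scaleA a b x : hsum_scale a (hsum_scale b x) = hsum_scale (a * b) x.
Proof. by apply: functional_extensionality_dep => i; exact: scalerA. Qed.
Let hsum_scale1 : left_id 1 hsum_scale.
Proof. by move=> x; apply: functional_extensionality_dep => i; exact: scale1r. Qed.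
Let hsum_scaleDr : right_distributive hsum_scale +%R.
Proof. by move=> a x y; apply: functional_extensionality_dep => i; exact: scalerDr. Qed.
Let hsum_scaleDl x : {morph hsum_scale^~ x : a b / a + b}.
Proof. by move=> a b; apply: functional_extensionality_dep => i; exact: scalerDl. Qed.

HB.instance Definition _ := GRing.Zmodule_isLmodule.Build R (hsum H)
  hsum_scaleA hsum_scale1 hsum_scaleDr hsum_scaleDl.

Definition hsum_dot x y : R := \sum_i dot (x i) (y i).
Definition hsum_norm x : R := Num.sqrt (\sum_i `|x i| ^+ 2).

Let sqr_ge0 x : 0 <= \sum_i `|x i| ^+ 2.
Proof. by apply: sumr_ge0 => i _; exact: exprn_ge0. Qed.

Let hsum_norm_ge0 x : 0 <= hsum_norm x.
Proof. exact: sqrtr_ge0. Qed.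

Let hsum_dotC x y : hsum_dot x y = hsum_dot y x.
Proof. by apply: eq_bigr => i _; exact: dotC. Qed.

Let hsum_dotDl x y z : hsum_dot (x + y) z = hsum_dot x z + hsum_dot y z.
Proof. by rewrite -big_split; apply: eq_bigr => i _; exact: dotDl. Qed.

Let hsum_dotZl a x y : hsum_dot (a *: x) y = a * hsum_dot x y.
Proof. by rewrite mulr_sumr; apply: eq_bigr => i _; exact: dotZl. Qed.

Let hsum_dot_normE x : hsum_dot x x = hsum_norm x ^+ 2.
Proof. by rewrite sqr_sqrtr//; apply: eq_bigr => i _; exact: dot_normE. Qed.

Let le_hsum_norm x i : `|x i| <= hsum_norm x.
Proof.
rewrite -[leLHS]ger0_norm// -sqrtr_sqr ler_wsqrtr//.
by rewrite (bigD1 i)//= lerDl sumr_ge0// => j _; exact: exprn_ge0.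
Qed.

Let hsum_norm_eq0 x : hsum_norm x = 0 -> x = 0.
Proof.
move=> x0; apply: functional_extensionality_dep => i.
by apply/eqP; rewrite -normr_le0 -x0 le_hsum_norm.
Qed.

Let hsum_normZ a x : hsum_norm (a *: x) = `|a| * hsum_norm x.
Proof.
rewrite /hsum_norm -[`|a|]ger0_norm// -sqrtr_sqr -sqrtrM ?exprn_ge0//.
by congr Num.sqrt; rewrite mulr_sumr; apply: eq_bigr => i _; rewrite normrZ exprMn.
Qed.

Let hsum_dot_sqr x y : hsum_dot x y ^+ 2 <= hsum_norm x ^+ 2 * hsum_norm y ^+ 2.
Proof.
rewrite -!hsum_dot_normE.
have [y0|y0] := eqVneq (hsum_norm y) 0.
  have -> : y = 0 *: y by rewrite {1}(hsum_norm_eq0 y0) scale0r.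
  by rewrite hsum_dotC !hsum_dotZl !mul0r mulr0 expr0n.
have yy : 0 < hsum_dot y y by rewrite hsum_dot_normE exprn_gt0// lt0r y0/=.
set p := hsum_dot x x; set q := hsum_dot x y; set r := hsum_dot y y in yy *.
have : 0 <= hsum_dot (r *: x + (- q) *: y) (r *: x + (- q) *: y).
  by rewrite hsum_dot_normE exprn_ge0.
rewrite hsum_dotDl !hsum_dotZl !(hsum_dotC _ (_ + _)) !hsum_dotDl !hsum_dotZl.
rewrite (hsum_dotC y x) -/p -/q -/r => h.
have {}h : 0 <= r * (p * r - q ^+ 2) by apply: le_trans h _; rewrite le_eqVlt; apply/orP; left; apply/eqP; ring.
by move: h; rewrite pmulr_rge0// subr_ge0.
Qed.

Let hsum_norm_triangle x y : hsum_norm (x + y) <= hsum_norm x + hsum_norm y.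
Proof.
rewrite -ler_sqr ?nnegrE ?addr_ge0// -hsum_dot_normE.
rewrite hsum_dotDl !(hsum_dotC _ (_ + _)) !hsum_dotDl (hsum_dotC y x).
have h : hsum_dot x y <= hsum_norm x * hsum_norm y.
  apply: le_trans (ler_norm _) _.
  rewrite -ler_sqr ?nnegrE ?mulr_ge0//.
  by rewrite -normrX ger0_norm ?sqr_ge0// ?exprMn// exprn_even_ge0.
rewrite !hsum_dot_normE; lra.
Qed.

HB.instance Definition _ := Lmodule_isNormed.Build R (hsum H)
  hsum_norm_triangle hsum_normZ hsum_norm_eq0.

Let hsum_norm_le_sum x : `|x| <= \sum_i `|x i|.
Proof.
rewrite -ler_sqr ?nnegrE ?sumr_ge0// -[`|x|]/(hsum_norm x) sqr_sqrtr//.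
rewrite [leRHS]expr2 mulr_suml; apply: ler_sum => i _.
by rewrite expr2 ler_wpM2l// (bigD1 i)//= lerDl sumr_ge0.
Qed.

Let hsum_complete (F : set_system (hsum H)) : ProperFilter F -> cauchy F -> cvg F.
Proof.
move=> FF /cauchyP Fc.
have Fi i : cvg ((fun x : hsum H => x i) @ F).
  apply: cauchy_cvg; apply/cauchyP => e e0.
  have [x Fx] := Fc e e0; exists (x i).
  rewrite /nbhs/=; apply: filterS Fx => y.
  rewrite -!ball_normE /=; apply: le_lt_trans.
  exact: (le_hsum_norm (x - y) i).
apply/cvg_ex; exists (fun i => lim ((fun x : hsum H => x i) @ F)).
apply/cvgrPdist_lt => e e0.
have e'0 : 0 < e / (#|I|.+1)%:R by rewrite divr_gt0.
have near_i : \forall x \near F, forall i,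
    `|lim ((fun x : hsum H => x i) @ F) - x i| < e / (#|I|.+1)%:R.
  apply: filter_forall => i.
  by move/cvgrPdist_lt : (Fi i) => /(_ _ e'0).
apply: filterS near_i => x xi.
apply: le_lt_trans (hsum_norm_le_sum _) _.
apply: (@le_lt_trans _ _ (\sum_(i in I) e / (#|I|.+1)%:R)).
  by apply: ler_sum => i _; exact: ltW (xi i).
by rewrite sumr_const -[ltLHS]mulr_natr mulrAC ltr_pdivrMr// ltr_pM2l// ltr_nat.
Qed.

HB.instance Definition _ := Uniform_isComplete.Build (hsum H) hsum_complete.

HB.instance Definition _ := isHilbert.Build R (hsum H)
  hsum_dotC hsum_dotDl hsum_dotZl hsum_dot_normE.

End hsum.

Section hilbert.
Context {R : realType}.
Implicit Types V W : hilbertType R.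

Definition weak_cvg V (u : nat -> V) (l : V) :=
  forall y, dot (u n) y @[n --> \oo] --> dot l y.

Definition opnorm V W (L : V -> W) : R :=
  sup [set `|L x| | x in [set x | `|x| <= 1]].

(* For L linear and bounded, the set below is a singleton (Riesz). *)
Definition adjoint V W (L : V -> W) (y : W) : V :=
  get [set x | forall z, dot (L z) y = dot z x].

(* Likewise a singleton when g is differentiable at x. *)
Definition grad V (g : V -> R) (x : V) : V :=
  get [set u | forall h, 'd g x h = dot h u].

Definition Gamma0 V (f : V -> \bar R) :=
  [/\ forall x, f x != -oo%E,
      exists x, f x != +oo%E,
      lower_semicontinuous f &
      forall x y (t : R), 0 < t < 1 ->
        (f (t *: x + (1 - t) *: y)%R <= t%:E * f x + (1 - t)%:E * f y)%E].

Definition argmin V (f : V -> \bar R) : set V :=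
  [set x | forall y, (f x <= f y)%E].

(* For f in Gamma0, the set of minimizers is a singleton. *)
Definition prox V (f : V -> \bar R) (x : V) : V :=
  get (argmin (fun y => (f y + (`|x - y| ^+ 2 / 2)%:E)%E)).

Definition subdiff V (f : V -> \bar R) (x : V) : set V :=
  [set u | forall y, ((dot (y - x)%R u)%:E + f x <= f y)%E].

Definition demiregular V (A : V -> set V) (x : V) :=
  A x !=set0 /\
  forall (xs us : nat -> V) (u : V),
    (forall n, A (xs n) (us n)) -> A x u ->
    weak_cvg xs x -> us @ \oo --> u -> xs @ \oo --> x.

End hilbert.

Section random.
Context {R : realType} d {T : measurableType d} (P : probability T R).

Definition borel (V : ptopologicalType) := g_sigma_algebraType (@open V).

Definition random_vector (V : hilbertType R) (X : T -> V) :=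
  measurable_fun setT (X : T -> borel V).

Definition sigma_upto (V : hilbertType R) (x : nat -> T -> V) (n : nat) :
    set (set T) :=
  <<s \bigcup_(k in `I_n.+1)
        preimage_set_system setT (x k) (@measurable _ (borel V)) >>.

Definition sigma_discrete (D : finType) (e : T -> D) : set (set T) :=
  preimage_set_system setT e (@discrete_measurable D).

Definition independent (E F : set (set T)) :=
  forall A B, E A -> F B -> P (A `&` B) = (P A * P B)%E.

(* Z is a version of E(Y | G), for Y nonnegative and not necessarily
   integrable. *)
Definition is_cond_exp (G : set (set T)) (Y Z : T -> \bar R) :=
  [/\ forall w, (0 <= Z w)%E,
      forall B : set (\bar R), measurable B -> G (Z @^-1` B) &
      forall A, G A -> (\int[P]_(w in A) Z w = \int[P]_(w in A) Y w)%E].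

End random.

Definition nonzero_bits m : set {ffun 'I_m -> bool} := ~` [set [ffun=> false]].
Arguments nonzero_bits : clear implicits.

Section problem.
Context {R : realType} {m p : nat} {H : 'I_m -> hilbertType R}
  {G : 'I_p -> hilbertType R}.
Variables (f : forall i, H i -> \bar R) (g : forall k, G k -> R)
  (L : forall k i, {linear H i -> G k}).

Definition coupling (k : 'I_p) (x : hsum H) : G k := \sum_i L k i (x i).

Definition objective (x : hsum H) : \bar R :=
  (\sum_i f (x i) + (\sum_k g (coupling k x))%:E)%E.

Definition coupled_grad (x : hsum H) : hsum H :=
  fun i => \sum_k adjoint (L k i) (grad (@g k) (coupling k x)).

End problem.

(* Main.v *)
Require Import Defs.
From HB Require Import structures.
From mathcomp Require Import all_boot all_order all_algebra.
From mathcomp Require Import all_classical all_reals all_analysis measurable_realfun.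
From mathcomp Require Import ring lra.

Import Order.TTheory GRing.Theory Num.Theory.
Import numFieldNormedType.Exports.

Local Open Scope classical_set_scope.
Local Open Scope ring_scope.

Set Implicit Arguments.
Unset Strict Implicit.
Unset Printing Implicit Defensive.

(** Write B for the gradient of the smooth part, seen as an operator on the direct
    sum, and T_n for the full forward-backward step with parameter gamma n.

    Deterministic core. The Baillon-Haddad inequality for each g_k, recombined
    over the couplings, makes B cocoercive with constant theta
    ([coupled_grad_cocoercive]). A point z is a solution when each subdifferential
    contains the corresponding block of - B z ([argmin_objectiveP]), that is, when
    z is a fixed point of T_n. Firm nonexpansiveness of the proximity operators
    then shows that a relaxed full step from x decreases |x - z|^2 by a combination
    of |B x - B z|^2 and |x - T_n x - gamma n (B x - B z)|^2
    ([fb_relaxed_estimate]).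

    Randomness. Only the selected blocks move, and block i is selected with a
    probability q_i that does not depend on the past. In the norm that weights
    block i by 1 / q_i the selected step achieves, in conditional expectation, the
    decrease of the full step in the original norm, because the squared norm is a
    sum over the blocks ([random_selection_cond_le]). The errors have summable
    conditional norms, so [stochastic_quasi_fejer], which rests on the
    Robbins-Siegmund theorem and on the convergence of nonnegative supermartingales
    by upcrossings, shows that almost surely the weighted distance to z converges
    and the decreases are summable ([fb_quasi_fejer]). The exceptional null set
    depends on z. Countably many null sets may be discarded, so z ranges over a
    dense sequence of solutions first, and [cvg_dist_dense] then extends the
    convergence of the distances to all solutions.

    Conclusion along a path. On the remaining outcomes B x_n converges strongly to
    B z and x_n - T_n x_n tends to 0. The graphs of the subdifferentials are closed
    for weak convergence of the points and strong convergence of the subgradients,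
    so every weak cluster point is a solution and Opial's argument gives weak
    convergence ([forward_backward_path]). Demiregularity, applied to the proximal
    points or to the iterates themselves, makes it strong ([fb_strong_cvg]). In a
    separable space a map is Borel as soon as its scalar products are measurable,
    so the limit is a random vector ([random_weak_limit]).

    Conditional inequalities are expressed by integrals against nonnegative weights
    that are measurable with respect to the past ([cond_le]): no moment of x_0 is
    assumed, so the distances need not be integrable. *)

(** * Inner products *)

Section inner_product.
Context {R : realType} {V : hilbertType R}.
Implicit Types (x y z : V) (a : R).

Lemma dotDr x y z : dot x (y + z) = dot x y + dot x z.
Proof. by rewrite dotC dotDl !(dotC x). Qed.

Lemma dotZr a x y : dot x (a *: y) = a * dot x y.
Proof. by rewrite dotC dotZl dotC. Qed.

Lemma dot0l x : dot 0 x = 0 :> R.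
Proof. by rewrite -(scale0r x) dotZl mul0r. Qed.

Lemma dot0r x : dot x 0 = 0 :> R.
Proof. by rewrite dotC dot0l. Qed.

Lemma dotNl x y : dot (- x) y = - dot x y.
Proof. by rewrite -scaleN1r dotZl mulN1r. Qed.

Lemma dotNr x y : dot x (- y) = - dot x y.
Proof. by rewrite dotC dotNl dotC. Qed.

Lemma dotBl x y z : dot (x - y) z = dot x z - dot y z.
Proof. by rewrite dotDl dotNl. Qed.

Lemma dotBr x y z : dot x (y - z) = dot x y - dot x z.
Proof. by rewrite dotDr dotNr. Qed.

Lemma dot_suml (I : finType) (F : I -> V) y : dot (\sum_i F i) y = \sum_i dot (F i) y.
Proof. by elim/big_rec2: _ => [|i u v _ <-]; rewrite ?dot0l ?dotDl. Qed.

Lemma dot_sumr (I : finType) (F : I -> V) y : dot y (\sum_i F i) = \sum_i dot y (F i).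
Proof. by rewrite dotC dot_suml; apply: eq_bigr => i _; rewrite dotC. Qed.

Lemma sqr_normD x y : `|x + y| ^+ 2 = `|x| ^+ 2 + 2 * dot x y + `|y| ^+ 2.
Proof. by rewrite -!dot_normE dotDl !dotDr (dotC y x); ring. Qed.

Lemma sqr_normB x y : `|x - y| ^+ 2 = `|x| ^+ 2 - 2 * dot x y + `|y| ^+ 2.
Proof. by rewrite sqr_normD dotNr normrN; ring. Qed.

Lemma sqr_normZ a x : `|a *: x| ^+ 2 = a ^+ 2 * `|x| ^+ 2.
Proof. by rewrite -!dot_normE dotZl dotZr mulrA expr2. Qed.

Lemma dot_ge0 x : 0 <= dot x x.
Proof. by rewrite dot_normE exprn_ge0. Qed.

Lemma cauchy_schwarz x y : `|dot x y| <= `|x| * `|y|.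
Proof.
have [->|y0] := eqVneq y 0; first by rewrite dot0r !normr0 mulr0.
have yy : 0 < `|y| by rewrite normr_gt0.
rewrite -ler_sqr ?nnegrE ?mulr_ge0// real_normK ?num_real// exprMn.
have := dot_ge0 (`|y| ^+ 2 *: x - dot x y *: y).
rewrite dot_normE sqr_normB !sqr_normZ dotZl dotZr.
rewrite (_ : _ + _ = `|y| ^+ 2 * (`|x| ^+ 2 * `|y| ^+ 2 - dot x y ^+ 2)); last by ring.
by rewrite pmulr_rge0 ?exprn_gt0// subr_ge0.
Qed.

Lemma dot_le_norm x y : dot x y <= `|x| * `|y|.
Proof. by apply: le_trans (ler_norm _) _; exact: cauchy_schwarz. Qed.

Lemma eq_dotr x y : (forall z, dot z x = dot z y) -> x = y.
Proof.
move=> e; apply/eqP; rewrite -subr_eq0 -normr_eq0 -sqrf_eq0 -dot_normE.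
by rewrite {2}/GRing.add/= dotBr e subrr.
Qed.

Lemma cvg_dotl {T : Type} {F : set_system T} {FF : Filter F} (u : T -> V) l y :
  u @ F --> l -> dot (u t) y @[t --> F] --> dot l y.
Proof.
move=> ul; apply/cvgrPdist_lt => e e0.
have e1 : 0 < e / (`|y| + 1) by rewrite divr_gt0// ltr_wpDl.
move/cvgrPdist_lt : ul => /(_ _ e1); apply: filterS => t.
rewrite -dotBl => h; apply: le_lt_trans (cauchy_schwarz _ _) _.
move: h; rewrite ltr_pdivlMr ?ltr_wpDl//; apply: le_lt_trans.
by rewrite ler_wpM2l// lerDl.
Qed.

(** Lets a bounded, weakly convergent family be paired with a strongly convergent
    one. *)
Lemma cvg_dot_bounded {T : Type} {F : set_system T} {FF : Filter F}
    (u v : T -> V) (M : R) :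
  (\forall t \near F, `|u t| <= M) -> v @ F --> (0 : V) ->
  dot (u t) (v t) @[t --> F] --> (0 : R).
Proof.
move=> uM v0; apply/cvgrPdist_lt => e e0.
have M0 : 0 < `|M| + 1 by rewrite ltr_wpDl.
have e1 : 0 < e / (`|M| + 1) by rewrite divr_gt0.
move/cvgrPdist_lt : v0 => /(_ _ e1); apply: filterS2 uM => t ut.
rewrite !sub0r !normrN => vt; apply: le_lt_trans (cauchy_schwarz _ _) _.
move: vt; rewrite ltr_pdivlMr// mulrC; apply: le_lt_trans.
by rewrite ler_wpM2r// (le_trans ut)// (le_trans (ler_norm _))// lerDl.
Qed.

End inner_product.

(** Pairing with a test vector turns a vector identity into a scalar one, which
    ring arithmetic decides. *)
Ltac hilbert_ring :=
  apply: eq_dotr => ?; rewrite !(dotDr, dotNr, dotZr, dot0r);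
  first [ring | lra].

Lemma cvg_ge0 {R : realType} {T : Type} {F : set_system T} {FF : ProperFilter F}
    (u : T -> R) (l : R) :
  u @ F --> l -> (\forall t \near F, 0 <= u t) -> 0 <= l.
Proof. by move=> ul u0; apply: (closed_cvg _ (@closed_ge R 0) u0 _ ul). Qed.

(** Extracts a first-order optimality condition from a comparison along a
    segment, where the second-order term B is controlled only by a constant. *)
Lemma ge0_of_affine_perturbation {R : realType} (A B : R) :
  (forall t, 0 < t < 1 -> 0 <= t * A + t ^+ 2 * B) -> 0 <= A.
Proof.
move=> h; rewrite leNgt; apply/negP => A0.
have D0 : 0 < `|B| + `|A| + 1 by rewrite ltr_wpDl.
(* At this t the quadratic term is at most half of t * |A|; the summand |A| keeps
   t below 1. *)
set t := - A / (2 * (`|B| + `|A| + 1)).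
have t0 : 0 < t by rewrite divr_gt0 ?mulr_gt0// oppr_gt0.
have t1 : t < 1.
  rewrite ltr_pdivrMr ?mulr_gt0// mul1r.
  by rewrite (ltr0_norm A0); have := normr_ge0 B; lra.
have /h : 0 < t < 1 by rewrite t0 t1.
rewrite (_ : _ + _ = t * (A + t * B)); last by ring.
rewrite pmulr_rge0//; apply/negP; rewrite -ltNge.
have : t * B <= t * (`|B| + `|A| + 1).
  rewrite ler_pM2l//; have := ler_norm B; have := normr_ge0 A; lra.
suff -> : t * (`|B| + `|A| + 1) = - A / 2 by lra.
by rewrite /t; field; rewrite gt_eqF.
Qed.

(** * Proximity operators *)

Section gamma0.
Context {R : realType} {V : hilbertType R}.
Variable f : V -> \bar R.
Hypothesis fG : Gamma0 f.

Lemma Gamma0_proper : exists x a, f x = a%:E.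
Proof.
case: fG => fNy [x fx] _ _; exists x.
by case: (f x) fx (fNy x) => [a| |] // _ _; exists a.
Qed.

(** Lower semicontinuity bounds f below near a point of its domain, and
    convexity carries the bound away from it along rays. *)
Lemma Gamma0_minorant : exists x0 : V, exists c M : R, 0 <= M /\
  forall y, ((c - M * `|y - x0|)%:E <= f y)%E.
Proof.
have [x0 [a fx0]] := Gamma0_proper; have [fNy _ flsc fcvx] := fG.
have [|U] := flsc x0 (a - 1); first by rewrite fx0 lte_fin; lra.
rewrite -nbhs_ballE => -[e/= e0 eU] fU.
exists x0, (a - 1), (2 / e); split; first by rewrite divr_ge0// ltW.
move=> y; have [lt_e|ge_e] := ltP `|y - x0| e.
  apply/ltW/(@le_lt_trans _ _ (a - 1)%:E); last first.
    by apply/fU/eU; rewrite -ball_normE/= -normrN opprB.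
  by rewrite lee_fin gerBl mulr_ge0// divr_ge0// ltW.
have n0 : 0 < `|y - x0| := lt_le_trans e0 ge_e.
(* This t brings the convex combination within e / 2 of x0, where f is known to
   be above a - 1. *)
set t := e / (2 * `|y - x0|).
have t0 : 0 < t by rewrite divr_gt0// mulr_gt0.
have t1 : t < 1 by rewrite ltr_pdivrMr ?mulr_gt0// mul1r; lra.
have /fU : U (t *: y + (1 - t) *: x0).
  apply: eU; rewrite -ball_normE/=.
  rewrite (_ : x0 - _ = - (t *: (y - x0))); last first.
    by hilbert_ring.
  rewrite normrN normrZ gtr0_norm// (_ : t * _ = e / 2); first by lra.
  by rewrite /t; field; rewrite gt_eqF.
have : 0 < t < 1 by rewrite t0 t1.
move=> /(fcvx y x0); rewrite fx0; case: (f y) (fNy y) => [b| |]// _; last first.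
  by rewrite leey.
rewrite -!EFinM -EFinD => h1 h2; have := lt_le_trans h2 h1; rewrite lte_fin lee_fin => h.
have {}h : - 1 < t * (b - a) by lra.
suff : - (2 / e * `|y - x0|) < b - a by lra.
have tE : t * (2 / e * `|y - x0|) = 1 by rewrite /t; field; rewrite !gt_eqF.
by rewrite -(ltr_pM2l t0) mulrN tE.
Qed.

Lemma subdiff_fin x u : subdiff f x u -> exists a, f x = a%:E.
Proof.
have [y [b fy]] := Gamma0_proper; case: fG => fNy _ _ _ /(_ y); rewrite fy.
by case: (f x) (fNy x) => [a| |]// _ _; exists a.
Qed.

Lemma subdiff_monotone x y u v : subdiff f x u -> subdiff f y v ->
  0 <= dot (x - y) (u - v).
Proof.
move=> xu yv; have [a fx] := subdiff_fin xu; have [b fy] := subdiff_fin yv.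
have := xu y; have := yv x; rewrite fx fy -!EFinD !lee_fin -opprB dotNl dotBr.
by rewrite !dotNl; lra.
Qed.

(** The midpoint of two almost minimizers of the strongly convex function
    f + |x - .|^2 / 2 gains an eighth of their squared distance. *)
Lemma prox_gap x (c : R) (y z : V) (a b : R) :
  (forall y, (c%:E <= f y + (`|x - y| ^+ 2 / 2)%:E)%E) ->
  f y = a%:E -> f z = b%:E ->
  `|y - z| ^+ 2 <= 4 * ((a + `|x - y| ^+ 2 / 2 - c) + (b + `|x - z| ^+ 2 / 2 - c)).
Proof.
move=> cP fy fz; have [fNy _ _ fcvx] := fG.
have h2 : 0 < (2^-1 : R) < 1 by lra.
have := fcvx y z _ h2; rewrite fy fz -!EFinM -EFinD => h.
have := le_trans (cP (2^-1 *: y + (1 - 2^-1) *: z)) (leeD2r _ h).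
rewrite -EFinD lee_fin.
have -> : x - (2^-1 *: y + (1 - 2^-1) *: z) = 2^-1 *: ((x - y) + (x - z)).
  by hilbert_ring.
have -> : y - z = (x - z) - (x - y) by hilbert_ring.
by rewrite sqr_normZ (sqr_normD (x - y)) (sqr_normB (x - z)) (dotC (x - z)); lra.
Qed.

(** A minimizing sequence is Cauchy by [prox_gap], and lower semicontinuity passes
    to its limit. *)
Lemma ex_prox x : argmin (fun y => (f y + (`|x - y| ^+ 2 / 2)%:E)%E) !=set0.
Proof.
have [fNy _ flsc fcvx] := fG; set q := fun y => _.
have qE y a : f y = a%:E -> q y = (a + `|x - y| ^+ 2 / 2)%:E by rewrite /q => ->.
have [c0 c0P] : exists c0 : R, forall y, (c0%:E <= q y)%E.
  have [x0 [c [M [M0 cP]]]] := Gamma0_minorant.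
  exists (c - M * `|x - x0| - M ^+ 2 / 2) => y.
  apply: le_trans (leeD2r _ (cP y)); rewrite -EFinD lee_fin.
  have : `|y - x0| <= `|x - y| + `|x - x0|.
    by rewrite -[`|x - y|]normrN opprB -(subrKA x) ler_normD.
  move/(ler_wpM2l M0); have := sqr_ge0 (M - `|x - y|); lra.
pose Q := [set a | exists y, q y = a%:E].
have Q0 : has_inf Q.
  split; last by exists c0 => a [y yE]; have := c0P y; rewrite yE lee_fin.
  have [y [a fy]] := Gamma0_proper.
  by exists (a + `|x - y| ^+ 2 / 2), y; exact: qE.
pose mu := inf Q.
have muP y : (mu%:E <= q y)%E.
  case E : (q y) (c0P y) => [a| |]//= _; last by rewrite leey.
  by rewrite lee_fin; apply: ge_inf; [exact: Q0.2|exists y].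
have /choice[y yP] : forall n : nat, exists y, (q y < (mu + n.+1%:R^-1)%:E)%E.
  move=> n; have n0 : 0 < n.+1%:R^-1 :> R by rewrite invr_gt0.
  by have [a [z zE] lta] := inf_adherent n0 Q0; exists z; rewrite zE lte_fin.
have /choice[fy fyP] : forall n, exists a, f (y n) = a%:E.
  move=> n; have := yP n; rewrite /q; case: (f (y n)) (fNy (y n)) => [a| |]// _ _.
  by exists a.
have yP' n : fy n + `|x - y n| ^+ 2 / 2 - mu < n.+1%:R^-1.
  by have := yP n; rewrite (qE _ _ (fyP n)) lte_fin ltrBlDl.
have yC : cvg (y @ \oo).
  apply: cauchy_cvg; apply/cauchyP => e e0.
  have e1 : 0 < e ^+ 2 / 8 by rewrite divr_gt0// exprn_gt0.
  have [N _ NP] := near_infty_natSinv_lt (PosNum e1).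
  exists (y N); exists N => // n /= Nn; rewrite -ball_normE/=.
  rewrite -ltr_sqr ?nnegrE ?(ltW e0)//.
  apply: le_lt_trans (prox_gap muP (fyP N) (fyP n)) _.
  have := yP' N; have := yP' n; have /= := NP N (leqnn N); have /= := NP n Nn.
  move: (n.+1%:R^-1) (N.+1%:R^-1) => ? ?; lra.
pose l := lim (y @ \oo); exists l => z; apply: le_trans (muP z).
rewrite leNgt; apply/negP => ltq.
have [a /andP[mua afl]] : exists a, ((mu - `|x - l| ^+ 2 / 2)%:E < a%:E < f l)%E.
  move: ltq; rewrite /q; case: (f l) (fNy l) => [b| |]// _.
    rewrite -EFinD lte_fin => h; exists ((mu - `|x - l| ^+ 2 / 2 + b) / 2).
    by rewrite !lte_fin; apply/andP; split; lra.
  by move=> _; exists (mu - `|x - l| ^+ 2 / 2 + 1); rewrite ltry lte_fin; lra.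
rewrite lte_fin in mua.
have [U Ul aU] := flsc l a afl.
have yl : y @ \oo --> l by exact: yC.
have dl : `|x - y n| ^+ 2 / 2 + a - n.+1%:R^-1 @[n --> \oo] --> `|x - l| ^+ 2 / 2 + a - 0.
  apply: cvgB; last exact: cvg_harmonic.
  apply: cvgD; last exact: cvg_cst.
  apply: cvgMl.
  under eq_cvg do rewrite expr2.
  by rewrite expr2; apply: cvgM; apply: cvg_norm; apply: cvgB => //; exact: cvg_cst.
suff : `|x - l| ^+ 2 / 2 + a - 0 <= mu by lra.
apply: (ler_cvg_to dl (cvg_cst mu)).
near=> n.
have : U (y n) by near: n; exact: yl.
by move/aU; rewrite fyP lte_fin; have := yP' n; move: (n.+1%:R^-1) => ?; lra.
Unshelve. all: by end_near.
Qed.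

(** Fermat's rule for the proximal subproblem. *)
Lemma prox_subdiff x : subdiff f (prox f x) (x - prox f x).
Proof.
have [fNy _ _ fcvx] := fG.
have := @getPex _ _ (ex_prox x); rewrite -/(prox f x); set p := prox f x => pP.
have [z [c fz]] := Gamma0_proper.
have [a fp] : exists a, f p = a%:E.
  have := pP z; rewrite fz; case: (f p) (fNy p) => [a| |]// _ _; by exists a.
move=> y; rewrite fp; case fy : (f y) (fNy y) => [b| |]// _; last by rewrite leey.
rewrite -EFinD lee_fin -subr_ge0.
apply: (@ge0_of_affine_perturbation _ _ (`|y - p| ^+ 2 / 2)) => t t01.
have := le_trans (pP (t *: y + (1 - t) *: p)) (leeD2r _ (fcvx y p t t01)).
rewrite fp fy -!EFinM -!EFinD lee_fin.
have -> : x - (t *: y + (1 - t) *: p) = (x - p) - t *: (y - p) by hilbert_ring.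
rewrite (sqr_normB (x - p)) sqr_normZ dotZr (dotC _ (x - p)); lra.
Qed.

(** Monotonicity of the subdifferential makes the solution of Fermat's rule
    unique, so that [prox] can be computed. *)
Lemma subdiff_prox x p : subdiff f p (x - p) -> prox f x = p.
Proof.
move=> /(subdiff_monotone (prox_subdiff x)).
rewrite (_ : _ - _ - _ = - (prox f x - p)); last by hilbert_ring.
rewrite dotNr dot_normE oppr_ge0 => h; apply/eqP; rewrite -subr_eq0 -normr_eq0.
by rewrite -sqrf_eq0 eq_le h exprn_ge0.
Qed.

Lemma prox_firm x y :
  `|prox f x - prox f y| ^+ 2 + `|(x - prox f x) - (y - prox f y)| ^+ 2 <= `|x - y| ^+ 2.
Proof.
have := subdiff_monotone (prox_subdiff x) (prox_subdiff y).
set p := prox f x; set q := prox f y.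
have -> : x - y = (p - q) + ((x - p) - (y - q)) by hilbert_ring.
by rewrite (sqr_normD (p - q)); lra.
Qed.

Lemma prox_nonexpansive x y : `|prox f x - prox f y| <= `|x - y|.
Proof.
rewrite -ler_sqr ?nnegrE//; apply: le_trans (prox_firm x y).
by rewrite lerDl exprn_ge0.
Qed.

(** Monotonicity is tested against the proximal point p of [y + u] and its
    subgradient y + u - p: the limit inequality forces p = y. This replaces weak
    lower semicontinuity of f. *)
Lemma subdiff_weak_strong_closed {T : Type} {F : set_system T} {FF : ProperFilter F}
    (ys us : T -> V) (y u : V) (M : R) :
  (forall t, subdiff f (ys t) (us t)) -> (\forall t \near F, `|ys t| <= M) ->
  (forall h, dot (ys t) h @[t --> F] --> dot y h) -> us @ F --> u ->
  subdiff f y u.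
Proof.
move=> sub yM yw uu; set p := prox f (y + u).
have pP := prox_subdiff (y + u); rewrite -/p in pP.
have l1 : dot (ys t - p) (us t - (y + u - p)) @[t --> F] --> dot (y - p) (p - y).
  have -> : dot (y - p) (p - y) = 0 + dot (y - p) (p - y) by rewrite add0r.
  have E t : dot (ys t - p) (us t - (y + u - p)) =
      dot (ys t - p) (us t - u) + (dot (ys t) (p - y) - dot p (p - y)).
    by rewrite -dotBl -dotDr; congr dot; hilbert_ring.
  under eq_cvg do rewrite E.
  apply: cvgD; last by rewrite dotBl; apply: cvgB; [exact: yw|exact: cvg_cst].
  apply: (@cvg_dot_bounded _ _ _ _ _ _ _ (M + `|p|)).
    by apply: filterS yM => t yt; rewrite (le_trans (ler_normB _ _))// lerD2r.
  by apply/subr_cvg0.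
have : 0 <= dot (y - p) (p - y).
  apply: (cvg_ge0 l1).
  by near=> t; exact: subdiff_monotone.
rewrite -(opprB y p) dotNr dot_normE oppr_ge0 => h.
have : `|y - p| ^+ 2 == 0 by rewrite eq_le h exprn_ge0.
rewrite sqrf_eq0 normr_eq0 subr_eq0 => /eqP yp.
by move: pP; rewrite -yp addrAC subrr add0r.
Unshelve. all: by end_near.
Qed.

End gamma0.

(** * Riesz representation, adjoints and operator norms *)

(** The bounded form - phi belongs to Gamma0, and its subgradient at the proximal
    point of the origin is, up to sign, the representing vector. *)
Lemma riesz_representation {R : realType} {V : hilbertType R} (phi : V -> R) (M : R) :
  (forall a x y, phi (a *: x + y) = a * phi x + phi y) ->
  (forall x, `|phi x| <= M * `|x|) -> exists u, forall x, phi x = dot x u.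
Proof.
move=> lin bnd.
have phi0 : phi 0 = 0.
  by apply/eqP; rewrite -normr_le0; have := bnd 0; rewrite normr0 mulr0.
have phiN x : phi (- x) = - phi x.
  by have := lin (-1) x 0; rewrite scaleN1r !addr0 phi0 addr0 mulN1r.
have phiD x y : phi (x + y) = phi x + phi y.
  by have := lin 1 x y; rewrite scale1r mul1r.
have phiZ a x : phi (a *: x) = a * phi x.
  by have := lin a x 0; rewrite addr0 phi0 addr0.
pose f x := (- phi x)%:E.
have fG : Gamma0 f.
  split=> // [|x a|x y t t01].
  - by exists 0.
  - rewrite lte_fin => h.
    have e0 : 0 < (- phi x - a) / (`|M| + 1).
      by rewrite divr_gt0 ?subr_gt0// ltr_wpDl.
    have M0 : 0 < `|M| + 1 by rewrite ltr_wpDl.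
    exists (ball x ((- phi x - a) / (`|M| + 1))); first exact: nbhsx_ballx.
    move=> y; rewrite -ball_normE/= ltr_pdivlMr// => yx.
    rewrite lte_fin -(opprK a) ltrN2.
    have : `|phi (x - y)| < - phi x - a.
      apply: le_lt_trans yx; apply: le_trans (bnd _) _; rewrite mulrC ler_wpM2l//.
      by apply: le_trans (ler_norm M) _; rewrite lerDl.
    by rewrite ltr_norml phiD phiN; lra.
  - by rewrite /f -!EFinM -EFinD lee_fin phiD !phiZ; lra.
have := prox_subdiff fG 0; set p := prox f 0 => sub.
exists p => x.
have h y : phi y <= dot y p.
  have := sub (y + p); rewrite addrK sub0r dotNr /f -EFinD lee_fin phiD; lra.
by apply/eqP; rewrite eq_le h/= -lerN2 -phiN -dotNl h.
Qed.

Section adjoint.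
Context {R : realType} {V W : hilbertType R}.
Variable L : {linear V -> W}.
Hypothesis L_bounded : exists M : R, forall x, `|L x| <= M * `|x|.

Lemma adjointP x y : dot (L x) y = dot x (adjoint L y).
Proof.
have [M LM] := L_bounded.
suff : [set x | forall z, dot (L z) y = dot z x] !=set0 by move/getPex; exact.
apply: (@riesz_representation R V (fun z => dot (L z) y) (M * `|y|)) => [a u v|z].
  by rewrite linearP dotDl dotZl.
by apply: le_trans (cauchy_schwarz _ _) _; rewrite mulrAC ler_wpM2r.
Qed.

Lemma adjointZ a y : adjoint L (a *: y) = a *: adjoint L y.
Proof. by apply: eq_dotr => x; rewrite -adjointP !dotZr !adjointP. Qed.

Lemma adjoint_bounded : exists M : R, forall y, `|adjoint L y| <= M * `|y|.
Proof.
have [M LM] := L_bounded; exists `|M| => y.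
have [->|n0] := eqVneq (`|adjoint L y|) 0; first by rewrite mulr_ge0.
rewrite -(ler_pM2r (_ : 0 < `|adjoint L y|)) ?lt0r ?n0 ?normr_ge0//.
rewrite -expr2 -dot_normE -adjointP; apply: le_trans (dot_le_norm _ _) _.
rewrite mulrAC ler_wpM2r//; apply: le_trans (LM _) _.
by rewrite ler_wpM2r// ler_norm.
Qed.

End adjoint.

Section opnorm.
Context {R : realType} {V W : hilbertType R}.
Variable S : V -> W.
Hypothesis S_homogeneous : forall (a : R) x, S (a *: x) = a *: S x.
Hypothesis S_bounded : exists M : R, forall x, `|S x| <= M * `|x|.

(** Boundedness is what makes the supremum defining [opnorm] meaningful. *)
Lemma le_opnorm x : `|S x| <= opnorm S * `|x|.
Proof.
have [M SM] := S_bounded.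
have [->|x0] := eqVneq x 0.
  by have := SM 0; rewrite !normr0 !mulr0.
have nx : 0 < `|x| by rewrite normr_gt0.
rewrite -ler_pdivrMr//; apply: ub_le_sup.
  exists `|M| => _ [y /= y1 <-]; apply: le_trans (SM y) _.
  apply: (@le_trans _ _ (`|M| * `|y|)); first by rewrite ler_wpM2r// ler_norm.
  by rewrite ler_piMr.
exists (`|x|^-1 *: x) => /=.
  by rewrite normrZ normfV normr_id mulVf ?gt_eqF.
by rewrite S_homogeneous normrZ normfV normr_id mulrC.
Qed.

Lemma opnorm_ge0 : 0 <= opnorm S.
Proof.
have [M SM] := S_bounded; apply: ub_le_sup.
  exists `|M| => _ [y /= y1 <-]; apply: le_trans (SM y) _.
  apply: (@le_trans _ _ (`|M| * `|y|)); first by rewrite ler_wpM2r// ler_norm.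
  by rewrite ler_piMr.
exists 0; rewrite /= ?normr0//.
by rewrite -(scale0r (0 : V)) S_homogeneous scale0r normr0.
Qed.

End opnorm.

(** * Gradients of convex functions *)

Section convex_gradient.
Context {R : realType} {V : hilbertType R}.
Variable g : V -> R.
Hypothesis g_diff : forall x, differentiable g x.

(** The differential is a bounded linear form, hence has a Riesz vector. *)
Lemma gradP x h : 'd g x h = dot h (grad g x).
Proof.
suff : [set u | forall h, 'd g x h = dot h u] !=set0 by move/getPex; exact.
have [k k0 kP] := linear_lipschitz (diff_continuous (g_diff x)).
apply: (@riesz_representation R V _ k) => [a u v|z]; last exact: kP.
by rewrite linearP.
Qed.

Hypothesis g_convex : convex_function [set: convex_lmodType V] g.

Lemma convex_functionE x y t : 0 < t < 1 ->
  g (t *: x + (1 - t) *: y) <= t * g x + (1 - t) * g y.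
Proof.
move=> /andP[t0 t1].
by have := @g_convex (Itv01 (ltW t0) (ltW t1)) x y; rewrite !in_setT => /(_ isT isT).
Qed.

(** Were the tangent above g at y, the difference quotients along the segment,
    which convexity bounds by g y - g x, could not tend to the derivative. *)
Lemma gradient_inequality x y : g x + dot (y - x) (grad g x) <= g y.
Proof.
rewrite -gradP -deriveE// leNgt; apply/negP => lt.
set D := 'D_(y - x) g x in lt.
have e0 : 0 < g x + D - g y by rewrite subr_gt0.
have : h^-1 *: ((g \o shift x) (h *: (y - x)) - g x) @[h --> 0^'] --> D.
  exact: diff_derivable.
move=> /cvgrPdist_lt /(_ _ e0) [d /= d0 dP].
set t := Num.min (d / 2) (2^-1).
have t0 : 0 < t by rewrite lt_min divr_gt0//=; lra.
have t1 : t < 1 by rewrite gt_min; apply/orP; right; lra.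
have td : t < d by rewrite gt_min; apply/orP; left; lra.
have /dP : ball_ (fun x => `|x|) 0 d t by rewrite /= sub0r normrN gtr0_norm.
rewrite gt_eqF// => /(_ isT); rewrite ltr_norml => /andP[_].
rewrite /= (_ : t *: (y - x) + x = t *: y + (1 - t) *: x); last by hilbert_ring.
have := @convex_functionE y x t; rewrite t0 t1 => /(_ isT) h1.
apply/negP; rewrite -leNgt.
suff : t^-1 *: (g (t *: y + (1 - t) *: x) - g x) <= g y - g x by lra.
rewrite [_ *: _]mulrC ler_pdivrMr//; lra.
Qed.

Variable tau : R.
Hypothesis tau_gt0 : 0 < tau.
Hypothesis g_lipschitz : tau.-lipschitz (grad g).

Lemma grad_lipschitz x y : `|grad g x - grad g y| <= tau * `|x - y|.
Proof. exact: (@g_lipschitz (x, y)). Qed.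

(** Cutting the segment into N pieces and adding up the gradient inequalities at
    the right endpoints gives a Riemann sum, which replaces the integral of the
    gradient along the segment. *)
Lemma descent_lemma x y :
  g y <= g x + dot (y - x) (grad g x) + tau / 2 * `|y - x| ^+ 2.
Proof.
set h := y - x; set D := dot h (grad g x).
have step (N k : nat) : (0 < N)%N ->
    g (x + (k%:R / N%:R) *: h) <=
    g x + k%:R / N%:R * D + tau * `|h| ^+ 2 * (k%:R * (k%:R + 1) / (2 * N%:R ^+ 2)).
  move=> N0; have N0' : 0 < N%:R :> R by rewrite ltr0n.
  elim: k => [|k IH]; first by rewrite !mul0r scale0r !addr0 mulr0 addr0.
  set z := x + (k.+1%:R / N%:R) *: h; set w := x + (k%:R / N%:R) *: h in IH.
  have := gradient_inequality z w.
  have -> : w - z = - N%:R^-1 *: h.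
    rewrite /w /z -natr1 mulrDl mul1r; hilbert_ring.
  rewrite dotZl mulNr => grd.
  have : dot h (grad g z) <= D + tau * (k%:R + 1) / N%:R * `|h| ^+ 2.
    rewrite -lerBlDl -dotBr; apply: le_trans (dot_le_norm _ _) _.
    apply: le_trans (ler_wpM2l _ (grad_lipschitz _ _)) _ => //.
    rewrite (_ : z - x = (k.+1%:R / N%:R) *: h); last by rewrite /z; hilbert_ring.
    rewrite normrZ ger0_norm ?divr_ge0// -natr1 le_eqVlt; apply/orP; left; apply/eqP.
    by ring.
  move/(ler_wpM2l (ltW (_ : 0 < N%:R^-1))); rewrite invr_gt0 => /(_ N0') grd2.
  apply: le_trans (_ : g w + N%:R^-1 * (D + tau * (k%:R + 1) / N%:R * `|h| ^+ 2) <= _).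
    by lra.
  apply: le_trans (lerD IH (lexx _)) _.
  rewrite -natr1 le_eqVlt; apply/orP; left; apply/eqP; by field; rewrite gt_eqF.
have lim n : 0 <= g x + D + tau / 2 * `|h| ^+ 2 - g y + tau * `|h| ^+ 2 / 2 * n.+1%:R^-1.
  have := step n.+1 n.+1 isT; rewrite divff ?pnatr_eq0// scale1r.
  rewrite (_ : x + h = y); last by rewrite /h addrC subrK.
  rewrite mul1r; move=> gy.
  have : n.+1%:R != 0 :> R by rewrite pnatr_eq0.
  move: n.+1%:R gy => N gy N0.
  rewrite -subr_ge0 in gy; apply: le_trans gy _.
  rewrite le_eqVlt; apply/orP; left; apply/eqP.
  by field; rewrite N0.
have cv : g x + D + tau / 2 * `|h| ^+ 2 - g y + tau * `|h| ^+ 2 / 2 * n.+1%:R^-1 @[n --> \oo]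
    --> g x + D + tau / 2 * `|h| ^+ 2 - g y + tau * `|h| ^+ 2 / 2 * 0.
  by apply: cvgD; [exact: cvg_cst|apply: cvgMr; exact: cvg_harmonic].
have := cvg_ge0 cv (nearW _ lim); rewrite mulr0 addr0 => e.
rewrite subr_ge0 in e; exact: e.
Qed.

(** The lower bound of the gradient inequality at x and the upper bound of the
    descent lemma at y are compared at y - d / tau, the gradient step from y for
    g minus its tangent at x; d is the difference of the gradients. *)
Lemma baillon_haddad_half x y :
  g x + dot (y - x) (grad g x) + `|grad g y - grad g x| ^+ 2 / (2 * tau) <= g y.
Proof.
have [d dE] : exists d, grad g y = d + grad g x.
  by exists (grad g y - grad g x); rewrite subrK.
have -> : grad g y - grad g x = d by rewrite dE addrK.
have lo := gradient_inequality x (y - tau^-1 *: d).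
have up := descent_lemma y (y - tau^-1 *: d).
rewrite [y - _ - x]addrAC dotBl dotZl in lo.
rewrite [y - _ - y]addrAC subrr sub0r normrN sqr_normZ dotNl dotZl dE in up.
rewrite dotDr dot_normE mulrDr in up.
have E1 : tau / 2 * (tau^-1 ^+ 2 * `|d| ^+ 2) = tau^-1 * `|d| ^+ 2 / 2.
  by field; rewrite gt_eqF.
have -> : `|d| ^+ 2 / (2 * tau) = tau^-1 * `|d| ^+ 2 / 2 by field; rewrite gt_eqF.
rewrite E1 in up; move: (le_trans lo up).
move: (tau^-1 * `|d| ^+ 2) (tau^-1 * dot d (grad g x)) (dot (y - x) _) (g x) (g y).
by move=> *; lra.
Qed.

(** Adding the sharpened gradient inequality to its mirror image. *)
Lemma baillon_haddad x y :
  `|grad g x - grad g y| ^+ 2 / tau <= dot (x - y) (grad g x - grad g y).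
Proof.
have lo := baillon_haddad_half x y; have up := baillon_haddad_half y x.
rewrite -(opprB (grad g x)) normrN in lo; rewrite -(opprB y x) dotNl in up.
rewrite -(opprB y x) dotNl dotBr.
have E : `|grad g x - grad g y| ^+ 2 / (2 * tau) = `|grad g x - grad g y| ^+ 2 / tau / 2.
  by field; rewrite gt_eqF.
rewrite E in lo up; move: lo up.
move: (_ / tau) (dot (y - x) (grad g y)) (dot (y - x) (grad g x)) (g x) (g y).
by move=> a b c u v; lra.
Qed.

End convex_gradient.

(** * Direct Hilbert sums *)

Section direct_sum.
Context {R : realType} {I : finType} {H : I -> hilbertType R}.
Implicit Types x y : hsum H.

Lemma hsum_dotE x y : dot x y = \sum_i dot (x i) (y i).
Proof. by []. Qed.

Lemma hsum_sqr_norm x : `|x| ^+ 2 = \sum_i `|x i| ^+ 2.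
Proof. by rewrite -dot_normE hsum_dotE; apply: eq_bigr => i _; rewrite dot_normE. Qed.

Lemma hsum_coord_le x i : `|x i| <= `|x|.
Proof.
rewrite -ler_sqr ?nnegrE// hsum_sqr_norm (bigD1 i)//= lerDl sumr_ge0// => j _.
Qed.

Lemma hsum_norm_lt x (e : R) :
  (forall i, `|x i| < e / (#|I|.+1)%:R) -> 0 < e -> `|x| < e.
Proof.
move=> xe e0; apply: (@le_lt_trans _ _ (\sum_i `|x i|)).
  rewrite -ler_sqr ?nnegrE ?sumr_ge0// hsum_sqr_norm.
  rewrite [leRHS]expr2 mulr_suml; apply: ler_sum => i _.
  by rewrite expr2 ler_wpM2l// (bigD1 i)//= lerDl sumr_ge0.
apply: (@le_lt_trans _ _ (\sum_(i in I) e / (#|I|.+1)%:R)).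
  by apply: ler_sum => i _; exact: ltW (xe i).
by rewrite sumr_const -[ltLHS]mulr_natr mulrAC ltr_pdivrMr// ltr_pM2l// ltr_nat.
Qed.

Lemma hsum_sumE (J : finType) (F : J -> hsum H) i : (\sum_j F j) i = \sum_j F j i.
Proof. by elim/big_rec2: _ => [|j u v _ <-]. Qed.

Lemma hsumP x y : (forall i, x i = y i) -> x = y.
Proof. by move=> e; apply: functional_extensionality_dep. Qed.

Lemma dot_dfwith x i (h : H i) : dot x (dfwith (0 : hsum H) i h) = dot (x i) h.
Proof.
rewrite hsum_dotE (bigD1 i)//= dfwithin big1 ?addr0// => j ji.
by rewrite dfwithout 1?eq_sym// dot0r.
Qed.

End direct_sum.

(** * The composite problem and its forward-backward step *)

Section scaled_gamma0.
Context {R : realType} {V : hilbertType R}.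
Variables (f : V -> \bar R) (gamma : R).
Hypotheses (fG : Gamma0 f) (gamma_gt0 : 0 < gamma).

Lemma Gamma0_scale : Gamma0 (fun y => (gamma%:E * f y)%E).
Proof.
have [fNy [y0 y0P] flsc fcvx] := fG; split.
- move=> x; case: (f x) (fNy x) => [a| |]// _; last by rewrite gt0_muley ?lte_fin.
- by exists y0; case: (f y0) y0P (fNy y0).
- move=> x a h.
  have [|U Ux UP] := flsc x (a / gamma).
    case: (f x) (fNy x) h => [b| |]// _; last by rewrite ltry.
    by rewrite -EFinM !lte_fin ltr_pdivrMr// mulrC.
  exists U => // y /UP; case: (f y) (fNy y) => [b| |]// _; last first.
    by move=> _; rewrite gt0_muley ?lte_fin ?ltry.
  by rewrite -EFinM !lte_fin ltr_pdivrMr// mulrC.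
- move=> x y t t01; have := fcvx x y t t01; have /andP[t0 t1] := t01.
  have t1' : 0 < 1 - t by rewrite subr_gt0.
  case: (f x) (fNy x) => [a| |]// _; case: (f y) (fNy y) => [b| |]// _; rewrite
    ?[(gamma%:E * +oo)%E]gt0_muley ?[(t%:E * +oo)%E]gt0_muley
    ?[((1 - t)%:E * +oo)%E]gt0_muley ?lte_fin ?leey//.
  rewrite -!EFinM -!EFinD; case: (f _) => [c| |]//; last first.
    by move=> _; rewrite gt0_muleNy ?lte_fin// leNye.
  by rewrite -EFinM !lee_fin; have := ltW gamma_gt0; nra.
Qed.

Lemma subdiff_scale x u : subdiff (fun y => (gamma%:E * f y)%E) x u ->
  subdiff f x (gamma^-1 *: u).
Proof.
move=> h y; have [fNy _ _ _] := fG; have [a fx] := subdiff_fin Gamma0_scale h.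
have {}fx : exists b, f x = b%:E.
  by move: fx; case: (f x) (fNy x) => [b| |]//; rewrite ?gt0_muley// => _ _; exists b.
have [b fxb] := fx; have := h y; rewrite fxb.
case: (f y) (fNy y) => [c| |]// _; last by rewrite !leey.
rewrite -!EFinM -!EFinD !lee_fin dotZr => k.
by rewrite -(ler_pM2l gamma_gt0) mulrDr mulrA mulfV ?gt_eqF// mul1r.
Qed.

Lemma scale_subdiff x u : subdiff f x u ->
  subdiff (fun y => (gamma%:E * f y)%E) x (gamma *: u).
Proof.
move=> h y; have [fNy _ _ _] := fG; have [b fx] := subdiff_fin fG h.
have := h y; rewrite fx.
case: (f y) (fNy y) => [c| |]// _; last by rewrite gt0_muley ?lte_fin// !leey.
by rewrite -!EFinM -!EFinD !lee_fin dotZr -mulrDr ler_pM2l.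
Qed.

End scaled_gamma0.

(** The smooth part seen from the product space: the adjoint enters only through
    the pairing, and N k bounds the squared norm of the k-th coupling map. *)
Section smooth_part.
Context {R : realType} {p : nat} {V : hilbertType R} {G : 'I_p -> hilbertType R}.
Variables (g : forall k, G k -> R) (A : forall k, V -> G k) (B : V -> V)
  (tau N : 'I_p -> R) (theta : R).
Arguments g : clear implicits.
Arguments A : clear implicits.
Hypotheses (tau_gt0 : forall k, 0 < tau k)
  (g_convex : forall k, convex_function [set: convex_lmodType (G k)] (g k))
  (g_differentiable : forall k x, differentiable (g k) x)
  (g_lipschitz : forall k, (tau k).-lipschitz (grad (g k)))
  (AB : forall k x y, A k (x - y) = A k x - A k y)
  (AN : forall k x, `|A k x| ^+ 2 <= N k * `|x| ^+ 2)
  (dot_B : forall x y, dot x (B y) = \sum_k dot (A k x) (grad (g k) (A k y)))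
  (theta_bounds : 0 < theta <= (\sum_k tau k * N k)^-1).
Implicit Types x y z : V.

Let theta_gt0 : 0 < theta. Proof. by case/andP: theta_bounds. Qed.

(** Baillon-Haddad for every g_k, transported by the coupling maps. Young's
    inequality with weight theta recombines the p contributions into the
    constant of the theorem. *)
Lemma smooth_cocoercive x y : theta * `|B x - B y| ^+ 2 <= dot (x - y) (B x - B y).
Proof.
pose d k := grad (g k) (A k x) - grad (g k) (A k y).
have dotd z : dot z (B x - B y) = \sum_k dot (A k z) (d k).
  by rewrite dotBr !dot_B -sumrB; apply: eq_bigr => k _; rewrite dotBr.
set b := B x - B y in dotd *.
have S0 : 0 < (\sum_k tau k * N k)^-1.
  by case/andP: theta_bounds => t0; exact: lt_le_trans.
have SN : theta * (\sum_k tau k * N k) <= 1.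
  rewrite -ler_pdivlMr; first by rewrite mul1r; case/andP: theta_bounds.
  by rewrite -invr_gt0.
have young : 2 * theta * `|b| ^+ 2 <=
    theta ^+ 2 * (\sum_k tau k * N k) * `|b| ^+ 2 + \sum_k `|d k| ^+ 2 / tau k.
  rewrite -{1}dot_normE {1}dotd mulr_sumr mulr_sumr mulr_suml -big_split/=.
  apply: ler_sum => k _.
  apply: le_trans (_ : theta ^+ 2 * tau k * `|A k b| ^+ 2 + `|d k| ^+ 2 / tau k <= _).
    have tk := tau_gt0 k.
    have : 0 <= `|(theta * tau k) *: A k b - d k| ^+ 2 / tau k.
      by rewrite divr_ge0 ?exprn_ge0// ltW.
    rewrite sqr_normB sqr_normZ dotZl => h; rewrite -subr_ge0.
    apply: le_trans h _; rewrite le_eqVlt; apply/orP; left; apply/eqP.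
    by field; rewrite gt_eqF.
  rewrite lerD2r -(mulrA _ _ (`|b| ^+ 2)) -!(mulrA (theta ^+ 2)).
  apply: ler_wpM2l; first exact: exprn_ge0 (ltW theta_gt0).
  by rewrite -mulrA; apply: ler_wpM2l (AN _ _); exact: ltW.
have coco : \sum_k `|d k| ^+ 2 / tau k <= dot (x - y) b.
  rewrite dotd; apply: ler_sum => k _; rewrite AB.
  exact: baillon_haddad.
have : theta ^+ 2 * (\sum_k tau k * N k) * `|b| ^+ 2 <= theta * `|b| ^+ 2.
  rewrite ler_wpM2r ?exprn_ge0// expr2 -mulrA -[leRHS]mulr1 ler_wpM2l//.
  exact: ltW.
lra.
Qed.

Lemma smooth_lipschitz x y : `|B x - B y| <= theta^-1 * `|x - y|.
Proof.
have [->|n0] := eqVneq (`|B x - B y|) 0; first by rewrite mulr_ge0// invr_ge0 ltW.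
have b0 : 0 < `|B x - B y| by rewrite lt0r n0 normr_ge0.
rewrite ler_pdivlMl// -(ler_pM2r b0) -mulrA -expr2.
exact: le_trans (smooth_cocoercive x y) (dot_le_norm _ _).
Qed.

Lemma smooth_gradient_inequality x y :
  \sum_k g k (A k x) + dot (y - x) (B x) <= \sum_k g k (A k y).
Proof.
rewrite dot_B -big_split/=; apply: ler_sum => k _.
by rewrite AB; exact: gradient_inequality.
Qed.

Lemma smooth_descent x y :
  \sum_k g k (A k y) <= \sum_k g k (A k x) + dot (y - x) (B x)
    + (\sum_k tau k / 2 * N k) * `|y - x| ^+ 2.
Proof.
rewrite dot_B mulr_suml -!big_split/=; apply: ler_sum => k _.
have := descent_lemma (@g_differentiable k) (@g_convex k) (@g_lipschitz k) (A k x) (A k y).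
move/le_trans; apply.
rewrite -AB lerD2l -[leRHS]mulrA; apply: ler_wpM2l (AN _ _).
by rewrite divr_ge0// ltW.
Qed.

End smooth_part.

(** The algebra behind one relaxed forward-backward step: [tx] and [z] stand for
    the images of x and of a fixed point z, [bx] and [bz] for the gradients. *)
Lemma forward_backward_gain {R : realType} {V : hilbertType R} (x z tx bx bz : V)
    (theta gamma lambda : R) : 0 < gamma -> 0 <= lambda <= 1 ->
  theta * `|bx - bz| ^+ 2 <= dot (x - z) (bx - bz) ->
  `|tx - z| ^+ 2 + `|(x - gamma *: bx - tx) - (z - gamma *: bz - z)| ^+ 2
    <= `|(x - gamma *: bx) - (z - gamma *: bz)| ^+ 2 ->
  `|x + lambda *: (tx - x) - z| ^+ 2 <= `|x - z| ^+ 2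
   - lambda * (gamma * (2 * theta - gamma) * `|bx - bz| ^+ 2
     + `|x - tx - gamma *: (bx - bz)| ^+ 2).
Proof.
move=> g0 /andP[l0 l1] coco firm.
have E1 : (x - gamma *: bx - tx) - (z - gamma *: bz - z) =
    x - tx - gamma *: (bx - bz) by hilbert_ring.
have E2 : (x - gamma *: bx) - (z - gamma *: bz) = (x - z) - gamma *: (bx - bz).
  by hilbert_ring.
rewrite E1 E2 (sqr_normB (x - z)) sqr_normZ dotZr in firm.
have gain : `|tx - z| ^+ 2 <= `|x - z| ^+ 2
   - (gamma * (2 * theta - gamma) * `|bx - bz| ^+ 2
     + `|x - tx - gamma *: (bx - bz)| ^+ 2).
  by have := ler_wpM2l (ltW (mulr_gt0 (ltr0n _ 2) g0)) coco; lra.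
have -> : x + lambda *: (tx - x) - z = (1 - lambda) *: (x - z) + lambda *: (tx - z).
  by hilbert_ring.
have cvx : `|(1 - lambda) *: (x - z) + lambda *: (tx - z)| ^+ 2 <=
    (1 - lambda) * `|x - z| ^+ 2 + lambda * `|tx - z| ^+ 2.
  rewrite -subr_ge0 (sqr_normD ((1 - lambda) *: _)) !sqr_normZ dotZl dotZr.
  rewrite (_ : _ - _ = (lambda * (1 - lambda)) * `|(x - z) - (tx - z)| ^+ 2).
    by rewrite !mulr_ge0 ?exprn_ge0// subr_ge0.
  by rewrite (sqr_normB (x - z)); ring.
apply: le_trans cvx _; have := ler_wpM2l l0 gain; lra.
Qed.

Section composite.
Context {R : realType} {m p : nat} {H : 'I_m -> hilbertType R}
  {G : 'I_p -> hilbertType R}.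
Variables (f : forall i, H i -> \bar R) (g : forall k, G k -> R)
  (L : forall k i, {linear H i -> G k}) (tau : 'I_p -> R) (theta : R).
Arguments f : clear implicits.
Arguments g : clear implicits.
Hypotheses (f_Gamma0 : forall i, Gamma0 (f i))
  (tau_gt0 : forall k, 0 < tau k)
  (g_convex : forall k, convex_function [set: convex_lmodType (G k)] (g k))
  (g_differentiable : forall k x, differentiable (g k) x)
  (g_lipschitz : forall k, (tau k).-lipschitz (grad (g k)))
  (L_bounded : forall k i, exists M : R, forall x, `|L k i x| <= M * `|x|)
  (theta_bounds : 0 < theta <=
      (\sum_k tau k * opnorm (fun y : G k => \sum_i L k i (adjoint (L k i) y)))^-1).
Implicit Types x y z : hsum H.

Let B := coupled_grad g L.
Let N k := opnorm (fun y : G k => \sum_i L k i (adjoint (L k i) y)).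
Let adj k (u : G k) : hsum H := fun i => adjoint (L k i) u.
Let theta_gt0 : 0 < theta. Proof. by case/andP: theta_bounds. Qed.

Lemma couplingB k x y : coupling L k (x - y) = coupling L k x - coupling L k y.
Proof. by rewrite /coupling -sumrB; apply: eq_bigr => i _; rewrite -linearB. Qed.

Lemma dot_coupling k x u : dot (coupling L k x) u = dot x (adj u).
Proof. by rewrite dot_suml hsum_dotE; apply: eq_bigr => i _; exact: adjointP. Qed.

Let gram k (u : G k) := \sum_i L k i (adjoint (L k i) u).

Let gramZ k a u : gram (a *: u) = a *: @gram k u.
Proof. by rewrite scaler_sumr; apply: eq_bigr => i _; rewrite adjointZ// linearZ. Qed.

Let gram_bounded k : exists M : R, forall u, `|@gram k u| <= M * `|u|.
Proof.
have /choice[M MP] : forall i, exists M : R, forall u,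
    `|L k i (adjoint (L k i) u)| <= M * `|u|.
  move=> i; have [M1 M1P] := L_bounded k i.
  have [M2 M2P] := adjoint_bounded (L_bounded k i).
  exists (`|M1| * M2) => u; apply: le_trans (M1P _) _.
  apply: le_trans (_ : `|M1| * `|adjoint (L k i) u| <= _).
    by rewrite ler_wpM2r// ler_norm.
  by rewrite -mulrA ler_wpM2l.
exists (\sum_i M i) => u; apply: le_trans (ler_norm_sum _ _ _) _.
by rewrite mulr_suml; apply: ler_sum.
Qed.

(** The squared norm of the adjoint is a quadratic form of the Gram operator,
    whose opnorm is the constant of the theorem. *)
Lemma sqr_norm_adj k (u : G k) : `|adj u| ^+ 2 <= N k * `|u| ^+ 2.
Proof.
rewrite -dot_normE -dot_coupling; apply: le_trans (dot_le_norm _ _) _.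
rewrite expr2 mulrA ler_wpM2r//.
exact: (le_opnorm (@gramZ k) (gram_bounded k) u).
Qed.

(** A coupling map and its adjoint have the same norm, so the bound for the
    adjoint, which is the one that opnorm of the Gram operator expresses, carries
    over. *)
Lemma sqr_norm_coupling k x : `|coupling L k x| ^+ 2 <= N k * `|x| ^+ 2.
Proof.
set u := coupling L k x.
have N0 : 0 <= N k by exact: (opnorm_ge0 (@gramZ k) (gram_bounded k)).
have [->|u0] := eqVneq (`|u|) 0; first by rewrite expr0n mulr_ge0// exprn_ge0.
have uu : 0 < `|u| ^+ 2 by rewrite exprn_gt0// lt0r u0 normr_ge0.
rewrite -(ler_pM2l uu).
apply: (@le_trans _ _ (`|x| ^+ 2 * `|adj u| ^+ 2)).
  rewrite -expr2 -exprMn ler_sqr ?nnegrE ?mulr_ge0 ?exprn_ge0//.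
  by rewrite -dot_normE {1}/u dot_coupling dot_le_norm.
rewrite [leRHS]mulrA [leRHS]mulrC; apply: ler_wpM2l; first exact: exprn_ge0.
by rewrite [leRHS]mulrC; exact: sqr_norm_adj.
Qed.

Lemma dot_coupled_grad x y :
  dot x (B y) = \sum_k dot (coupling L k x) (grad (g k) (coupling L k y)).
Proof.
have -> : B y = \sum_k adj (grad (g k) (coupling L k y)).
  by apply: hsumP => i; rewrite hsum_sumE.
by rewrite dot_sumr; apply: eq_bigr => k _; rewrite dot_coupling.
Qed.

Lemma coupled_grad_cocoercive x y :
  theta * `|B x - B y| ^+ 2 <= dot (x - y) (B x - B y).
Proof.
exact: (smooth_cocoercive tau_gt0 g_convex g_differentiable g_lipschitz couplingB
  sqr_norm_coupling dot_coupled_grad theta_bounds).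
Qed.

Lemma coupled_grad_lipschitz x y : `|B x - B y| <= theta^-1 * `|x - y|.
Proof.
exact: (smooth_lipschitz tau_gt0 g_convex g_differentiable g_lipschitz couplingB
  sqr_norm_coupling dot_coupled_grad theta_bounds).
Qed.

Let Phi x : R := \sum_k g k (coupling L k x).

Lemma objectiveE x (a : 'I_m -> R) : (forall i, f i (x i) = (a i)%:E) ->
  objective f g L x = (\sum_i a i + Phi x)%:E.
Proof.
by move=> fa; rewrite /objective EFinD; congr (_ + _)%E; rewrite -sumEFin; exact: eq_bigr.
Qed.

(** A solution has a finite objective, because the objective is finite at a
    point of the product of the domains. *)
Lemma argmin_fin z : argmin (objective f g L) z ->
  exists a : 'I_m -> R, forall i, f i (z i) = (a i)%:E.
Proof.
move=> zP; suff: forall i, exists a : R, f i (z i) = a%:E by move=> /choice[a aP]; exists a.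
move=> i.
have fNy j (y : H j) : f j y != -oo%E by case: (f_Gamma0 j) => /(_ y).
pose w : hsum H := fun j => projT1 (cid (Gamma0_proper (f_Gamma0 j))).
have /choice[b bP] : forall j, exists a, f j (w j) = a%:E.
  by move=> j; exact: (projT2 (cid (Gamma0_proper (f_Gamma0 j)))).
have := zP w; rewrite (objectiveE bP); case E : (f i (z i)) (fNy i (z i)) => [a| |]// _.
  by exists a.
have -> : objective f g L z = +oo%E.
  rewrite /objective (_ : (\sum_i f i (z i))%E = +oo%E) ?addye//.
  apply/eqP; rewrite esum_eqy; last by move=> j _; exact: fNy.
  by apply/existsP; exists i; rewrite E.
by rewrite leye_eq.
Qed.

(** First-order optimality. For the direct implication z is perturbed along a
    segment in one coordinate, where the descent lemma bounds the smooth part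
    above by its linearization and a quadratic term. *)
Lemma argmin_objectiveP z :
  argmin (objective f g L) z <-> forall i, subdiff (f i) (z i) (- B z i).
Proof.
split=> [zP i y|zP y]; last first.
  have /choice[a aP] : forall i, exists a, f i (z i) = a%:E.
    by move=> i; have := subdiff_fin (f_Gamma0 i) (zP i); exact.
  rewrite (objectiveE aP) /objective.
  apply: le_trans (_ : (\sum_i ((dot (y i - z i) (- B z i))%:E + f i (z i)) + (Phi y)%:E <= _)%E).
    rewrite (eq_bigr (fun i => (dot (y i - z i) (- B z i) + a i)%:E)); last first.
      by move=> i _; rewrite aP.
    rewrite sumEFin -EFinD lee_fin big_split/=.
    rewrite /Phi.
    have := smooth_gradient_inequality g_convex g_differentiable couplingB
      dot_coupled_grad z y; rewrite hsum_dotE.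
    under [X in _ <= X + _ + _]eq_bigr do rewrite dotNr.
    rewrite sumrN.
    by have -> : \sum_i dot (y i - z i) (B z i) = \sum_i dot ((y - z) i) (B z i) by []; lra.
  by rewrite leeD2r// lee_sum// => i _; exact: zP.
have [a aP] := argmin_fin zP; rewrite aP.
have [fNy _ _ fcvx] := f_Gamma0 i.
case fy : (f i y) (fNy y) => [b| |]// _; last by rewrite leey.
rewrite -EFinD lee_fin dotNr -subr_ge0.
pose h : hsum H := dfwith (0 : hsum H) i (y - z i).
apply: (@ge0_of_affine_perturbation _ _ ((\sum_k tau k / 2 * N k) * `|h| ^+ 2)) => t t01.
have ai j : exists c, f j ((z + t *: h) j) = c%:E /\
    c <= (if j == i then t * b + (1 - t) * a i else a j).
  have [->|ji] := eqVneq j i.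
    have -> : (z + t *: h) i = t *: y + (1 - t) *: z i.
      have -> : (z + t *: h) i = z i + t *: h i by [].
      by rewrite /h dfwithin; hilbert_ring.
    have := fcvx y (z i) t t01; rewrite fy aP -!EFinM -EFinD.
    by case: (f i _) (fNy (t *: y + (1 - t) *: z i)) => [c| |]// _ cl; exists c.
  have -> : (z + t *: h) j = z j + t *: h j by [].
  by rewrite /h dfwithout 1?eq_sym// scaler0 addr0; exists (a j).
have /choice[c cP] := ai.
have := zP (z + t *: h).
rewrite (objectiveE aP) (objectiveE (fun j => (cP j).1)) lee_fin.
have : \sum_j c j <= \sum_j (if j == i then t * b + (1 - t) * a i else a j).
  by apply: ler_sum => j _; exact: (cP j).2.
rewrite (bigD1 i)//= [X in _ <= X](bigD1 i)//= eqxx.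
rewrite [X in _ <= _ + X](eq_bigr a); last by move=> j /negPf ->.
rewrite [\sum_(j < m) a j](bigD1 i)//=.
have E : z + t *: h - z = t *: h by rewrite addrAC subrr add0r.
have := smooth_descent tau_gt0 g_convex g_differentiable g_lipschitz couplingB
  sqr_norm_coupling dot_coupled_grad z (z + t *: h).
rewrite E dotZl sqr_normZ (dotC h) dot_dfwith (dotC (B z i)) /Phi.
move: (dot (y - z i) (B z i)) (\sum_(j < m | _) c j) (\sum_(j < m | _) a j) => *; lra.
Qed.

Definition fb_step (gamma : R) x : hsum H :=
  fun i => prox (fun y : H i => (gamma%:E * f i y)%E) (x i - gamma *: B x i).

Lemma fb_step_fixed gamma z : 0 < gamma -> argmin (objective f g L) z ->
  fb_step gamma z = z.
Proof.
move=> g0 /argmin_objectiveP zP; apply: hsumP => i; rewrite /fb_step.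
apply: subdiff_prox; first exact: Gamma0_scale.
rewrite addrAC subrr add0r -scalerN; exact: scale_subdiff.
Qed.

Lemma fb_step_subdiff gamma x i : 0 < gamma ->
  subdiff (f i) (fb_step gamma x i) (gamma^-1 *: (x i - fb_step gamma x i) - B x i).
Proof.
move=> g0; have := prox_subdiff (Gamma0_scale (f_Gamma0 i) g0) (x i - gamma *: B x i).
move=> /(subdiff_scale (f_Gamma0 i) g0); rewrite -/(fb_step gamma x i).
congr subdiff; rewrite addrAC scalerBr scalerA mulVf ?gt_eqF// scale1r.
by [].
Qed.

(** The firm nonexpansiveness of the proximity operators and the cocoercivity of
    the gradient both leave a quadratic gain, which the weak limits need in order
    to be identified: the first one controls the residuals, the second one the
    gradients. *)
Lemma fb_relaxed_estimate gamma lambda z x : 0 < gamma -> 0 <= lambda <= 1 ->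
  argmin (objective f g L) z ->
  `|x + lambda *: (fb_step gamma x - x) - z| ^+ 2 <= `|x - z| ^+ 2
   - lambda * (gamma * (2 * theta - gamma) * `|B x - B z| ^+ 2
     + `|x - fb_step gamma x - gamma *: (B x - B z)| ^+ 2).
Proof.
move=> g0 l01 zF; apply: forward_backward_gain => //; first exact: coupled_grad_cocoercive.
have firm i (bx bz : hsum H) : prox (fun y : H i => (gamma%:E * f i y)%E)
      (z i - gamma *: bz i) = z i ->
    `|prox (fun y : H i => (gamma%:E * f i y)%E) (x i - gamma *: bx i) - z i| ^+ 2
    + `|(x i - gamma *: bx i - prox (fun y : H i => (gamma%:E * f i y)%E)
          (x i - gamma *: bx i)) - (z i - gamma *: bz i - z i)| ^+ 2
    <= `|(x i - gamma *: bx i) - (z i - gamma *: bz i)| ^+ 2.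
  move=> e; have := prox_firm (Gamma0_scale (f_Gamma0 i) g0) (x i - gamma *: bx i)
    (z i - gamma *: bz i).
  by rewrite e.
rewrite !hsum_sqr_norm -big_split/=; apply: ler_sum => i _.
apply: (firm i (B x) (B z)); move: (fb_step_fixed g0 zF) => /(congr1 (fun u : hsum H => u i)).
exact.
Qed.

End composite.

(** * Weak convergence *)

(** If u failed to converge, the sets of F could be traced on the complement of a
    neighbourhood of l, and an ultrafilter above the trace would contradict the
    assumption. *)
Lemma cvg_of_ultrafilters {R : realType} {T : Type} {F : set_system T}
    {FF : ProperFilter F} (u : T -> R) (l : R) :
  (forall U, UltraFilter U -> F `<=` U -> u @ U --> l) -> u @ F --> l.
Proof.
move=> h; apply/cvgrPdist_lt => e e0; apply: contrapT => nF.
set A := [set t | `|l - u t| < e].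
have wF : ProperFilter (within (~` A) F).
  apply: Build_ProperFilter; rewrite /within/=.
  by move=> h0; apply: nF; apply: filterS h0 => t; exact: contrapT.
have [U [Uultra FU]] := ultraFilterLemma wF.
have UA : U A.
  have FsU : F `<=` U.
    by move=> P FP; apply: FU; rewrite /within/=; apply: filterS FP => t.
  by move: (h U Uultra FsU) => /cvgrPdist_lt /(_ _ e0).
have UnA : U (~` A) by apply: FU; rewrite /within/=; exact: nearW.
have PU : ProperFilter U by exact: ultra_proper.
have [t [At nAt]] := filter_ex (filterI UA UnA).
exact: nAt.
Qed.

Lemma bounded_ultra_cvg {R : realType} {T : Type} {U : set_system T} (u : T -> R) (M : R) :
  UltraFilter U -> (\forall t \near U, `|u t| <= M) ->
  exists l : R, u @ U --> l /\ `|l| <= M.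
Proof.
move=> Uultra uM; have PU : ProperFilter U by exact: ultra_proper.
have [|l [lM lcl]] := @segment_compact R (- M) M (u @ U).
  by apply: filterS uM => t; rewrite /= in_itv/= -ler_norml.
exists l; split; last by move: lM; rewrite /= in_itv/= -ler_norml.
move=> A lA; have [//|UnA] := in_ultra_setVsetC (u @^-1` A) Uultra.
have [t [nAt At]] := lcl _ A (UnA : (u @ U) (~` A)) lA.
by case: nAt.
Qed.

(** Weak compactness of balls without subsequences: along an ultrafilter every
    bounded real sequence converges, and the limits of the coordinates define a
    bounded linear form. *)
Lemma bounded_weak_limit {R : realType} {V : hilbertType R} {T : Type}
    {U : set_system T} (x : T -> V) (M : R) :
  UltraFilter U -> (\forall t \near U, `|x t| <= M) ->
  exists l, forall h, dot (x t) h @[t --> U] --> dot l h.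
Proof.
move=> Uultra xM; have PU : ProperFilter U by exact: ultra_proper.
have /choice[phi phiP] : forall h, exists l, dot (x t) h @[t --> U] --> l /\ `|l| <= M * `|h|.
  move=> h; apply: bounded_ultra_cvg => //; apply: filterS xM => t xt.
  by apply: le_trans (cauchy_schwarz _ _) _; rewrite ler_wpM2r.
have [|h|l lP] := @riesz_representation R V phi M.
- move=> a h k; apply: (@cvg_unique _ _ (fmap (fun t => dot (x t) (a *: h + k)) U)) => //.
  + by have [] := phiP (a *: h + k).
  + have -> : (fun t => dot (x t) (a *: h + k)) = (fun t => a * dot (x t) h + dot (x t) k).
      by apply/funext => t; rewrite dotDr dotZr.
    apply: cvgD; last by have [] := phiP k.
    by apply: cvgMr; have [] := phiP h.
- by have [] := phiP h.
by exists l => h; rewrite dotC -lP; have [] := phiP h.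
Qed.

Lemma bounded_of_cvg_dist {R : realType} {V : normedModType R} (S : V -> V)
    (x : nat -> V) (z : V) : (forall u, `|u| <= `|S u|) ->
  cvgn (fun n => `|S (x n - z)|) -> exists M : R, \forall n \near \oo, `|x n| <= M.
Proof.
move=> Sge /cvg_ex[l /cvgrPdist_lt/(_ 1 ltr01) h].
exists (l + 1 + `|z|); apply: filterS h => n.
rewrite distrC => /(le_lt_trans (ler_norm _)); rewrite ltrBlDl => h.
rewrite -{1}(subrK z (x n)); apply: le_trans (ler_normD _ _) _; rewrite lerD2r.
by apply: le_trans (Sge _) _; exact: ltW.
Qed.

(** Opial's argument. If the distances to two cluster points l and l' both
    converge, so do the scalar products of S (x n) with S (l - l'); computing the
    limit along the two ultrafilters forces l = l'. The operator [S] turns the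
    original norm into the one for which the distances converge. *)
Lemma opial {R : realType} {V : hilbertType R} (S : V -> V) (F : set V) (x : nat -> V) :
  (forall u v, S (u - v) = S u - S v) -> (forall u v, dot (S u) v = dot u (S v)) ->
  (forall u, `|u| <= `|S u|) -> F !=set0 ->
  (forall z, F z -> cvgn (fun n => `|S (x n - z)|)) ->
  (forall U, UltraFilter U -> \oo `<=` U -> forall l,
     (forall h, dot (x n) h @[n --> U] --> dot l h) -> F l) ->
  exists2 l, F l & weak_cvg x l.
Proof.
move=> SB Ssym Sge [z0 Fz0] Fcvg Fcluster.
have [M xM] := bounded_of_cvg_dist Sge (Fcvg z0 Fz0).
have limU U : UltraFilter U -> \oo `<=` U -> exists2 l, F l &
    forall h, dot (x n) h @[n --> U] --> dot l h.
  move=> Uu oU; have [l lP] := bounded_weak_limit Uu (oU _ xM).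
  by exists l => //; exact: Fcluster lP.
have uniq U U' l l' : UltraFilter U -> \oo `<=` U -> UltraFilter U' -> \oo `<=` U' ->
    F l -> F l' -> (forall h, dot (x n) h @[n --> U] --> dot l h) ->
    (forall h, dot (x n) h @[n --> U'] --> dot l' h) -> l = l'.
  move=> Uu oU Uu' oU' Fl Fl' lP lP'.
  have PU : ProperFilter U by exact: ultra_proper.
  have PU' : ProperFilter U' by exact: ultra_proper.
  have E n : dot (x n) (S (S (l - l'))) =
      2^-1 * (`|S (x n - l')| ^+ 2 - `|S (x n - l)| ^+ 2 + `|S l| ^+ 2 - `|S l'| ^+ 2).
    rewrite -Ssym !SB (sqr_normB (S (x n))) (sqr_normB (S (x n))) dotBr; lra.
  have [d dP] : exists d : R, dot (x n) (S (S (l - l'))) @[n --> \oo] --> d.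
    have sq z : F z -> cvgn (fun n => `|S (x n - z)| ^+ 2).
      by move=> Fz; under eq_is_cvg do rewrite expr2; apply: is_cvgM; exact: Fcvg.
    have /cvg_ex[d1 d1P] := sq l Fl; have /cvg_ex[d2 d2P] := sq l' Fl'.
    exists (2^-1 * (d2 - d1 + `|S l| ^+ 2 - `|S l'| ^+ 2)).
    under eq_cvg do rewrite E.
    by apply: cvgMr; apply: cvgB; [apply: cvgD; [exact: cvgB|exact: cvg_cst]|exact: cvg_cst].
  have e1 : dot l (S (S (l - l'))) = d.
    apply: (@cvg_unique _ _ (fmap (fun n => dot (x n) (S (S (l - l')))) U)).
    - exact: norm_hausdorff.
    - exact: lP.
    - by move=> A dA; apply: oU; exact: (dP A dA).
  have e2 : dot l' (S (S (l - l'))) = d.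
    apply: (@cvg_unique _ _ (fmap (fun n => dot (x n) (S (S (l - l')))) U')).
    - exact: norm_hausdorff.
    - exact: lP'.
    - by move=> A dA; apply: oU'; exact: (dP A dA).
  have : dot (l - l') (S (S (l - l'))) = 0 by rewrite dotBl e1 e2 subrr.
  rewrite -Ssym dot_normE => /eqP; rewrite sqrf_eq0 normr_eq0 => /eqP S0.
  have := Sge (l - l'); rewrite S0 normr0 normr_le0 subr_eq0 => /eqP; exact.
have [U0 [U0u oU0]] := ultraFilterLemma (F := \oo) _.
have [l Fl lP] := limU U0 U0u oU0; exists l => // h.
apply: cvg_of_ultrafilters => U Uu oU.
by have [l' Fl' lP'] := limU U Uu oU; rewrite (uniq U0 U l l').
Unshelve. all: by end_near.
Qed.

(** The distances to z and to a nearby point of C differ uniformly in n by little,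
    so the former are Cauchy. *)
Lemma cvg_dist_dense {R : realType} {V : hilbertType R} (S : V -> V) (kappa : R)
    (x : nat -> V) (C : set V) (z : V) :
  (forall u v, S (u - v) = S u - S v) -> (forall u, `|S u| <= kappa * `|u|) ->
  (forall e, 0 < e -> exists2 c, C c & `|c - z| < e) ->
  (forall c, C c -> cvgn (fun n => `|S (x n - c)|)) ->
  cvgn (fun n => `|S (x n - z)|).
Proof.
move=> SB Sle dense Ccvg; apply: cauchy_cvg; apply/cauchyP => e e0.
have k0 : 0 < `|kappa| + 1 by rewrite ltr_wpDl.
have e1 : 0 < e / 4 / (`|kappa| + 1) by rewrite !divr_gt0.
have [c Cc cz] := dense _ e1.
have cz' : `|S (c - z)| < e / 4.
  apply: le_lt_trans (Sle _) _; move: cz; rewrite ltr_pdivlMr// mulrC.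
  by apply: le_lt_trans; rewrite ler_wpM2r// (le_trans (ler_norm _))// lerDl.
have e2 : 0 < e / 2 by rewrite divr_gt0.
have close n : `| `|S (x n - z)| - `|S (x n - c)| | < e / 4.
  apply: le_lt_trans cz'; apply: le_trans (ler_dist_dist _ _) _.
  rewrite -SB; have -> : x n - z - (x n - c) = c - z by hilbert_ring.
  exact: lexx.
have /cvg_ex[d dP] := Ccvg c Cc.
exists d; suff : \forall n \near \oo, ball d e `|S (x n - z)| by [].
near=> n.
rewrite -ball_normE/= -(subrK `|S (x n - c)| d) -addrA.
have : `|d - `|S (x n - c)| | < e / 2 by near: n; move/cvgrPdist_lt: dP => /(_ _ e2).
move: (close n); rewrite -[X in X < _ -> _]normrN opprB => h1 h2.
apply: le_lt_trans (ler_normD _ _) _; lra.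
Unshelve. all: by end_near.
Qed.

(** Cocoercivity is tested between x t and l: the scalar product tends to 0 by
    weak convergence of the points and strong convergence of the images. *)
Lemma cocoercive_weak_closed {R : realType} {V : hilbertType R} {T : Type}
    {F : set_system T} {FF : ProperFilter F} (B : V -> V) (theta M : R)
    (x : T -> V) (l b : V) : 0 < theta ->
  (forall u v, theta * `|B u - B v| ^+ 2 <= dot (u - v) (B u - B v)) ->
  (\forall t \near F, `|x t| <= M) ->
  (forall h, dot (x t) h @[t --> F] --> dot l h) -> B (x t) @[t --> F] --> b ->
  b = B l.
Proof.
move=> t0 coco xM xl Bb.
have lim : dot (x t - l) (B (x t) - B l) - theta * `|B (x t) - B l| ^+ 2 @[t --> F] -->
    0 + (dot l (b - B l) - dot l (b - B l)) - theta * `|b - B l| ^+ 2.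
  apply: cvgB; last first.
    apply: cvgMr; under eq_cvg do rewrite expr2; rewrite expr2.
    by apply: cvgM; apply: cvg_norm; apply: cvgB => //; exact: cvg_cst.
  have E t : dot (x t - l) (B (x t) - B l) =
      dot (x t - l) (B (x t) - b) + (dot (x t) (b - B l) - dot l (b - B l)).
    by rewrite -dotBl -dotDr; congr dot; hilbert_ring.
  under eq_cvg do rewrite E.
  apply: cvgD; last by apply: cvgB; [exact: xl|exact: cvg_cst].
  apply: (@cvg_dot_bounded _ _ _ _ _ _ _ (M + `|l|)).
    by apply: filterS xM => t xt; rewrite (le_trans (ler_normB _ _))// lerD2r.
  by apply/subr_cvg0.
have := cvg_ge0 lim (nearW _ (fun t => _)).
rewrite subrr addr0 sub0r oppr_ge0 => h.
have : `|b - B l| ^+ 2 == 0.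
  rewrite eq_le exprn_ge0// andbT -(ler_pM2l t0) mulr0; apply: h => t.
  by rewrite subr_ge0.
by rewrite sqrf_eq0 normr_eq0 subr_eq0 => /eqP.
Qed.

Lemma cvg_hsum_coord {R : realType} {I : finType} {H : I -> hilbertType R} {T : Type}
    {F : set_system T} {FF : Filter F} (x : T -> hsum H) (l : hsum H) i :
  x @ F --> l -> x t i @[t --> F] --> l i.
Proof.
move=> xl; apply/cvgrPdist_lt => e e0; move/cvgrPdist_lt : xl => /(_ _ e0).
by apply: filterS => t; apply: le_lt_trans; exact: (hsum_coord_le (l - x t) i).
Qed.

Lemma cvg_hsum {R : realType} {I : finType} {H : I -> hilbertType R} {T : Type}
    {F : set_system T} {FF : Filter F} (x : T -> hsum H) (l : hsum H) :
  (forall i, x t i @[t --> F] --> l i) -> x @ F --> l.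
Proof.
move=> xl; apply/cvgrPdist_lt => e e0.
have e1 : 0 < e / (#|I|.+1)%:R by rewrite divr_gt0.
have : \forall t \near F, forall i, `|l i - x t i| < e / (#|I|.+1)%:R.
  by apply: filter_forall => i; move/cvgrPdist_lt : (xl i) => /(_ _ e1).
by apply: filterS => t xt; exact: hsum_norm_lt.
Qed.

(** * Weak and strong limits of forward-backward iterations *)

Lemma cvg0_of_sqr {R : realType} (u v : nat -> R) (k : R) : 0 < k ->
  (forall n, 0 <= u n) -> (forall n, k * u n ^+ 2 <= v n) ->
  v @ \oo --> (0 : R) -> u @ \oo --> (0 : R).
Proof.
move=> k0 u0 kuv v0; apply/cvgrPdist_lt => e e0.
have ke : 0 < k * e ^+ 2 by rewrite mulr_gt0// exprn_gt0.
move/cvgrPdist_lt : v0 => /(_ _ ke); apply: filterS => n; rewrite !sub0r !normrN => vn.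
rewrite ger0_norm// ltNge; apply/negP => eu.
have : k * e ^+ 2 <= k * u n ^+ 2.
  by rewrite ler_pM2l// ler_sqr ?nnegrE// ltW.
move/(le_lt_trans (le_trans (kuv n) (ler_norm _))) : vn => /lt_geF ->.
by [].
Qed.

Lemma cvg_of_dist0 {R : realType} {V : normedModType R} (u : nat -> V) (l : V) :
  (fun n => `|u n - l|) @ \oo --> (0 : R) -> u @ \oo --> l.
Proof.
move=> ul; apply/cvgrPdist_lt => e e0; move/cvgrPdist_lt : ul => /(_ _ e0).
by apply: filterS => n; rewrite sub0r normrN normr_id distrC.
Qed.

Lemma cvg0_shift {R : realType} {V : normedModType R} (u v : nat -> V) (s : nat -> R) (k : R) :
  0 < k -> (forall n, 0 <= s n <= k) -> (fun n => `|v n|) @ \oo --> (0 : R) ->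
  (fun n => `|u n - s n *: v n|) @ \oo --> (0 : R) -> u @ \oo --> (0 : V).
Proof.
move=> k0 sk v0 uv; apply/cvgrPdist_lt => e e0.
have e2 : 0 < e / 2 by rewrite divr_gt0.
have e3 : 0 < e / 2 / k by rewrite divr_gt0.
move/cvgrPdist_lt : v0 => /(_ _ e3); move/cvgrPdist_lt : uv => /(_ _ e2).
apply: filterS2 => n; rewrite !sub0r !normrN !normr_id => h1.
rewrite ltr_pdivlMr// => h2; have /andP[s0 s1] := sk n.
rewrite -(subrK (s n *: v n) (u n)).
apply: le_lt_trans (ler_normD _ _) _; rewrite [ltRHS]splitr; apply: ltrD => //.
by rewrite normrZ ger0_norm//; apply: le_lt_trans h2; rewrite mulrC ler_wpM2l.
Qed.

Section forward_backward_limits.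
Context {R : realType} {m p : nat} {H : 'I_m -> hilbertType R}
  {G : 'I_p -> hilbertType R}.
Variables (f : forall i, H i -> \bar R) (g : forall k, G k -> R)
  (L : forall k i, {linear H i -> G k}) (tau : 'I_p -> R) (theta : R).
Arguments f : clear implicits.
Arguments g : clear implicits.
Hypotheses (f_Gamma0 : forall i, Gamma0 (f i))
  (tau_gt0 : forall k, 0 < tau k)
  (g_convex : forall k, convex_function [set: convex_lmodType (G k)] (g k))
  (g_differentiable : forall k x, differentiable (g k) x)
  (g_lipschitz : forall k, (tau k).-lipschitz (grad (g k)))
  (L_bounded : forall k i, exists M : R, forall x, `|L k i x| <= M * `|x|)
  (theta_bounds : 0 < theta <=
      (\sum_k tau k * opnorm (fun y : G k => \sum_i L k i (adjoint (L k i) y)))^-1).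
Variables (gamma : nat -> R) (gamma0 : R) (x : nat -> hsum H) (b : hsum H).
Hypotheses (gamma0_gt0 : 0 < gamma0) (gamma_ge : forall n, gamma0 <= gamma n)
  (Bx : coupled_grad g L (x n) @[n --> \oo] --> b)
  (Tx : x n - fb_step f g L (gamma n) (x n) @[n --> \oo] --> (0 : hsum H)).

Let y n := fb_step f g L (gamma n) (x n).
Let u i n := (gamma n)^-1 *: (x n i - y n i) - coupled_grad g L (x n) i.

Let u_subdiff i n : subdiff (f i) (y n i) (u i n).
Proof. by apply: fb_step_subdiff => //; exact: lt_le_trans (gamma_ge n). Qed.

Let u_cvg i : u i @ \oo --> - b i.
Proof.
rewrite -[X in _ --> X]sub0r; apply: cvgB; last exact: (cvg_hsum_coord Bx).
have Txi : x n i - y n i @[n --> \oo] --> (0 : H i) by exact: (cvg_hsum_coord Tx).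
apply/cvgrPdist_lt => e e0.
have e1 : 0 < e * gamma0 by rewrite mulr_gt0.
move/cvgrPdist_lt : Txi => /(_ _ e1); apply: filterS => n.
have gn : 0 < gamma n by exact: lt_le_trans (gamma_ge n).
rewrite !sub0r !normrN normrZ ger0_norm ?invr_ge0 ?(ltW gn)// => h.
rewrite mulrC ltr_pdivrMr//; apply: lt_le_trans h _.
by rewrite ler_wpM2l// ltW.
Qed.

(** The proximal points y n have the same weak limit as the iterates, and their
    subgradients u n converge strongly to - b = - B l. *)
Lemma fb_cluster_argmin U (l : hsum H) (M : R) : UltraFilter U -> \oo `<=` U ->
  (\forall n \near \oo, `|x n| <= M) ->
  (forall h, dot (x n) h @[n --> U] --> dot l h) -> argmin (objective f g L) l.
Proof.
move=> Uu oU xM xl; have PU : ProperFilter U by exact: ultra_proper.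
have bE : b = coupled_grad g L l.
  apply: (@cocoercive_weak_closed _ _ _ U _ _ theta M x) => //.
  - by case/andP: theta_bounds.
  - exact: (coupled_grad_cocoercive tau_gt0).
  - exact: oU.
  - by move=> A bA; apply: oU; exact: Bx.
apply/(argmin_objectiveP f_Gamma0 tau_gt0 g_convex g_differentiable g_lipschitz L_bounded) => i.
have yw h : dot (y n i) h @[n --> U] --> dot (l i) h.
  have -> : dot (l i) h = dot (l i) h - dot (0 : H i) h by rewrite dot0l subr0.
  have E n : dot (y n i) h = dot (x n i) h - dot (x n i - y n i) h.
    by rewrite -dotBl; congr dot; hilbert_ring.
  under eq_cvg do rewrite E.
  apply: cvgB.
    by have := xl (dfwith (0 : hsum H) i h); rewrite dot_dfwith;
       under eq_cvg do rewrite dot_dfwith.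
  apply: cvg_dotl; move=> A A0; apply: oU; exact: (cvg_hsum_coord Tx).
have yM : \forall n \near U, `|y n i| <= M + 1.
  have Txi : x n i - y n i @[n --> \oo] --> (0 : H i) by exact: (cvg_hsum_coord Tx).
  apply: oU; move/cvgrPdist_lt : Txi => /(_ 1 ltr01).
  apply: filterS2 xM => n xn; rewrite sub0r normrN => d.
  have -> : y n i = x n i - (x n i - y n i) by hilbert_ring.
  apply: le_trans (ler_normB _ _) _; apply: lerD; last exact: ltW.
  exact: le_trans (hsum_coord_le _ _) xn.
have -> : (- coupled_grad g L l i) = - b i by rewrite bE.
apply: (@subdiff_weak_strong_closed _ _ _ (f_Gamma0 i) _ U _ (fun n => y n i) (u i)
  (l i) (- b i) (M + 1)) => //.
by move=> A A0; apply: oU; exact: u_cvg.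
Qed.

(** Strong convergence: demiregularity is applied to the proximal points y n,
    whose subgradients converge strongly, or to the iterates themselves. *)
Lemma fb_strong_cvg (l : hsum H) : argmin (objective f g L) l -> weak_cvg x l ->
  b = coupled_grad g L l ->
  (forall i, demiregular (subdiff (f i)) (l i)) \/
  demiregular (fun y => [set coupled_grad g L y]) l ->
  x @ \oo --> l.
Proof.
move=> lF xl bE [dreg|[_ dreg]]; last first.
  apply: (dreg x (fun n => coupled_grad g L (x n)) b).
  - by move=> n; exact: erefl.
  - exact: bE.
  - exact: xl.
  - exact: Bx.
apply: cvg_hsum => i.
have Txi : x n i - y n i @[n --> \oo] --> (0 : H i) by exact: (cvg_hsum_coord Tx).
have yl : y n i @[n --> \oo] --> l i.
  have [_ dreg'] := dreg i.
  apply: (dreg' (fun n => y n i) (u i) (- b i)).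
  - exact: u_subdiff.
  - rewrite bE.
    by move/(argmin_objectiveP f_Gamma0 tau_gt0 g_convex g_differentiable g_lipschitz L_bounded) : lF.
  - move=> h; have -> : dot (l i) h = dot (l i) h - dot (0 : H i) h by rewrite dot0l subr0.
    have E n : dot (y n i) h = dot (x n i) h - dot (x n i - y n i) h.
      by rewrite -dotBl; congr dot; hilbert_ring.
    under eq_cvg do rewrite E.
    apply: cvgB; last exact: cvg_dotl.
    by have := xl (dfwith (0 : hsum H) i h); rewrite dot_dfwith;
       under eq_cvg do rewrite dot_dfwith.
  - exact: u_cvg.
have -> : l i = 0 + l i by rewrite add0r.
have E n : x n i = (x n i - y n i) + y n i by rewrite subrK.
by under eq_cvg do rewrite E; exact: cvgD.
Qed.

End forward_backward_limits.

(** * Conditional inequalities *)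

Definition adapted {R : realType} d {T : measurableType d} (C : set (set T)) (X : T -> R) :=
  measurable_fun [set: g_sigma_algebraType C] (X : g_sigma_algebraType C -> R).

Section adapted_facts.
Context {R : realType} d {T : measurableType d}.
Implicit Types (C : set (set T)) (X Y : T -> R).

Lemma adaptedP C X : adapted C X <-> forall B, measurable B -> <<s C >> (X @^-1` B).
Proof.
split=> [mX B mB|mX _ B mB]; last by rewrite setTI; exact: mX.
by have := mX measurableT B mB; rewrite setTI.
Qed.

Lemma adaptedS C C' X : <<s C >> `<=` <<s C' >> -> adapted C X -> adapted C' X.
Proof. by move=> CC' /adaptedP mX; apply/adaptedP => B /mX /CC'. Qed.

Lemma adapted_measurable C X : <<s C >> `<=` measurable -> adapted C X ->
  measurable_fun setT X.
Proof. by move=> CT /adaptedP mX _ B mB; rewrite setTI; apply: CT; exact: mX. Qed.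

Lemma adaptedV C X : (forall w, 0 < X w) -> adapted C X -> adapted C (fun w => (X w)^-1).
Proof.
move=> X0 mX.
rewrite /adapted (_ : (fun w => _) = (fun w => powR (X w) (-1))); last first.
  by apply/funext => w; rewrite powR_inv1// ltW.
exact: (measurableT_comp (measurable_powR _)).
Qed.

Lemma adapted_indic C (b : T -> bool) :
  measurable_fun [set: g_sigma_algebraType C] (b : g_sigma_algebraType C -> bool) ->
  adapted C (fun w => (b w)%:R : R).
Proof.
move=> mb; rewrite /adapted (_ : (fun w => _) = (fun w => if b w then 1 else 0 : R)).
  exact: measurable_fun_ifT.
by apply/funext => w; case: (b w).
Qed.

End adapted_facts.

Lemma measurable_sqr {R : realType} d {T : measurableType d} (F : T -> R) :
  measurable_fun setT F -> measurable_fun setT (fun w => F w ^+ 2).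
Proof. by move=> mF; exact: (measurable_funX 2 mF). Qed.

Lemma adapted_sqr {R : realType} d {T : measurableType d} (C : set (set T)) (F : T -> R) :
  adapted C F -> adapted C (fun w => F w ^+ 2).
Proof. exact: measurable_sqr. Qed.

(** [cond_le C Y Z] is the inequality E(Y | C) <= E(Z | C) for nonnegative Y and
    Z, tested against C-measurable weights, so that neither side has to be
    integrable. *)
Definition cond_le {R : realType} d {T : measurableType d} (P : probability T R)
    (C : set (set T)) (Y Z : T -> R) :=
  forall h : T -> R, (forall w, 0 <= h w) -> adapted C h ->
    (\int[P]_w (h w * Y w)%:E <= \int[P]_w (h w * Z w)%:E)%E.

Section cond_le_facts.
Import HBNNSimple.
Context {R : realType} d {T : measurableType d} (P : probability T R).
Implicit Types (C : set (set T)) (Y Z : T -> R).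

Let m_mul Y Z : measurable_fun setT Y -> measurable_fun setT Z ->
  measurable_fun setT (fun w => (Y w * Z w)%:E).
Proof. by move=> mY mZ; apply/measurable_EFinP; exact: measurable_funM. Qed.

(** Indicators of C-measurable sets suffice as weights: nonnegative adapted weights
    are increasing limits of simple ones. *)
Lemma cond_le_of_sets C Y Z : <<s C >> `<=` measurable ->
  measurable_fun setT Y -> measurable_fun setT Z ->
  (forall w, 0 <= Y w) -> (forall w, 0 <= Z w) ->
  (forall A, <<s C >> A -> (\int[P]_(w in A) (Y w)%:E <= \int[P]_(w in A) (Z w)%:E)%E) ->
  cond_le P C Y Z.
Proof.
move=> CT mY mZ Y0 Z0 YZ h h0 mh.
have [|g [gmono gcvg]] := @approximation _ (g_sigma_algebraType C) R setT measurableT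
    (EFin \o h) ((measurable_EFinP _ _).2 mh).
  by move=> w _; rewrite lee_fin.
have g0 n w : 0 <= g n w by [].
have ag n : adapted C (g n : T -> R) by exact: measurable_funP.
have Cg n y : <<s C >> (g n @^-1` [set y]).
  by move/adaptedP: (ag n); apply; exact: measurable_set1.
have mg n : measurable_fun setT (g n : T -> R) := adapted_measurable CT (ag n).
have simpleE n (X : T -> R) : measurable_fun setT X -> (forall w, 0 <= X w) ->
    (\int[P]_w (g n w * X w)%:E =
     \sum_(y \in range (g n)) y%:E * \int[P]_(w in g n @^-1` [set y]) (X w)%:E)%E.
  move=> mX X0.
  have mA y : measurable (g n @^-1` [set y] : set T).
    exact: CT.
  have mI y : measurable_fun setT (\1_(g n @^-1` [set y]) : T -> R).
    exact: measurable_indic.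
  have F0 y w : (0 <= (y * \1_(g n @^-1` [set y]) w)%:E * (X w)%:E)%E.
    by rewrite mule_ge0 ?lee_fin//; exact: nnfun_muleindic_ge0.
  transitivity (\int[P]_w (\sum_(y \in range (g n))
      (y * \1_(g n @^-1` [set y]) w)%:E * (X w)%:E))%E.
    apply: eq_integral => w _; rewrite -ge0_mule_fsuml => [|y].
      rewrite fsumEFin// -EFinM; congr ((_ * _)%:E); exact: (fimfunE (g n) w).
    exact: nnfun_muleindic_ge0.
  rewrite ge0_integral_fsum//; last first.
    move=> y; apply: emeasurable_funM; apply/measurable_EFinP => //.
    exact: measurable_funM.
  apply: eq_fsbigr => y; rewrite inE => -[w0 _ w0y].
  have y0 : 0 <= y by rewrite -w0y.
  under eq_integral do rewrite EFinM -muleA.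
  rewrite ge0_integralZl_EFin//; last 2 first.
  - by move=> w _; rewrite -EFinM lee_fin mulr_ge0// indicE.
  - by apply/measurable_EFinP; exact: measurable_funM.
  congr (_ * _)%E; rewrite [RHS]integral_mkcond; apply: eq_integral => w _.
  by rewrite epatch_indic/= muleC.
have simple_le n : (\int[P]_w (g n w * Y w)%:E <= \int[P]_w (g n w * Z w)%:E)%E.
  rewrite !simpleE//; apply: lee_fsum => // y [w0 _ w0y].
  apply: lee_wpmul2l; first by rewrite lee_fin -w0y.
  exact: YZ.
have gw w : g n w @[n --> \oo] --> h w.
  by have := gcvg w I; move/fine_cvgP => [_]; exact.
have g_le n w : g n w <= h w.
  rewrite -(cvg_lim (@norm_hausdorff _ _) (gw w)).
  apply: nondecreasing_cvgn_le; last by apply/cvg_ex; exists (h w).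
  by move=> a b ab; have /lefP := gmono _ _ ab; exact.
have le_h n : (\int[P]_w (g n w * Y w)%:E <= \int[P]_w (h w * Z w)%:E)%E.
  apply: le_trans (simple_le n) _; apply: ge0_le_integral => //=.
  - by move=> w _; rewrite lee_fin mulr_ge0.
  - exact: m_mul.
  - by apply: m_mul => //; exact: adapted_measurable CT mh.
  - by move=> w _; rewrite lee_fin ler_wpM2r.
have -> : (\int[P]_w (h w * Y w)%:E = limn (fun n => \int[P]_w (g n w * Y w)%:E))%E.
  rewrite -monotone_convergence//; last 3 first.
  - by move=> n; exact: m_mul.
  - by move=> n w _; rewrite lee_fin mulr_ge0.
  - move=> w _ a b ab; rewrite lee_fin ler_wpM2r//.
    by have /lefP := gmono _ _ ab; exact.
  apply: eq_integral => w _; apply/esym/cvg_lim => //.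
  by apply: cvg_EFin; [exact: nearW|apply: cvgMl; exact: gw].
apply: lime_le; last exact: nearW.
apply: ereal_nondecreasing_is_cvgn => a b ab; apply: ge0_le_integral => //=.
- by move=> w _; rewrite lee_fin mulr_ge0.
- exact: m_mul.
- exact: m_mul.
- move=> w _; rewrite lee_fin ler_wpM2r//.
  by have /lefP := gmono _ _ ab; exact.
Qed.

Lemma cond_le_trans C Y Z X : cond_le P C Y Z -> cond_le P C Z X -> cond_le P C Y X.
Proof. by move=> YZ ZX h h0 mh; exact: le_trans (YZ h h0 mh) (ZX h h0 mh). Qed.

Lemma cond_le_pointwise C Y Z : <<s C >> `<=` measurable ->
  measurable_fun setT Y -> measurable_fun setT Z -> (forall w, 0 <= Y w) ->
  (forall w, Y w <= Z w) -> cond_le P C Y Z.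
Proof.
move=> CT mY mZ Y0 YZ h h0 /(adapted_measurable CT) mh.
apply: ge0_le_integral => //=; [|exact: m_mul|exact: m_mul|].
- by move=> w _; rewrite lee_fin mulr_ge0.
- by move=> w _; rewrite lee_fin ler_wpM2l.
Qed.

Lemma cond_leD C Y Z Y' Z' : <<s C >> `<=` measurable ->
  measurable_fun setT Y -> measurable_fun setT Z ->
  measurable_fun setT Y' -> measurable_fun setT Z' ->
  (forall w, 0 <= Y w) -> (forall w, 0 <= Z w) ->
  (forall w, 0 <= Y' w) -> (forall w, 0 <= Z' w) ->
  cond_le P C Y Z -> cond_le P C Y' Z' -> cond_le P C (Y \+ Y') (Z \+ Z').
Proof.
move=> CT mY mZ mY' mZ' Y0 Z0 Y'0 Z'0 YZ YZ' h h0 ah.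
have mh := adapted_measurable CT ah.
have E (X X' : T -> R) : measurable_fun setT X -> measurable_fun setT X' ->
    (forall w, 0 <= X w) -> (forall w, 0 <= X' w) ->
    (\int[P]_w (h w * (X \+ X') w)%:E =
     \int[P]_w (h w * X w)%:E + \int[P]_w (h w * X' w)%:E)%E.
  move=> mX mX' X0 X'0; rewrite -ge0_integralD//; first last.
  - exact: m_mul.
  - by move=> w _; rewrite lee_fin mulr_ge0.
  - exact: m_mul.
  - by move=> w _; rewrite lee_fin mulr_ge0.
  by apply: eq_integral => w _; rewrite /= mulrDr EFinD.
by rewrite !E//; apply: leeD; [exact: YZ|exact: YZ'].
Qed.

Lemma cond_leM C Y Z k : (forall w, 0 <= k w) -> adapted C k ->
  cond_le P C Y Z -> cond_le P C (fun w => k w * Y w) (fun w => k w * Z w).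
Proof.
move=> k0 mk YZ h h0 mh.
have E X : (\int[P]_w (h w * (k w * X w))%:E = \int[P]_w (h w * k w * X w)%:E)%E.
  by apply: eq_integral => w _; rewrite mulrA.
rewrite !E; apply: YZ; first by move=> w; rewrite mulr_ge0.
exact: measurable_funM.
Qed.

End cond_le_facts.

(** A conditional decrease is established by splitting off the gain G pointwise
    and averaging only the rest. *)
Lemma cond_le_absorb {R : realType} d {T : measurableType d} (P : probability T R)
    (C : set (set T)) (Y Q G D : T -> R) : <<s C >> `<=` measurable ->
  measurable_fun setT Y -> measurable_fun setT Q -> measurable_fun setT G ->
  measurable_fun setT D ->
  (forall w, 0 <= Y w) -> (forall w, 0 <= Q w) -> (forall w, 0 <= G w) ->
  cond_le P C Y Q -> (forall w, Q w + G w <= D w) -> cond_le P C (fun w => Y w + G w) D.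
Proof.
move=> Cm mY mQ mG mD Y0 Q0 G0 YQ QD.
apply: (@cond_le_trans _ _ _ _ _ _ (Q \+ G)); last first.
  apply: (@cond_le_pointwise _ _ _ P C _ _ Cm) => //; first exact: measurable_funD.
  by move=> w; rewrite addr_ge0.
exact: (cond_leD Cm).
Qed.

(** * Nonnegative supermartingales *)

(** By Fatou's lemma the lower limit of the sequence is integrable, hence almost
    surely finite. *)
Lemma freq_bounded_of_integral {R : realType} d {T : measurableType d}
    (P : probability T R) (X : nat -> T -> R) (M : R) :
  (forall n, measurable_fun setT (X n)) -> (forall n w, 0 <= X n w) ->
  (forall n, (\int[P]_w (X n w)%:E <= M%:E)%E) ->
  {ae P, forall w, exists K : R, forall N, exists2 n, (N <= n)%N & X n w <= K}.
Proof.
move=> mX X0 XM; pose Y w := limn_einf (fun n => (X n w)%:E).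
have mE n : measurable_fun setT (fun w => (X n w)%:E) by exact/measurable_EFinP.
have Y0 w : (0 <= Y w)%E.
  rewrite /Y limn_einf_lim; apply: lime_ge; first exact: is_cvg_einfs.
  by apply: nearW => n; apply: le_ereal_inf_tmp => _ [k /= _ <-]; rewrite lee_fin.
have intY : (\int[P]_w Y w <= M%:E)%E.
  apply: le_trans (fatou _ _ mE _) _ => //.
  - by move=> n w _; rewrite lee_fin.
  - rewrite limn_einf_lim; apply: lime_le; first exact: is_cvg_einfs.
    by apply: nearW => n; apply: le_trans (XM n); apply: ereal_inf_lbound; exists n => /=.
have mN (Z : T -> \bar R) : measurable_fun setT Z -> measurable_fun setT (fun w => - Z w)%E.
  move=> mZ; exact: (measurableT_comp (@oppe_measurable R setT) mZ).
have mY : measurable_fun setT Y.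
  by apply: (mN _); apply: measurable_fun_limn_esup => n; exact: mN.
have /integrable_ae : P.-integrable setT Y.
  apply/integrableP; split => //; under eq_integral do rewrite gee0_abs//.
  exact: le_lt_trans intY (ltry _).
move=> /(_ measurableT); apply: filterS => w /(_ I) Yfin; apply: contrapT => nb.
suff : Y w = +oo%E by move=> E; rewrite E in Yfin.
suff h : (X n w)%:E @[n --> \oo] --> +oo%E by rewrite /Y (cvg_limn_einf_sup h).
apply/cvgeyPge => K; apply: contrapT => nK; apply: nb; exists K => N.
apply: contrapT => nN; apply: nK; exists N => // n /= Nn.
rewrite lee_fin; apply: ltW; rewrite ltNge; apply/negP => le; apply: nN; by exists n.
Qed.

(** The betting strategy behind the upcrossing inequality: [holding] tells
    whether a share, bought at a price at most a, is still in the portfolio, and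
    [upcrossings] counts the sales at a price at least b. *)
Section upcrossings.
Context {R : realType}.
Variables (a b : R) (s : nat -> R).

Fixpoint holding n : bool :=
  if n is k.+1 then if holding k then s k.+1 < b else s k.+1 <= a else s 0%N <= a.

Fixpoint upcrossings n : nat :=
  if n is k.+1 then (upcrossings k + (holding k && (b <= s k.+1)%R))%N else 0%N.

Hypothesis ab : a < b.

Lemma holding_le n : s n <= a -> holding n.
Proof. by case: n => [//|n] /= sa; case: ifP => // _; exact: le_lt_trans ab. Qed.

Lemma holding_ge n : b <= s n -> holding n = false.
Proof.
case: n => [|n] /= bs; first by apply/negbTE; rewrite -ltNge; exact: lt_le_trans bs.
by case: ifP => _; apply/negbTE; rewrite -?leNgt// -ltNge; exact: lt_le_trans bs.
Qed.

Lemma upcrossings_nd n k : (upcrossings n <= upcrossings (n + k))%N.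
Proof. by elim: k => [|k IH]; rewrite ?addn0// addnS/= (leq_trans IH)// leq_addr. Qed.

Lemma upcrossings_sale n k : holding n -> ~~ holding (n + k) ->
  (upcrossings n < upcrossings (n + k))%N.
Proof.
move=> hn; elim: k => [|k IH]; first by rewrite addn0 hn.
rewrite addnS/=; case: (boolP (holding (n + k))) => hk; last first.
  by move=> _; rewrite addn0; exact: IH.
by rewrite -leNgt => ->; rewrite addn1 ltnS upcrossings_nd.
Qed.

Lemma upcrossings_unbounded :
  (forall N, exists2 n, (N <= n)%N & s n <= a) ->
  (forall N, exists2 n, (N <= n)%N & b <= s n) ->
  forall K, exists n, (K <= upcrossings n)%N.
Proof.
move=> freq_a freq_b; elim=> [|K [n Kn]]; first by exists 0%N.
have [n1 nn1 /holding_le h1] := freq_a n.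
have [n2 n12 /holding_ge h2] := freq_b n1.
exists n2; apply: leq_ltn_trans Kn _.
have lt : (upcrossings n1 < upcrossings n2)%N.
  by rewrite -(subnKC n12); apply: upcrossings_sale => //; rewrite subnKC// h2.
by apply: leq_ltn_trans lt; rewrite -(subnKC nn1) upcrossings_nd.
Qed.

End upcrossings.

(** The limit is the infimum l of the levels below which s comes back infinitely
    often. Were s infinitely often above l + e as well, it would oscillate across
    a rational interval between l and l + e. *)
Lemma cvg_of_no_oscillation {R : realType} (s : nat -> R) (K : R) :
  (forall n, 0 <= s n) -> (forall N, exists2 n, (N <= n)%N & s n <= K) ->
  (forall q r : rat, 0 <= ratr q :> R -> ratr q < ratr r :> R ->
    (forall N, exists2 n, (N <= n)%N & s n <= ratr q) ->
    (forall N, exists2 n, (N <= n)%N & ratr r <= s n) -> False) ->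
  cvgn s.
Proof.
move=> s0 freqK noosc.
pose A := [set t : R | forall N, exists2 n, (N <= n)%N & s n <= t].
have A0 : has_inf A.
  split; first by exists K.
  by exists 0 => t /(_ 0%N)[n _]; apply: le_trans.
set l := inf A; apply/cvg_ex; exists l; apply/cvgrPdist_lt => e e0.
have l0 : 0 <= l by apply: lb_le_inf; [exact: A0.1|move=> t /(_ 0%N)[n _]; apply: le_trans].
have [q] : exists q : rat, ratr q \in `]l, (l + e / 2)[.
  by apply: rat_in_itvoo; rewrite ltrDl divr_gt0.
rewrite in_itv/= => /andP[lq qe].
have [r] : exists r : rat, ratr r \in `](l + e / 2), (l + e)[.
  by apply: rat_in_itvoo; lra.
rewrite in_itv/= => /andP[er re].
have Aq : A (ratr q).
  have ql : 0 < ratr q - l by rewrite subr_gt0.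
  have [t At tq] := inf_adherent ql A0.
  move=> N; have [n Nn st] := At N; exists n => //.
  by apply: le_trans st _; move: tq; rewrite -/l; lra.
have nAl : ~ A (l - e / 2).
  by move/(ge_inf A0.2); rewrite -/l; lra.
have [N1 N1P] : exists N, forall n, (N <= n)%N -> l - e / 2 < s n.
  apply: contrapT => nN; apply: nAl => N; apply: contrapT => nn; apply: nN; exists N => n Nn.
  by rewrite ltNge; apply/negP => sn; apply: nn; exists n.
have [N2 N2P] : exists N, forall n, (N <= n)%N -> s n < ratr r.
  apply: contrapT => nN; apply: (noosc q r); [lra|lra|exact: Aq|] => N.
  apply: contrapT => nn; apply: nN; exists N => n Nn.
  by rewrite ltNge; apply/negP => sn; apply: nn; exists n.
exists (maxn N1 N2) => // n /=; rewrite geq_max => /andP[/N1P ? /N2P ?].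
by rewrite ltr_norml; apply/andP; split; lra.
Qed.

Section supermartingale.
Context {R : realType} d {T : measurableType d} (P : probability T R).
Variables (C : nat -> set (set T)) (S q : nat -> T -> R).
Hypotheses (C_measurable : forall n, <<s C n >> `<=` measurable)
  (C_nd : forall n, <<s C n >> `<=` <<s C n.+1 >>)
  (S_adapted : forall n, adapted (C n) (S n)) (S_ge0 : forall n w, 0 <= S n w)
  (q_measurable : forall n, measurable_fun setT (q n)) (q_ge0 : forall n w, 0 <= q n w)
  (Sq : forall n, cond_le P (C n) (fun w => S n.+1 w + q n w) (S n)).

Let S_measurable n : measurable_fun setT (S n).
Proof. exact: adapted_measurable (@C_measurable n) (@S_adapted n). Qed.

Let hold a b n (w : T) : bool := holding a b (fun k => S k w) n.
Let upc a b n (w : T) : R := (upcrossings a b (fun k => S k w) n)%:R.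

Let hold_adapted a b n : measurable_fun [set: g_sigma_algebraType (C n)]
  (hold a b n : g_sigma_algebraType (C n) -> bool).
Proof.
elim: n => [|n IH]; first by apply: measurable_fun_ler => //; exact: S_adapted.
have IH' : measurable_fun [set: g_sigma_algebraType (C n.+1)]
    (hold a b n : g_sigma_algebraType (C n.+1) -> bool).
  by move=> _ B mB; rewrite setTI; apply: C_nd; have := IH measurableT B mB; rewrite setTI.
apply: (measurable_fun_ifT IH').
- by apply: measurable_fun_ltr => //; exact: S_adapted.
- by apply: measurable_fun_ler => //; exact: S_adapted.
Qed.

Let hold_measurable a b n : measurable_fun setT (hold a b n).
Proof.
by move=> _ B mB; rewrite setTI; apply: (@C_measurable n);
  have := @hold_adapted a b n measurableT B mB; rewrite setTI.
Qed.

Let upc_adapted a b n : adapted (C n) (upc a b n).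
Proof.
elim: n => [|n IH]; first exact: measurable_cst.
rewrite /adapted (_ : upc a b n.+1 =
  (fun w => upc a b n w + (hold a b n w && (b <= S n.+1 w))%:R)); last first.
  by apply/funext => w; rewrite /upc/= natrD.
apply: measurable_funD; first exact: (adaptedS (@C_nd n)).
apply: adapted_indic; apply: measurable_and.
  by move=> _ B mB; rewrite setTI; apply: C_nd;
     have := @hold_adapted a b n measurableT B mB; rewrite setTI.
by apply: measurable_fun_ler => //; exact: S_adapted.
Qed.

(** The value of the portfolio, profits included, is itself a supermartingale
    whose initial value is at most a. *)
Let value a b n w : R := (b - a) * upc a b n w + (if hold a b n w then S n w else a).

Let value_measurable a b n : measurable_fun setT (value a b n).
Proof.
apply: measurable_funD.
  by apply: measurable_funM => //; exact: adapted_measurable (@C_measurable n) (@upc_adapted a b n).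
exact: measurable_fun_ifT.
Qed.

Let integral_value a b n : 0 <= a -> a < b ->
  (\int[P]_w (value a b n w)%:E <= a%:E)%E.
Proof.
move=> a0 ab.
have v0 k w : 0 <= value a b k w.
  by rewrite addr_ge0 ?mulr_ge0 ?ler0n ?subr_ge0 ?(ltW ab)//; case: ifP.
elim: n => [|n]; last apply: le_trans.
  apply: (@le_trans _ _ (\int[P]_w (cst a%:E) w)%E); last first.
    by rewrite integral_cst// [X in (_ * X)%E](@probability_setT _ _ _ P) mule1.
  apply: ge0_le_integral => //=.
  - by move=> w _; rewrite lee_fin.
  - exact/measurable_EFinP.
  - move=> w _; rewrite lee_fin /value /upc /= mulr0 add0r.
    by rewrite /hold/=; case: ifP.
pose X w := (b - a) * upc a b n w + (if hold a b n w then 0 else a).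
pose h w := (hold a b n w)%:R : R.
have mupc := adapted_measurable (@C_measurable n) (@upc_adapted a b n).
have mX : measurable_fun setT X.
  apply: measurable_funD; first exact: measurable_funM.
  exact: measurable_fun_ifT.
have X0 w : 0 <= X w.
  by rewrite addr_ge0 ?mulr_ge0 ?ler0n ?subr_ge0 ?(ltW ab)//; case: ifP.
have ah : adapted (C n) h by apply: adapted_indic.
have mh : measurable_fun setT h := adapted_measurable (@C_measurable n) ah.
have h0 w : 0 <= h w by rewrite ler0n.
have split (Y : T -> R) : measurable_fun setT Y -> (forall w, 0 <= Y w) ->
    (\int[P]_w (X w + h w * Y w)%:E = \int[P]_w (X w)%:E + \int[P]_w (h w * Y w)%:E)%E.
  move=> mY Y0; under eq_integral do rewrite EFinD.
  rewrite ge0_integralD//.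
  - by move=> w _; rewrite lee_fin.
  - exact/measurable_EFinP.
  - by move=> w _; rewrite lee_fin mulr_ge0.
  - by apply/measurable_EFinP; exact: measurable_funM.
apply: (@le_trans _ _ (\int[P]_w (X w + h w * (S n.+1 w + q n w))%:E)%E).
  apply: ge0_le_integral => //=.
  - by move=> w _; rewrite lee_fin.
  - exact/measurable_EFinP.
  - apply/measurable_EFinP; apply: measurable_funD => //.
    by apply: measurable_funM => //; exact: measurable_funD.
  - move=> w _; rewrite lee_fin /value /X /h /upc/= natrD /hold/=.
    have := q_ge0 n w; have := S_ge0 n.+1 w.
    case: (holding _ _ _ _) => /=; last first.
      move=> *; rewrite addr0 mul0r addr0 lerD2l; case: ifP => //.
    by case: ltP => /= *; lra.
apply: (@le_trans _ _ (\int[P]_w (X w + h w * S n w)%:E)%E); last first.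
  apply: ge0_le_integral => //=.
  - by move=> w _; rewrite lee_fin addr_ge0// mulr_ge0.
  - by apply/measurable_EFinP; apply: measurable_funD => //; exact: measurable_funM.
  - exact/measurable_EFinP.
  - move=> w _; rewrite lee_fin /value /X /h.
    by case: (hold _ _ _ _); rewrite ?mul1r ?mul0r ?addr0 -?addrA ?add0r.
rewrite !split//; first last.
- by move=> w; rewrite addr_ge0.
- exact: measurable_funD.
by apply: leeD => //; exact: Sq.
Qed.

Let no_oscillation a b : 0 <= a -> a < b ->
  {ae P, forall w, (forall N, exists2 n, (N <= n)%N & S n w <= a) ->
    (forall N, exists2 n, (N <= n)%N & b <= S n w) -> False}.
Proof.
move=> a0 ab.
have v0 n w : 0 <= value a b n w.
  by rewrite addr_ge0 ?mulr_ge0 ?ler0n ?subr_ge0 ?(ltW ab)//; case: ifP.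
have := @freq_bounded_of_integral _ _ _ P (fun n => value a b n) a
  (@value_measurable a b) v0 (fun n => integral_value n a0 ab).
apply: filterS => w [K KP] freq_a freq_b.
have [n Kn] := upcrossings_unbounded ab freq_a freq_b (Num.truncn (K / (b - a))).+1.
have [k nk vk] := KP n.
have ba : 0 < b - a by rewrite subr_gt0.
have : (b - a) * upc a b k w <= K.
  by apply: le_trans vk; rewrite lerDl; case: ifP.
apply/negP; rewrite -ltNge mulrC -ltr_pdivrMr//.
apply: lt_le_trans (truncnS_gt _) _; rewrite ler_nat; apply: leq_trans Kn _.
by rewrite -(subnKC nk) upcrossings_nd.
Qed.

Let partial_sum_bound (K : R) n : 0 <= K ->
  (\int[P]_w (((S 0%N w <= K)%R%:R * (S n w + \sum_(k < n) q k w))%R)%:E <= K%:E)%E.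
Proof.
move=> K0; pose h w := (S 0%N w <= K)%R%:R : R.
have ah k : adapted (C k) h.
  elim: k => [|k IH]; last exact: adaptedS (@C_nd k) IH.
  by apply: adapted_indic; apply: measurable_fun_ler => //; exact: S_adapted.
have h0 w : 0 <= h w by rewrite ler0n.
have mh : measurable_fun setT h := adapted_measurable (@C_measurable 0%N) (ah 0%N).
have msum k : measurable_fun setT (fun w => \sum_(j < k) q j w) by exact: measurable_sum.
have sum0 k w : 0 <= \sum_(j < k) q j w by apply: sumr_ge0.
elim: n => [|n]; last apply: le_trans.
  apply: (@le_trans _ _ (\int[P]_w (cst K%:E) w)%E); last first.
    by rewrite integral_cst// [X in (_ * X)%E](@probability_setT _ _ _ P) mule1.
  under eq_integral do rewrite big_ord0 addr0.
  apply: ge0_le_integral => //=.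
  - by move=> w _; rewrite lee_fin mulr_ge0// ler0n.
  - by apply/measurable_EFinP; exact: (measurable_funM mh).
  - by move=> w _; rewrite lee_fin; case: (leP (S 0%N w) K) => SK; rewrite ?mul1r ?mul0r.
have split (Y : T -> R) : measurable_fun setT Y -> (forall w, 0 <= Y w) ->
    (\int[P]_w (h w * Y w + h w * \sum_(j < n) q j w)%:E =
     \int[P]_w (h w * Y w)%:E + \int[P]_w (h w * \sum_(j < n) q j w)%:E)%E.
  move=> mY Y0; under eq_integral do rewrite EFinD.
  rewrite ge0_integralD//.
  - by move=> w _; rewrite lee_fin mulr_ge0.
  - by apply/measurable_EFinP; exact: measurable_funM.
  - by move=> w _; rewrite lee_fin mulr_ge0.
  - by apply/measurable_EFinP; exact: measurable_funM.
have -> : (\int[P]_w (((S 0%N w <= K)%R%:R * (S n.+1 w + \sum_(k < n.+1) q k w))%R)%:E =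
    \int[P]_w (h w * (S n.+1 w + q n w) + h w * \sum_(j < n) q j w)%:E)%E.
  apply: eq_integral => w _; congr EFin; rewrite big_ord_recr/= -/(h w); ring.
have -> : (\int[P]_w (((S 0%N w <= K)%R%:R * (S n w + \sum_(k < n) q k w))%R)%:E =
    \int[P]_w (h w * S n w + h w * \sum_(j < n) q j w)%:E)%E.
  by apply: eq_integral => w _; rewrite mulrDr.
rewrite !split//; first last.
- by move=> w; rewrite addr_ge0.
- exact: measurable_funD.
by rewrite leeD2r//; exact: Sq.
Qed.

(** The convergence theorem for nonnegative supermartingales, with a gain q.
    Oscillations across the countably many rational intervals are excluded one at
    a time; boundedness is obtained on the events where the initial value is at
    most an integer, as the initial value need not be integrable. *)
Lemma supermartingale_cvg :
  {ae P, forall w, cvgn (fun n => S n w) /\ cvgn (fun n => \sum_(k < n) q k w)}.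
Proof.
have osc : {ae P, forall w, forall qr : rat * rat, 0 <= ratr qr.1 :> R ->
    ratr qr.1 < ratr qr.2 :> R ->
    (forall N, exists2 n, (N <= n)%N & S n w <= ratr qr.1) ->
    (forall N, exists2 n, (N <= n)%N & ratr qr.2 <= S n w) -> False}.
  have : {ae P, forall w, forall k : nat, forall qr : rat * rat, unpickle k = Some qr ->
      0 <= ratr qr.1 :> R -> ratr qr.1 < ratr qr.2 :> R ->
      (forall N, exists2 n, (N <= n)%N & S n w <= ratr qr.1) ->
      (forall N, exists2 n, (N <= n)%N & ratr qr.2 <= S n w) -> False}.
    apply: ae_foralln => k; case: (unpickle k) => [[q1 q2]|]; last exact: nearW.
    have [/andP[q0 q12]|nq] := boolP ((0 <= ratr q1 :> R) && (ratr q1 < ratr q2 :> R)).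
      by have := no_oscillation q0 q12; apply: filterS => w h _ [<-] /= _ _; exact: h.
    by apply: nearW => w _ [<-] /= q0 q12; move: nq; rewrite q0 q12.
  by apply: filterS => w h qr; exact: (h (pickle qr) qr (pickleK qr)).
have bnd : {ae P, forall w, forall j : nat, exists K : R, forall N, exists2 n, (N <= n)%N &
    (S 0%N w <= j%:R)%R%:R * (S n w + \sum_(k < n) q k w) <= K}.
  apply: ae_foralln => j.
  apply: (@freq_bounded_of_integral _ _ _ P
    (fun n w => (S 0%N w <= j%:R)%R%:R * (S n w + \sum_(k < n) q k w)) j%:R) => [n|n w|n].
  - apply: measurable_funM.
      apply: (adapted_measurable (@C_measurable 0%N)); apply: adapted_indic.
      by apply: measurable_fun_ler => //; exact: S_adapted.
    by apply: measurable_funD => //; exact: measurable_sum.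
  - by rewrite mulr_ge0 ?ler0n// addr_ge0// sumr_ge0.
  - exact: partial_sum_bound.
move: osc bnd; apply: filterS2 => w osc bnd.
have [K KP] := bnd (Num.truncn (S 0%N w)).+1.
have S0K : S 0%N w <= (Num.truncn (S 0%N w)).+1%:R by exact/ltW/truncnS_gt.
rewrite S0K in KP.
have sum0 n : 0 <= \sum_(k < n) q k w by apply: sumr_ge0.
split.
  apply: (@cvg_of_no_oscillation _ _ K) => // [N|r s r0 rs].
    have [n Nn le] := KP N; exists n => //; apply: le_trans le.
    by rewrite mul1r lerDl.
  exact: (osc (r, s)).
have nd : {homo (fun n => \sum_(k < n) q k w) : m n / (m <= n)%N >-> m <= n}.
  move=> i j ij; rewrite -(subnKC ij) big_split_ord/= lerDl sumr_ge0//.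
apply: nondecreasing_is_cvgn => //.
exists K => _ [n _ <-]; have [k nk le] := KP n.
apply: le_trans (nd _ _ nk) _; apply: le_trans le.
by rewrite mul1r lerDr.
Qed.

End supermartingale.

(** * Stochastic quasi-Fejer monotonicity *)

(** Meant for nonnegative sequences, for which bounded partial sums amount to
    summability. *)
Definition summable_seq {R : realType} (u : nat -> R) :=
  exists M : R, forall n, \sum_(k < n) u k <= M.

Lemma summable_seq_cvg0 {R : realType} (u : nat -> R) :
  (forall n, 0 <= u n) -> summable_seq u -> u @ \oo --> (0 : R).
Proof.
move=> u0 [M uM]; apply: cvg_series_cvg_0.
apply: nondecreasing_is_cvgn.
  by move=> i j ij; rewrite -subr_ge0 sub_series ij; apply: sumr_ge0.
by exists M => _ [n _ <-]; rewrite /series/= big_mkord.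
Qed.

Lemma cvg_summable_seq {R : realType} (u : nat -> R) :
  (forall n, 0 <= u n) -> cvgn (fun n => \sum_(k < n) u k) -> summable_seq u.
Proof.
move=> u0 cu; exists (limn (fun n => \sum_(k < n) u k)) => n.
apply: (@nondecreasing_cvgn_le _ (fun n => \sum_(k < n) u k)) => // i j ij.
by rewrite -(subnKC ij) big_split_ord/= lerDl sumr_ge0.
Qed.

Lemma summable_sqrte {R : realType} (u : nat -> \bar R) : (forall n, (0 <= u n)%E) ->
  (\sum_(0 <= n <oo) sqrte (u n) < +oo)%E ->
  (forall n, (u n < +oo)%E) /\ summable_seq (fun n => Num.sqrt (fine (u n))).
Proof.
move=> u0 uS.
have s0 n : (0 <= sqrte (u n))%E by exact: sqrte_ge0.
have le n : (\sum_(0 <= k < n) sqrte (u k) <= \sum_(0 <= k <oo) sqrte (u k))%E.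
  by apply: nneseries_lim_ge => k _ _; exact: s0.
have ufin n : (u n < +oo)%E.
  rewrite ltey; apply/eqP => un; move: (le n.+1); rewrite big_nat_recr//= un /=.
  rewrite addey; last first.
    by rewrite -ltNye (lt_le_trans (ltNyr 0))// sume_ge0.
  by rewrite leye_eq => /eqP e; rewrite e in uS.
split=> //; exists (fine (\sum_(0 <= k <oo) sqrte (u k))%E) => n.
have E k : sqrte (u k) = (Num.sqrt (fine (u k)))%:E.
  by case: (u k) (u0 k) (ufin k).
have sfin : (\sum_(0 <= k <oo) sqrte (u k))%E \is a fin_num.
  by rewrite ge0_fin_numE//; apply: nneseries_ge0.
rewrite -lee_fin fineK// -sumEFin; apply: le_trans (le n).
by rewrite big_mkord; under [leRHS]eq_bigr do rewrite E.
Qed.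

Section almost_supermartingale.
Context {R : realType} d {T : measurableType d} (P : probability T R).
Variables (C : nat -> set (set T)).
Hypotheses (C_measurable : forall n, <<s C n >> `<=` measurable)
  (C_nd : forall n, <<s C n >> `<=` <<s C n.+1 >>).

(** Robbins and Siegmund: discounting by the product of the factors 1 + chi turns an
    almost supermartingale into a supermartingale. *)
Lemma robbins_siegmund (V chi theta : nat -> T -> R) :
  (forall n, adapted (C n) (V n)) -> (forall n w, 0 <= V n w) ->
  (forall n, adapted (C n) (chi n)) -> (forall n w, 0 <= chi n w) ->
  (forall n, measurable_fun setT (theta n)) -> (forall n w, 0 <= theta n w) ->
  (forall n, cond_le P (C n) (fun w => V n.+1 w + theta n w) (fun w => (1 + chi n w) * V n w)) ->
  {ae P, forall w, summable_seq (chi^~ w)} ->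
  {ae P, forall w, cvgn (V^~ w) /\ summable_seq (theta^~ w)}.
Proof.
move=> aV V0 achi chi0 mtheta theta0 Vle sumchi.
pose p n w := \prod_(k < n) (1 + chi k w).
have p0 n w : 0 < p n w by apply: prodr_gt0 => k _; rewrite ltr_wpDr.
have chi_adapted n k : (k <= n)%N -> adapted (C n) (chi k).
  move=> kn; rewrite -(subnK kn); elim: (n - k)%N => [|j IH]; first exact: achi.
  exact: adaptedS (@C_nd _) IH.
have ap n : adapted (C n) (p n.+1).
  apply: measurable_prod => k _; apply: measurable_funD; first exact: measurable_cst.
  by apply: chi_adapted; rewrite -ltnS ltn_ord.
have ap' n : adapted (C n) (p n).
  case: n => [|n]; last exact: adaptedS (@C_nd _) (ap n).
  rewrite /adapted (_ : p 0%N = cst 1); first exact: measurable_cst.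
  by apply/funext => w; rewrite /p big_ord0.
have aV' n : adapted (C n) (fun w => (p n w)^-1 * V n w).
  by apply: measurable_funM; [exact: adaptedV|exact: aV].
have mpV n : measurable_fun setT (fun w => (p n.+1 w)^-1 * theta n w).
  apply: measurable_funM => //.
  by apply: (adapted_measurable (@C_measurable n)); exact: adaptedV.
have V'0 n w : 0 <= (p n w)^-1 * V n w by rewrite mulr_ge0// invr_ge0 ltW.
have th'0 n w : 0 <= (p n.+1 w)^-1 * theta n w by rewrite mulr_ge0// invr_ge0 ltW.
have pV n : cond_le P (C n)
    (fun w => (p n.+1 w)^-1 * V n.+1 w + (p n.+1 w)^-1 * theta n w)
    (fun w => (p n w)^-1 * V n w).
  have := cond_leM (fun w => ltW (_ : 0 < (p n.+1 w)^-1)) (adaptedV (p0 n.+1) (ap n)) (Vle n).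
  have -> : (fun w => (p n.+1 w)^-1 * (V n.+1 w + theta n w)) =
      (fun w => (p n.+1 w)^-1 * V n.+1 w + (p n.+1 w)^-1 * theta n w).
    by apply/funext => w; rewrite mulrDr.
  have -> : (fun w => (p n.+1 w)^-1 * ((1 + chi n w) * V n w)) =
      (fun w => (p n w)^-1 * V n w).
    apply/funext => w; rewrite /p big_ord_recr/=; field.
    by rewrite !gt_eqF ?ltr_wpDr//; exact: p0.
  by apply => w; rewrite invr_gt0.
have := supermartingale_cvg C_measurable C_nd aV' V'0 mpV th'0 pV.
move: sumchi; apply: filterS2 => w [M chiM] [cV cth].
have pM n : p n w <= expR M.
  apply: (@le_trans _ _ (expR (\sum_(k < n) chi k w))); last by rewrite ler_expR.
  rewrite expR_sum; apply: ler_prod => k _.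
  by rewrite addr_ge0//= expR_ge1Dx.
have pnd : {homo (p^~ w) : m n / (m <= n)%N >-> m <= n}.
  move=> i j ij; rewrite -(subnKC ij); elim: (j - i)%N => [|k IH]; first by rewrite addn0.
  apply: le_trans IH _; rewrite addnS /p big_ord_recr/= ler_peMr ?lerDl//.
  exact: ltW (p0 _ _).
have cp : cvgn (p^~ w).
  apply: nondecreasing_is_cvgn => //.
  by exists (expR M) => _ [n _ <-].
split.
  have -> : V^~ w = (fun n => p n w * ((p n w)^-1 * V n w)).
    by apply/funext => n; rewrite mulrA mulfV ?mul1r// gt_eqF.
  exact: is_cvgM.
have [K KP] := cvg_summable_seq (fun n => th'0 n w) cth.
exists (expR M * K) => n; apply: le_trans (ler_wpM2l (expR_ge0 M) (KP n)).
rewrite mulr_sumr; apply: ler_sum => k _.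
rewrite mulrA ler_peMl// -ler_pdivrMr ?invr_gt0// invrK mul1r.
exact: pM.
Qed.

(** Stochastic quasi-Fejer monotonicity. The error e is absorbed by Young's
    inequality (t + e)^2 <= (1 + s) t^2 + (1 + 1 / s) e^2 with the predictable
    weight s = xi + 2^-n; the geometric term keeps s positive. *)
Lemma stochastic_quasi_fejer (D t e xi theta : nat -> T -> R) :
  (forall n, adapted (C n) (D n)) -> (forall n w, 0 <= D n w) ->
  (forall n, adapted (C n) (xi n)) -> (forall n w, 0 <= xi n w) ->
  (forall n, measurable_fun setT (t n)) -> (forall n w, 0 <= t n w) ->
  (forall n, measurable_fun setT (e n)) -> (forall n w, 0 <= e n w) ->
  (forall n, measurable_fun setT (theta n)) -> (forall n w, 0 <= theta n w) ->
  (forall n w, D n.+1 w <= t n w + e n w) ->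
  (forall n, cond_le P (C n) (fun w => t n w ^+ 2 + theta n w) (fun w => D n w ^+ 2)) ->
  (forall n, cond_le P (C n) (fun w => e n w ^+ 2) (fun w => xi n w ^+ 2)) ->
  {ae P, forall w, summable_seq (xi^~ w)} ->
  {ae P, forall w, cvgn (D^~ w) /\ summable_seq (theta^~ w)}.
Proof.
move=> aD D0 axi xi0 mt t0 me e0 mth th0 Dte tD exi sumxi.
pose s n w := xi n w + 2^-1 ^+ n.
have s0 n w : 0 < s n w by rewrite ltr_wpDl// exprn_gt0.
have as_ n : adapted (C n) (s n) by apply: measurable_funD; [exact: axi|exact: measurable_cst].
have ams n : measurable_fun setT (s n) := adapted_measurable (@C_measurable n) (@as_ n).
have mD n : measurable_fun setT (D n) := adapted_measurable (@C_measurable n) (@aD n).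
have mxi n : measurable_fun setT (xi n) := adapted_measurable (@C_measurable n) (@axi n).
have asV n : adapted (C n) (fun w => (s n w)^-1) by exact: adaptedV.
have msV n : measurable_fun setT (fun w => (s n w)^-1) :=
  adapted_measurable (@C_measurable n) (@asV n).
have aV n : adapted (C n) (fun w => 1 + D n w ^+ 2).
  by apply: measurable_funD; [exact: measurable_cst|apply: measurable_funX; exact: aD].
have achi n : adapted (C n) (fun w => 2 * s n w + s n w ^+ 2).
  apply: measurable_funD; last by apply: measurable_funX; exact: as_.
  by apply: measurable_funM; [exact: measurable_cst|exact: as_].
have V0 n w : 0 <= 1 + D n w ^+ 2 by rewrite addr_ge0// exprn_ge0.
have chi0 n w : 0 <= 2 * s n w + s n w ^+ 2.
  by rewrite addr_ge0 ?exprn_ge0 ?mulr_ge0// ltW.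
have le n : cond_le P (C n) (fun w => 1 + D n.+1 w ^+ 2 + theta n w)
    (fun w => (1 + (2 * s n w + s n w ^+ 2)) * (1 + D n w ^+ 2)).
  have CM := @C_measurable n.
  pose A1 w := (1 + s n w) * (t n w ^+ 2 + theta n w).
  pose A2 w := (1 + (s n w)^-1) * e n w ^+ 2.
  pose B1 w := (1 + s n w) * D n w ^+ 2.
  pose B2 w := (1 + (s n w)^-1) * xi n w ^+ 2.
  have k1 w : 0 <= 1 + s n w by rewrite addr_ge0// ltW.
  have k2 w : 0 <= 1 + (s n w)^-1 by rewrite addr_ge0// invr_ge0 ltW.
  have ak1 : adapted (C n) (fun w => 1 + s n w).
    by apply: measurable_funD; [exact: measurable_cst|exact: as_].
  have ak2 : adapted (C n) (fun w => 1 + (s n w)^-1).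
    by apply: measurable_funD; [exact: measurable_cst|exact: asV].
  have mk1 := adapted_measurable CM ak1; have mk2 := adapted_measurable CM ak2.
  have mA1 : measurable_fun setT A1.
    by apply: measurable_funM => //; apply: measurable_funD => //; exact: measurable_funX.
  have mA2 : measurable_fun setT A2 by apply: measurable_funM => //; exact: measurable_funX.
  have mB1 : measurable_fun setT B1 by apply: measurable_funM => //; exact: measurable_funX.
  have mB2 : measurable_fun setT B2 by apply: measurable_funM => //; exact: measurable_funX.
  have A10 w : 0 <= A1 w by rewrite mulr_ge0// addr_ge0// exprn_ge0.
  have A20 w : 0 <= A2 w by rewrite mulr_ge0// exprn_ge0.
  have B10 w : 0 <= B1 w by rewrite mulr_ge0// exprn_ge0.
  have B20 w : 0 <= B2 w by rewrite mulr_ge0// exprn_ge0.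
  have AB1 : cond_le P (C n) A1 B1 by exact: cond_leM.
  have AB2 : cond_le P (C n) A2 B2 by exact: cond_leM.
  have mone : measurable_fun setT (cst 1 : T -> R) by exact: measurable_cst.
  have AB : cond_le P (C n) (cst 1 \+ (A1 \+ A2)) (cst 1 \+ (B1 \+ B2)).
    apply: cond_leD => //; try exact: measurable_funD.
    - by move=> w; rewrite addr_ge0.
    - by move=> w; rewrite addr_ge0.
    - exact: cond_leD.
  apply: (cond_le_trans (Z := cst 1 \+ (A1 \+ A2))).
    apply: cond_le_pointwise => //.
    - apply: measurable_funD => //; apply: measurable_funD => //; exact: measurable_funX.
    - by apply: measurable_funD => //; exact: measurable_funD.
    - by move=> w; rewrite addr_ge0.
    - move=> w /=; have := Dte n w; have := s0 n w; have := D0 n.+1 w.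
      have := t0 n w; have := e0 n w; have := th0 n w.
      rewrite /A1 /A2; move: (D n.+1 w) (t n w) (e n w) (theta n w) (s n w).
      move=> D' t' e' th' s' th'0 e'0 t'0 D'0 s'0 le.
      have sq : D' ^+ 2 <= (t' + e') ^+ 2 by rewrite ler_sqr ?nnegrE// addr_ge0.
      have young : 0 <= s'^-1 * (s' * t' - e') ^+ 2.
        by rewrite mulr_ge0 ?exprn_even_ge0// invr_ge0 ltW.
      have E : s'^-1 * (s' * t' - e') ^+ 2 = s' * t' ^+ 2 - 2 * t' * e' + s'^-1 * e' ^+ 2.
        by field; rewrite gt_eqF.
      have : 0 <= s' * th' by rewrite mulr_ge0// ltW.
      rewrite E in young; move: young {E}; move: (s'^-1) => v; lra.
  apply: (cond_le_trans AB); apply: cond_le_pointwise => //.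
  - by apply: measurable_funD => //; exact: measurable_funD.
  - apply: measurable_funM; last by apply: measurable_funD => //; exact: measurable_funX.
    exact: measurable_funD (adapted_measurable CM (@achi n)).
  - by move=> w /=; rewrite !addr_ge0.
  - move=> w /=; rewrite /B1 /B2; have := s0 n w; have := xi0 n w.
    have xs : xi n w <= s n w by rewrite lerDl exprn_ge0.
    move=> x0 ss0; have B2le : (1 + (s n w)^-1) * xi n w ^+ 2 <= s n w ^+ 2 + s n w.
      apply: le_trans (_ : (1 + (s n w)^-1) * s n w ^+ 2 <= _).
        by rewrite ler_wpM2l// ler_sqr ?nnegrE// ltW.
      by rewrite le_eqVlt; apply/orP; left; apply/eqP; field; rewrite gt_eqF.
    move: B2le; move: ((1 + (s n w)^-1) * xi n w ^+ 2) => b.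
    have := sqr_ge0 (D n w); move: (D n w ^+ 2) => dd; nra.
have sumchi : {ae P, forall w, summable_seq (fun n => 2 * s n w + s n w ^+ 2)}.
  apply: filterS sumxi => w [M xiM].
  have sM n : \sum_(k < n) s k w <= M + 2.
    rewrite big_split/= lerD//; first exact: xiM.
    have : 0 <= (2^-1 : R) ^+ n by rewrite exprn_ge0.
    suff -> : \sum_(k < n) 2^-1 ^+ k = 2 - 2 * 2^-1 ^+ n :> R by lra.
    elim: n => [|n IH]; first by rewrite big_ord0 expr0; ring.
    by rewrite big_ord_recr/= IH exprS; field.
  have s1 n : s n w <= M + 2.
    apply: le_trans (sM n.+1); rewrite big_ord_recr/= lerDr.
    by apply: sumr_ge0 => k _; exact: ltW.
  exists ((2 + (M + 2)) * (M + 2)) => n.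
  have M0 : 0 <= M + 2 by apply: le_trans (s1 0%N); exact: ltW.
  apply: le_trans (_ : (2 + (M + 2)) * \sum_(k < n) s k w <= _).
    rewrite mulr_sumr; apply: ler_sum => k _.
    rewrite expr2 -mulrDl ler_wpM2r ?lerD2l//; exact: ltW.
  by rewrite ler_wpM2l// addr_ge0.
have := @robbins_siegmund _ _ theta aV V0 achi chi0 mth th0 le sumchi.
apply: filterS => w [cV sth]; split => //.
have -> : D^~ w = (fun n => Num.sqrt (1 + D n w ^+ 2 - 1)).
  by apply/funext => n; rewrite addrAC subrr add0r sqrtr_sqr ger0_norm.
move/cvg_ex : cV => [l lP]; apply/cvg_ex; exists (Num.sqrt (l - 1)).
apply: continuous_cvg; first exact: sqrt_continuous.
by apply: cvgB => //; exact: cvg_cst.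
Qed.

End almost_supermartingale.

(** * Continuity and random vectors in separable spaces *)

Lemma lipschitz_continuous {R : realType} {V : hilbertType R} {W : normedModType R}
    (f : V -> W) (k : R) : (forall x y, `|f x - f y| <= k * `|x - y|) -> continuous f.
Proof.
move=> fk x; apply/cvgrPdist_lt => e e0.
have k0 : 0 < `|k| + 1 by rewrite ltr_wpDl.
have e1 : 0 < e / (`|k| + 1) by rewrite divr_gt0.
have : y @[y --> x] --> x by [].
move/cvgrPdist_lt => /(_ _ e1); apply: filterS => y xy.
apply: le_lt_trans (fk x y) _; move: xy; rewrite ltr_pdivlMr// mulrC.
by apply: le_lt_trans; rewrite ler_wpM2r// (le_trans (ler_norm _))// lerDl.
Qed.

Lemma continuous_subr {R : realType} {V : topologicalType} {W : normedModType R}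
    (F F' : V -> W) : continuous F -> continuous F' -> continuous (fun u => F u - F' u).
Proof. by move=> cF cF' u; apply: cvgB; [exact: cF|exact: cF']. Qed.

Lemma continuous_subc {R : realType} {V : topologicalType} {W : normedModType R}
    (F : V -> W) (c : W) : continuous F -> continuous (fun u => F u - c).
Proof. by move=> cF; apply: continuous_subr => // u; exact: cvg_cst. Qed.

Lemma continuous_addr {R : realType} {V : topologicalType} {W : normedModType R}
    (F F' : V -> W) : continuous F -> continuous F' -> continuous (fun u => F u + F' u).
Proof. by move=> cF cF' u; apply: cvgD; [exact: cF|exact: cF']. Qed.

Lemma continuous_scaler {R : realType} {V : topologicalType} {W : normedModType R}
    (k : R) (F : V -> W) : continuous F -> continuous (fun u => k *: F u).
Proof. by move=> cF u; apply: cvgZl_tmp; exact: cF. Qed.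

Definition dense_seq {R : realType} {V : hilbertType R} (e : nat -> V) :=
  forall x eps, 0 < eps -> exists n, `|e n - x| < eps.

(** Indices that the enumeration of the dense set leaves out yield an arbitrary
    vector, which does not affect density. *)
Lemma separable_dense_seq {R : realType} (V : hilbertType R) :
  separable V -> exists e : nat -> V, dense_seq e.
Proof.
move=> [A [/countable_injP[f f_inj] dA]].
exists (fun n => get [set a | A a /\ f a = n]) => x eps eps0.
have ob : open (ball x eps) by exact: ball_open.
have [|a [xa Aa]] := dA (ball x eps) _ ob.
  by exists x; exact: ballxx.
exists (f a); have [Ag fg] : [set a' | A a' /\ f a' = f a] (get [set a' | A a' /\ f a' = f a]).
  by apply: getPex; exists a.
have -> : get [set a' | A a' /\ f a' = f a] = a.
  by apply: f_inj; rewrite ?inE.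
by rewrite -normrN opprB; move: xa; rewrite -ball_normE.
Qed.

Lemma hsum_dense_seq {R : realType} {m : nat} {H : 'I_m -> hilbertType R}
    (e : forall i, nat -> H i) :
  (forall i, dense_seq (e i)) -> exists E : nat -> hsum H, dense_seq E.
Proof.
move=> de.
exists (fun n => if unpickle n is Some phi then
  (fun i => e i ((phi : {ffun 'I_m -> nat}) i)) : hsum H else 0) => x eps eps0.
have eps1 : 0 < eps / (#|'I_m|.+1)%:R by rewrite divr_gt0.
have /choice[phi phiP] : forall i, exists n, `|e i n - x i| < eps / (#|'I_m|.+1)%:R.
  by move=> i; exact: de.
exists (pickle [ffun i => phi i]); rewrite pickleK.
set y : hsum H := fun i => _.
have yi i : (y - x) i = e i (phi i) - x i.
  by have -> : (y - x) i = y i - x i by []; rewrite /y ffunE.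
by apply: hsum_norm_lt => // i; rewrite yi.
Qed.

(** Subsets of separable metric spaces are separable: one point of F is chosen in
    every ball of radius 1 / k.+1 around a point of the dense sequence that
    meets F. *)
Lemma dense_seq_subset {R : realType} {V : hilbertType R} (e : nat -> V) (F : set V) :
  dense_seq e -> F !=set0 -> exists c : nat -> V, (forall n, F (c n)) /\
  forall z, F z -> forall eps, 0 < eps -> exists n, `|c n - z| < eps.
Proof.
move=> de [z0 Fz0].
pose good n k := [set z | F z /\ `|e n - z| < k.+1%:R^-1].
pose c j := if unpickle j is Some (n, k) then
  if pselect (good n k !=set0) then get (good n k) else z0 else z0.
exists c; split.
  move=> j; rewrite /c; case: (unpickle j) => [[n k]|//].
  by case: pselect => [ex|//]; have [] := getPex ex.
move=> z Fz eps eps0.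
have [k keps] : exists k : nat, k.+1%:R^-1 < eps / 2.
  have eps2 : 0 < eps / 2 by rewrite divr_gt0.
  have [N _ NP] := near_infty_natSinv_lt (PosNum eps2).
  by exists N; have /= := NP N (leqnn N).
have [|n nz] := de z (k.+1%:R^-1); first by rewrite invr_gt0.
exists (pickle (n, k)); rewrite /c pickleK.
case: pselect => [[z' gz']|]; last by case; exists z.
have [_ gn] : good n k (get (good n k)) by apply: getPex; exists z'.
rewrite -(subrKA (e n)); apply: le_lt_trans (ler_normD _ _) _.
rewrite -normrN opprB in gn.
by move: keps nz gn; move: (k.+1%:R^-1) => ?; lra.
Qed.

Section random_vectors.
Context {R : realType} d {T : measurableType d}.
Implicit Types V W : hilbertType R.

Lemma open_borel V (U : set V) : open U -> @measurable _ (borel V) U.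
Proof. by move=> oU; exact: sub_sigma_algebra. Qed.

Lemma random_vectorP V (X : T -> V) :
  random_vector X <-> forall U, open U -> measurable (X @^-1` U).
Proof.
split=> [mX U oU|oX].
  by have := mX measurableT U (open_borel oU); rewrite setTI.
apply: (@measurability _ _ T (borel V) setT X (@open V)) => //.
by move=> _ [U oU <-]; rewrite setTI; exact: oX.
Qed.

Lemma random_vector_continuous V W (X : T -> V) (g : V -> W) :
  continuous g -> random_vector X -> random_vector (fun w => g (X w)).
Proof.
move=> cg /random_vectorP mX; apply/random_vectorP => U oU.
by move/continuousP : cg => cg; exact: (mX (g @^-1` U) (cg U oU)).
Qed.

Lemma continuous_borel V (phi : V -> R) :
  continuous phi -> measurable_fun [set: borel V] (phi : borel V -> R).
Proof.
move=> cphi; apply: (measurability _ (RGenOpens.measurableE R)) => //.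
move=> _ [U [a [b ->]] <-]; rewrite setTI; apply: open_borel.
by move/continuousP : cphi; apply; exact: interval_open.
Qed.

Lemma measurable_continuous V (X : T -> V) (phi : V -> R) :
  continuous phi -> random_vector X -> measurable_fun setT (fun w => phi (X w)).
Proof. by move=> /continuous_borel mphi mX; exact: (measurableT_comp mphi mX). Qed.

Lemma continuous_dotl V (h : V) : continuous (fun x : V => dot x h).
Proof. by move=> x; exact: cvg_dotl. Qed.

Lemma measurable_dot V (X : T -> V) h :
  random_vector X -> measurable_fun setT (fun w => dot (X w) h).
Proof. by apply: (@measurable_continuous V X (fun x => dot x h)); exact: continuous_dotl. Qed.

(** In a separable space the closed balls are countable intersections of slabs
    and the open sets countable unions of closed balls. *)
Lemma random_vector_of_dot V (e : nat -> V) (X : T -> V) : dense_seq e ->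
  (forall h, measurable_fun setT (fun w => dot (X w) h)) -> random_vector X.
Proof.
move=> de mX; apply/random_vectorP => U oU.
have mball a r : 0 <= r -> measurable [set w | `|X w - a| <= r].
  move=> r0; have -> : [set w | `|X w - a| <= r] =
      \bigcap_n [set w | dot (X w) (e n) - dot a (e n) <= r * `|e n|].
    apply/seteqP; split=> w /= h.
      move=> n _ /=; rewrite -dotBl; apply: le_trans (dot_le_norm _ _) _.
      by rewrite ler_wpM2r.
    rewrite leNgt; apply/negP => lt_r.
    set u := X w - a in lt_r; have u0 : 0 < `|u| := le_lt_trans r0 lt_r.
    have ru : 0 < r + `|u| by rewrite ltr_wpDl.
    have eps0 : 0 < `|u| * (`|u| - r) / (r + `|u|).
      by rewrite divr_gt0// mulr_gt0// subr_gt0.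
    have [n nu] := de u _ eps0.
    have := h n I; rewrite /= -dotBl -/u; apply/negP; rewrite -ltNge.
    rewrite -{2}(subrK u (e n)) dotDr dot_normE.
    have := cauchy_schwarz u (e n - u); rewrite ler_norml => /andP[lo _].
    have : r * `|e n| <= r * (`|e n - u| + `|u|).
      by rewrite ler_wpM2l// -{1}(subrK u (e n)) ler_normD.
    move: nu; rewrite ltr_pdivlMr//; move: lo; rewrite mulrBr -expr2.
    move: `|e n - u| `|e n| (dot u (e n - u)) => q s v; lra.
  apply: bigcap_measurable => // n _; rewrite -[X in measurable X]setTI.
  by apply: measurable_fun_le => //; apply: measurable_funB => //; exact: measurable_cst.
pose D n k := if pselect ([set y | `|y - e n| <= k.+1%:R^-1] `<=` U) then
  [set w | `|X w - e n| <= k.+1%:R^-1] else set0.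
have -> : X @^-1` U = \bigcup_n \bigcup_k D n k.
  apply/seteqP; split=> w /=; last first.
    by move=> [n _ [k _]]; rewrite /D; case: pselect => // sub; exact: sub.
  move=> UXw; have /nbhs_ballP[eps /= eps0 epsU] : nbhs (X w) U by exact: open_nbhs_nbhs.
  have eps2 : 0 < eps / 2 by rewrite divr_gt0.
  have [k _ kP] := near_infty_natSinv_lt (PosNum eps2).
  have /= keps := kP k (leqnn k).
  have [|n nX] := de (X w) (k.+1%:R^-1); first by rewrite invr_gt0.
  exists n => //; exists k => //; rewrite /D; case: pselect => /= [_|[]].
    by rewrite -normrN opprB; exact: ltW.
  move=> y /= yn; apply: epsU; rewrite -ball_normE/= -normrN opprB -(subrKA (e n)).
  apply: le_lt_trans (ler_normD _ _) _.
  by move: yn nX keps; move: (k.+1%:R^-1) => ?; lra.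
apply: bigcupT_measurable => n; apply: bigcupT_measurable => k.
rewrite /D; case: (pselect _) => sub /=; last exact: measurable0.
by apply: mball; rewrite invr_ge0.
Qed.

End random_vectors.

(** * Natural filtrations and conditional expectations *)

Section natural_filtration.
Context {R : realType} d {T : measurableType d} {V : hilbertType R}.
Variable x : nat -> T -> V.

(** [sigma_upto x n] is the sigma-algebra generated by this family; the family is
    named because adaptedness refers to generators. *)
Definition past n : set (set T) := \bigcup_(k in `I_n.+1)
  preimage_set_system setT (x k) (@measurable _ (borel V)).

Lemma past_nd n : <<s past n >> `<=` <<s past n.+1 >>.
Proof.
apply: sub_smallest2r; first exact: smallest_sigma_algebra.
by move=> A [k /= kn kA]; exists k => //=; exact: ltn_trans kn _.
Qed.

Lemma past_measurable n : (forall k, (k <= n)%N -> random_vector (x k)) ->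
  <<s past n >> `<=` measurable.
Proof.
move=> mx; apply: smallest_sub; first exact: sigma_algebra_measurable.
move=> A [k /= kn [B mB <-]]; exact: (mx k kn).
Qed.

Lemma adapted_past n (phi : V -> R) : continuous phi ->
  adapted (past n) (fun w => phi (x n w)).
Proof.
move=> cphi; apply/adaptedP => B mB; apply: sub_sigma_algebra.
exists n => //=; exists (phi @^-1` B); last by rewrite setTI.
by have := continuous_borel cphi measurableT mB; rewrite setTI.
Qed.

End natural_filtration.

Section conditional_expectation.
Context {R : realType} d {T : measurableType d} (P : probability T R).
Variable C : set (set T).
Hypothesis C_measurable : <<s C >> `<=` measurable.

Lemma fine_cond_exp_adapted (Y Z : T -> \bar R) :
  is_cond_exp P <<s C >> Y Z -> adapted C (fun w => fine (Z w)).
Proof.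
move=> [_ mZ _]; apply/adaptedP => B mB.
have := mZ (fine @^-1` B); apply.
by have := fine_measurable measurableT measurableT mB; rewrite setTI.
Qed.

Lemma cond_exp_cond_le (Y : T -> R) (Z : T -> \bar R) :
  measurable_fun setT Y -> (forall w, 0 <= Y w) ->
  is_cond_exp P <<s C >> (fun w => (Y w)%:E) Z -> {ae P, forall w, (Z w < +oo)%E} ->
  cond_le P C Y (fun w => fine (Z w)).
Proof.
move=> mY Y0 cZ Zfin; have aZ := fine_cond_exp_adapted cZ.
have mfZ := adapted_measurable C_measurable aZ.
have [Z0 mZ YZ] := cZ.
have mZ' : measurable_fun setT Z.
  by move=> _ B mB; rewrite setTI; apply: C_measurable; exact: mZ.
apply: cond_le_of_sets => // [w|A CA]; first exact: fine_ge0.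
rewrite -YZ// le_eqVlt; apply/orP; left; apply/eqP.
have mA := C_measurable CA.
apply: ge0_ae_eq_integral => //.
- exact: measurable_funTS.
- by apply/measurable_EFinP; exact: measurable_funTS.
- by move=> w _; rewrite lee_fin fine_ge0.
- apply: filterS Zfin => w Zw _; rewrite fineK// ge0_fin_numE//.
Qed.

(** The conditional probability of an event independent of C is its
    probability. *)
Lemma independent_cond_le (F : set (set T)) (E : set T) (k : T -> R) :
  independent P F <<s C >> -> F E -> measurable E ->
  (forall w, 0 <= k w) -> adapted C k ->
  cond_le P C (fun w => k w * \1_E w) (fun w => k w * fine (P E)).
Proof.
move=> indep FE mE k0 ak; apply: (cond_leM k0 ak).
have PE : P E \is a fin_num by exact: fin_num_measure.
apply: cond_le_of_sets => // [w|A CA]; first by rewrite fine_ge0.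
have mA := C_measurable CA.
rewrite integral_indic// integral_cst// fineK//.
by rewrite le_eqVlt; apply/orP; left; apply/eqP; exact: indep.
Qed.

Lemma cond_le_sum (I : Type) (s : seq I) (Y Z : I -> T -> R) :
  (forall i, measurable_fun setT (Y i)) -> (forall i, measurable_fun setT (Z i)) ->
  (forall i w, 0 <= Y i w) -> (forall i w, 0 <= Z i w) ->
  (forall i, cond_le P C (Y i) (Z i)) ->
  cond_le P C (fun w => \sum_(i <- s) Y i w) (fun w => \sum_(i <- s) Z i w).
Proof.
move=> mY mZ Y0 Z0 YZ; elim: s => [|i s IH].
  by move=> h _ _; under eq_integral do rewrite big_nil;
     under [leRHS]eq_integral do rewrite big_nil.
have E (X : I -> T -> R) :
    (fun w => \sum_(j <- i :: s) X j w) = X i \+ (fun w => \sum_(j <- s) X j w).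
  by apply/funext => w; rewrite big_cons.
rewrite !E; apply: cond_leD => //; try exact: measurable_sum.
- by move=> w; apply: sumr_ge0.
- by move=> w; apply: sumr_ge0.
Qed.

End conditional_expectation.

(** * Block-weighted norms *)

(** The square roots make the squared norm of [block_scale w x] the sum of the
    squared norms of the blocks of x weighted by w. *)
Definition block_scale {R : realType} {I : finType} {H : I -> hilbertType R}
  (w : I -> R) (x : hsum H) : hsum H := fun i => Num.sqrt (w i) *: x i.

Section block_scale.
Context {R : realType} {I : finType} {H : I -> hilbertType R}.
Variable w : I -> R.
Hypothesis w_ge1 : forall i, 1 <= w i.
Implicit Types x y : hsum H.

Let w_ge0 i : 0 <= w i. Proof. exact: le_trans (w_ge1 i). Qed.

Lemma sqr_norm_block_scale x : `|block_scale w x| ^+ 2 = \sum_i w i * `|x i| ^+ 2.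
Proof.
rewrite hsum_sqr_norm; apply: eq_bigr => i _.
by rewrite /block_scale sqr_normZ sqr_sqrtr.
Qed.

Lemma block_scaleB x y : block_scale w (x - y) = block_scale w x - block_scale w y.
Proof. by apply: hsumP => i; exact: scalerBr. Qed.

Lemma block_scaleD x y : block_scale w (x + y) = block_scale w x + block_scale w y.
Proof. by apply: hsumP => i; exact: scalerDr. Qed.

Lemma block_scale_sym x y : dot (block_scale w x) y = dot x (block_scale w y).
Proof. by rewrite !hsum_dotE; apply: eq_bigr => i _; rewrite /block_scale dotZl dotZr. Qed.

Lemma le_block_scale x : `|x| <= `|block_scale w x|.
Proof.
rewrite -ler_sqr ?nnegrE// sqr_norm_block_scale hsum_sqr_norm; apply: ler_sum => i _.
by rewrite ler_peMl// exprn_ge0.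
Qed.

Lemma block_scale_sqr_le x : `|block_scale w x| ^+ 2 <= (\sum_i w i) * `|x| ^+ 2.
Proof.
rewrite sqr_norm_block_scale mulr_suml; apply: ler_sum => i _.
by rewrite ler_wpM2l// ler_sqr ?nnegrE// hsum_coord_le.
Qed.

Lemma block_scale_le x : `|block_scale w x| <= Num.sqrt (\sum_i w i) * `|x|.
Proof.
rewrite -ler_sqr ?nnegrE ?mulr_ge0 ?sqrtr_ge0// exprMn.
rewrite (@sqr_sqrtr _ (\sum_i w i)) ?sumr_ge0//; exact: block_scale_sqr_le.
Qed.

End block_scale.

(** * The random block-coordinate iteration *)

(** The selection is independent of the past and the i-th term depends on it
    through the i-th block alone, so the sum averages term by term with the
    marginal probabilities. *)
Lemma random_selection_cond_le {R : realType} d {T : measurableType d}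
    (P : probability T R) (C : set (set T)) (m : nat)
    (eps : T -> {ffun 'I_m -> bool}) (a b : 'I_m -> T -> R) :
  <<s C >> `<=` measurable -> sigma_discrete eps `<=` measurable ->
  independent P (sigma_discrete eps) <<s C >> ->
  (forall i, adapted C (a i)) -> (forall i, adapted C (b i)) ->
  (forall i w, 0 <= a i w) -> (forall i w, 0 <= b i w) ->
  cond_le P C (fun w => \sum_i (if eps w i then a i w else b i w))
    (fun w => \sum_i (fine (P [set w | eps w i = true]) * a i w
      + (1 - fine (P [set w | eps w i = true])) * b i w)).
Proof.
move=> Cm epsm indep aa ab a0 b0.
pose E i := [set w | eps w i = true].
have EE i : sigma_discrete eps (E i).
  by exists [set D : {ffun 'I_m -> bool} | D i = true] => //; rewrite setTI.
have nE i : sigma_discrete eps (~` E i).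
  by exists (~` [set D : {ffun 'I_m -> bool} | D i = true]) => //; rewrite setTI.
have mE i : measurable (E i) by exact: epsm.
have mnE i : measurable (~` E i) by exact: epsm.
have PE0 i : 0 <= fine (P (E i)) by exact: fine_ge0.
have PnE i : fine (P (~` E i)) = 1 - fine (P (E i)).
  by rewrite probability_setC// fineB// fin_num_measure.
have ma i : measurable_fun setT (a i) := adapted_measurable Cm (aa i).
have mb i : measurable_fun setT (b i) := adapted_measurable Cm (ab i).
rewrite (_ : (fun w => _) = (fun w => \sum_i (a i w * \1_(E i) w + b i w * \1_(~` E i) w))); last first.
  apply/funext => w; apply: eq_bigr => i _; rewrite !indicE.
  have [ei|ei] := boolP (eps w i).
    by rewrite mem_set// memNset ?mulr1 ?mulr0 ?addr0//=; exact.
  by rewrite memNset ?mem_set ?mulr1 ?mulr0 ?add0r//=; apply/negP.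
rewrite (_ : (fun w => \sum_i (fine _ * _ + _)) =
  (fun w => \sum_i (a i w * fine (P (E i)) + b i w * fine (P (~` E i))))); last first.
  by apply/funext => w; apply: eq_bigr => i _; rewrite PnE mulrC [X in _ + X]mulrC.
have mi (A : set T) : measurable A -> measurable_fun setT (\1_A : T -> R).
  by move=> mA; exact: measurable_indic.
apply: cond_le_sum => //.
- by move=> i; apply: measurable_funD; apply: measurable_funM => //; exact: mi.
- by move=> i; apply: measurable_funD; apply: measurable_funM => //; exact: measurable_cst.
- by move=> i w; rewrite addr_ge0 ?mulr_ge0// indicE.
- by move=> i w; rewrite addr_ge0 ?mulr_ge0// fine_ge0.
move=> i; apply: cond_leD.
all: try by move=> w; rewrite mulr_ge0// ?indicE// fine_ge0.
all: try by apply: measurable_funM => //; [exact: mi].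
all: try by apply: measurable_funM => //; exact: measurable_cst.
- exact: Cm.
- exact: (independent_cond_le Cm indep (EE i)).
- exact: (independent_cond_le Cm indep (nE i)).
Qed.

Section random_forward_backward.
Context {R : realType} {d : measure_display} {Omega : measurableType d}
  (P : probability Omega R) {m p : nat} {H : 'I_m -> hilbertType R}
  {G : 'I_p -> hilbertType R}.
Variables (f : forall i, H i -> \bar R) (g : forall k, G k -> R)
  (L : forall k i, {linear H i -> G k}) (tau : 'I_p -> R) (theta : R).
Arguments f : clear implicits.
Arguments g : clear implicits.
Hypotheses (H_separable : forall i, separable (H i))
  (f_Gamma0 : forall i, Gamma0 (f i))
  (tau_gt0 : forall k, 0 < tau k)
  (g_convex : forall k, convex_function [set: convex_lmodType (G k)] (g k))
  (g_differentiable : forall k x, differentiable (g k) x)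
  (g_lipschitz : forall k, (tau k).-lipschitz (grad (g k)))
  (L_bounded : forall k i, exists M : R, forall x, `|L k i x| <= M * `|x|)
  (theta_bounds : 0 < theta <=
      (\sum_k tau k * opnorm (fun y : G k => \sum_i L k i (adjoint (L k i) y)))^-1).
Variables (gamma lambda : nat -> R) (x r a c : nat -> Omega -> hsum H)
  (eps : nat -> Omega -> {ffun 'I_m -> bool}).
Hypotheses (gamma_bounds : forall n, 0 < gamma n < 2 * theta)
  (lambda_bounds : forall n, 0 < lambda n <= 1)
  (x0_random : random_vector (x 0%N))
  (a_random : forall n, random_vector (a n))
  (c_random : forall n, random_vector (c n))
  (eps_random : forall n, sigma_discrete (eps n) `<=` measurable)
  (r_def : forall n w i, r n w i = (eps n w i)%:R *:
      (x n w i - gamma n *: (coupled_grad g L (x n w) i + c n w i)))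
  (x_def : forall n w i, x n.+1 w i = x n w i + ((eps n w i)%:R * lambda n) *:
      (prox (fun y => ((gamma n)%:E * f i y)%E) (r n w i) + a n w i - x n w i)).

Let B := coupled_grad g L.
Let step n := fb_step f g L (gamma n).
Let theta_gt0 : 0 < theta. Proof. by case/andP: theta_bounds. Qed.
Let gamma_gt0 n : 0 < gamma n. Proof. by case/andP: (gamma_bounds n). Qed.

Let B_lipschitz u v : `|B u - B v| <= theta^-1 * `|u - v|.
Proof. exact: (coupled_grad_lipschitz tau_gt0). Qed.

Let B_continuous : continuous B. Proof. exact: (lipschitz_continuous B_lipschitz). Qed.

Let prox_le n i (u v : H i) :
  `|prox (fun y => ((gamma n)%:E * f i y)%E) u - prox (fun y => ((gamma n)%:E * f i y)%E) v|
    <= `|u - v|.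
Proof. by apply: prox_nonexpansive; exact: Gamma0_scale. Qed.

Lemma fb_step_lipschitz n u v :
  `|fb_step f g L (gamma n) u - fb_step f g L (gamma n) v|
    <= (1 + gamma n * theta^-1) * `|u - v|.
Proof.
have le_shift (bu bv : hsum H) : `|bu - bv| <= theta^-1 * `|u - v| ->
    `|(u - gamma n *: bu) - (v - gamma n *: bv)| <= (1 + gamma n * theta^-1) * `|u - v|.
  move=> h; have -> : (u - gamma n *: bu) - (v - gamma n *: bv) =
    (u - v) - gamma n *: (bu - bv) by hilbert_ring.
  apply: le_trans (ler_normB _ _) _; rewrite mulrDl mul1r lerD2l normrZ.
  by rewrite gtr0_norm// -mulrA; apply: ler_wpM2l h; exact: ltW.
apply: le_trans (le_shift _ _ (B_lipschitz u v)).
rewrite -ler_sqr ?nnegrE// !hsum_sqr_norm; apply: ler_sum => i _.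
rewrite ler_sqr ?nnegrE//; exact: prox_le.
Qed.

Let step_continuous n : continuous (step n).
Proof. exact: (lipschitz_continuous (@fb_step_lipschitz n)). Qed.

Let prox_continuous n i : continuous (prox (fun y => ((gamma n)%:E * f i y)%E)).
Proof. by apply: (@lipschitz_continuous _ _ _ _ 1) => u v; rewrite mul1r; exact: prox_le. Qed.

Let coord_continuous i : continuous (fun u : hsum H => u i).
Proof.
apply: (@lipschitz_continuous _ _ _ _ 1) => u v; rewrite mul1r.
exact: (hsum_coord_le (u - v)).
Qed.

Let H_dense : exists E : nat -> hsum H, dense_seq E.
Proof.
exact: (hsum_dense_seq (fun i => projT2 (cid (separable_dense_seq (@H_separable i))))).
Qed.

Let eps_measurable n i : measurable_fun setT (fun w => (eps n w i)%:R : R).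
Proof.
have -> : (fun w => (eps n w i)%:R : R) = \1_[set w | eps n w i = true].
  apply/funext => w; rewrite indicE; have [ei|ei] := boolP (eps n w i).
    by rewrite mem_set.
  by rewrite memNset//; apply/negP.
apply: measurable_indic; apply: eps_random.
by exists [set D : {ffun 'I_m -> bool} | D i = true] => //; rewrite setTI.
Qed.

Lemma iterates_random n : random_vector (x n).
Proof.
elim: n => [//|n IH].
have [E dE] := H_dense.
have coord (X : Omega -> hsum H) i : random_vector X -> random_vector (fun w => X w i).
  exact: (random_vector_continuous (@coord_continuous i)).
have r_random i : random_vector (fun w => r n w i).
  have [e de] := separable_dense_seq (@H_separable i).
  apply: (random_vector_of_dot de) => h.
  rewrite (_ : (fun w => _) = (fun w => (eps n w i)%:R * (dot (x n w i) h
      - gamma n * (dot (B (x n w) i) h + dot (c n w i) h)))); last first.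
    by apply/funext => w; rewrite r_def dotZl dotBl dotZl dotDl.
  have BX : random_vector (fun w => B (x n w)) by exact: (random_vector_continuous B_continuous).
  apply: measurable_funM; first exact: eps_measurable.
  apply: measurable_funB; first exact: measurable_dot (coord _ i IH).
  apply: measurable_funM; first exact: measurable_cst.
  apply: measurable_funD; first exact: measurable_dot (coord _ i BX).
  exact: measurable_dot (coord _ i (@c_random n)).
apply: (random_vector_of_dot dE) => h.
rewrite (_ : (fun w => _) = (fun w => \sum_i (dot (x n w i) (h i) +
    ((eps n w i)%:R * lambda n) * (dot (prox (fun y => ((gamma n)%:E * f i y)%E) (r n w i)) (h i)
      + dot (a n w i) (h i) - dot (x n w i) (h i))))); last first.
  apply/funext => w; rewrite hsum_dotE; apply: eq_bigr => i _.
  by rewrite x_def dotDl dotZl dotBl dotDl.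
apply: measurable_sum => i; apply: measurable_funD; first exact: measurable_dot (coord _ i IH).
apply: measurable_funM.
  by apply: measurable_funM; [exact: eps_measurable|exact: measurable_cst].
apply: measurable_funB; last exact: measurable_dot (coord _ i IH).
apply: measurable_funD; last exact: measurable_dot (coord _ i (@a_random n)).
apply: measurable_dot.
by apply: (random_vector_continuous (g := prox _)); [exact: prox_continuous|exact: r_random].
Qed.

(** The next iterate if the errors vanished. *)
Let selected n w : hsum H :=
  fun i => x n w i + ((eps n w i)%:R * lambda n) *: (step n (x n w) i - x n w i).

(** The proximity operator is nonexpansive and gamma n < 2 * theta, so on the
    selected blocks the error is at most |a| + 2 * theta * |c|. *)
Let error_le n w : `|x n.+1 w - selected n w| ^+ 2 <=
  2 * `|a n w| ^+ 2 + 8 * theta ^+ 2 * `|c n w| ^+ 2.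
Proof.
have [l0 l1] := andP (lambda_bounds n); have [g0 g1] := andP (gamma_bounds n).
rewrite !hsum_sqr_norm !mulr_sumr -big_split/=; apply: ler_sum => i _.
have -> : (x n.+1 w - selected n w) i = ((eps n w i)%:R * lambda n) *:
    (prox (fun y => ((gamma n)%:E * f i y)%E) (r n w i) - step n (x n w) i + a n w i).
  have -> : (x n.+1 w - selected n w) i = x n.+1 w i - selected n w i by [].
  by rewrite x_def /selected; move: (step n _ i) (prox _ _) => u v; hilbert_ring.
have rhs0 : 0 <= 2 * `|a n w i| ^+ 2 + 8 * theta ^+ 2 * `|c n w i| ^+ 2.
  by rewrite addr_ge0 ?mulr_ge0 ?exprn_ge0// ltW.
have [ei|ei] := boolP (eps n w i); last by rewrite mul0r scale0r normr0 expr0n.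
have proxc : `|prox (fun y => ((gamma n)%:E * f i y)%E) (r n w i) - step n (x n w) i|
    <= 2 * theta * `|c n w i|.
  apply: le_trans (prox_le _ _ _) _; rewrite r_def ei scale1r.
  have -> : (x n w i - gamma n *: (coupled_grad g L (x n w) i + c n w i)) -
     (x n w i - gamma n *: coupled_grad g L (x n w) i) = (- gamma n) *: c n w i.
    by move: (coupled_grad g L (x n w) i) => u; hilbert_ring.
  by rewrite normrZ normrN gtr0_norm// ler_wpM2r// ltW.
move: proxc; move: (prox _ _ - _) => v vc.
rewrite mul1r normrZ gtr0_norm//.
have le1 : lambda n * `|v + a n w i| <= 2 * theta * `|c n w i| + `|a n w i|.
  apply: le_trans (_ : `|v + a n w i| <= _); first by rewrite ler_piMl.
  by apply: le_trans (ler_normD _ _) _; rewrite lerD2r.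
apply: le_trans (_ : (2 * theta * `|c n w i| + `|a n w i|) ^+ 2 <= _).
  by rewrite ler_sqr ?nnegrE// ?addr_ge0// ?mulr_ge0// ltW.
have := sqr_ge0 (2 * theta * `|c n w i| - `|a n w i|); rewrite -subr_ge0 => h.
by rewrite -subr_ge0; apply: le_trans h _; rewrite le_eqVlt; apply/orP; left; apply/eqP; ring.
Qed.

Let selected_random n : random_vector (selected n).
Proof.
have [E dE] := H_dense; have mx := @iterates_random n.
have mT : random_vector (fun w => step n (x n w)) by exact: random_vector_continuous.
apply: (random_vector_of_dot dE) => h.
rewrite (_ : (fun w => _) = (fun w => \sum_i (dot (x n w i) (h i) +
    ((eps n w i)%:R * lambda n) * (dot (step n (x n w) i) (h i) - dot (x n w i) (h i))))); last first.
  apply/funext => w; rewrite hsum_dotE; apply: eq_bigr => i _.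
  by rewrite /selected dotDl dotZl dotBl.
have coord (X : Omega -> hsum H) i : random_vector X ->
    measurable_fun setT (fun w => dot (X w i) (h i)).
  by move=> mX; apply: measurable_dot; exact: (random_vector_continuous (@coord_continuous i)).
apply: measurable_sum => i; apply: measurable_funD; first exact: coord mx.
apply: measurable_funM.
  by apply: measurable_funM; [exact: eps_measurable|exact: measurable_cst].
by apply: measurable_funB; [exact: coord mT|exact: coord mx].
Qed.

Variables (q : 'I_m -> R).
Hypotheses (q_bounds : forall i, 0 < q i <= 1)
  (q_def : forall n i, fine (P [set w | eps n w i = true]) = q i)
  (eps_x_independent : forall n,
      independent P (sigma_discrete (eps n)) (sigma_upto x n)).

Let S := block_scale (H := H) (fun i => (q i)^-1).
Let q_ge1 i : 1 <= (q i)^-1.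
Proof. by case/andP: (q_bounds i) => q0 q1; rewrite invf_ge1. Qed.
Let past_m n : <<s past x n >> `<=` measurable.
Proof. by apply: past_measurable => k _; exact: iterates_random. Qed.

Let S_continuous : continuous S.
Proof.
apply: (@lipschitz_continuous _ _ _ _ (Num.sqrt (\sum_i (q i)^-1))) => u v.
by rewrite -block_scaleB; exact: block_scale_le.
Qed.

Section one_solution.
Variable z : hsum H.
Hypothesis z_argmin : argmin (objective f g L) z.

(** Lower bound for the decrease of the squared distance to the solution z in a
    relaxed full step from u. *)
Definition fb_gain n (u : hsum H) : R :=
  lambda n * (gamma n * (2 * theta - gamma n) * `|coupled_grad g L u - coupled_grad g L z| ^+ 2 +
    `|u - fb_step f g L (gamma n) u - gamma n *: (coupled_grad g L u - coupled_grad g L z)| ^+ 2).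

Let gain_ge0 n u : 0 <= fb_gain n u.
Proof.
have [l0 l1] := andP (lambda_bounds n); have [g0 g1] := andP (gamma_bounds n).
apply: mulr_ge0; first exact: ltW.
apply: addr_ge0; last exact: exprn_ge0.
by rewrite mulr_ge0 ?exprn_ge0// mulr_ge0 ?subr_ge0// ltW.
Qed.

Let norm_continuous (V W : hilbertType R) (F : V -> W) : continuous F ->
  continuous (fun u => `|F u|).
Proof. by move=> cF u; apply: cvg_norm; exact: cF. Qed.

Let adapted_norm n (W : hilbertType R) (F : hsum H -> W) : continuous F ->
  adapted (past x n) (fun w => `|F (x n w)|).
Proof.
move=> cF; apply: (@adapted_past _ _ _ (hsum H) x n (fun u : hsum H => `|F u|)).
exact: norm_continuous.
Qed.

Let gain_measurable n : measurable_fun setT (fun w => fb_gain n (x n w)).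
Proof.
have cBz : continuous (fun u : hsum H => coupled_grad g L u - coupled_grad g L z).
  by apply: continuous_subc; exact: B_continuous.
have cTz : continuous (fun u : hsum H => u - fb_step f g L (gamma n) u
    - gamma n *: (coupled_grad g L u - coupled_grad g L z)).
  apply: continuous_subr; last by apply: continuous_scaler; exact: cBz.
  by apply: continuous_subr => [u|]; [exact: cvg_id|exact: step_continuous].
apply: measurable_funM; first exact: measurable_cst.
apply: measurable_funD; last first.
  exact: (adapted_measurable (@past_m n) (adapted_sqr (@adapted_norm n _ _ cTz))).
apply: measurable_funM; first exact: measurable_cst.
exact: (adapted_measurable (@past_m n) (adapted_sqr (@adapted_norm n _ _ cBz))).
Qed.

(** The weights are the inverses of the selection probabilities, so the bound for
    the decrease of the full step in the original norm becomes a bound for the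
    conditional decrease of the selected step in the weighted norm. *)
Let selected_decrease n :
  cond_le P (past x n) (fun w => `|S (selected n w - z)| ^+ 2 + fb_gain n (x n w))
    (fun w => `|S (x n w - z)| ^+ 2).
Proof.
have [l0 l1] := andP (lambda_bounds n).
pose A i w := (q i)^-1 * `|x n w i + lambda n *: (step n (x n w) i - x n w i) - z i| ^+ 2.
pose A' i w := (q i)^-1 * `|x n w i - z i| ^+ 2.
have q0 i : 0 <= (q i)^-1 by exact: le_trans (@q_ge1 i).
have A0 i w : 0 <= A i w by rewrite mulr_ge0// exprn_ge0.
have A'0 i w : 0 <= A' i w by rewrite mulr_ge0// exprn_ge0.
have cT i : continuous (fun u : hsum H => u i + lambda n *: (step n u i - u i) - z i).
  have cTi : continuous (fun u : hsum H => step n u i).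
    by move=> u; exact: (continuous_comp (@step_continuous n u) (@coord_continuous i (step n u))).
  apply: continuous_subc.
  apply: continuous_addr; first exact: coord_continuous.
  by apply: continuous_scaler; apply: continuous_subr; [exact: cTi|exact: coord_continuous].
have aA i : adapted (past x n) (A i).
  apply: measurable_funM; first exact: measurable_cst.
  by exact: (adapted_sqr (@adapted_norm n _ _ (@cT i))).
have aA' i : adapted (past x n) (A' i).
  apply: measurable_funM; first exact: measurable_cst.
  apply: (adapted_sqr (@adapted_norm n _ (fun u : hsum H => u i - z i) _)).
  by apply: continuous_subc; exact: coord_continuous.
have cSx : continuous (fun u : hsum H => S (u - z)).
  have cz : continuous (fun u : hsum H => u - z).
    by apply: continuous_subc => u; exact: cvg_id.
  by move=> u; exact: (continuous_comp (@cz u) (@S_continuous (u - z))).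
have := random_selection_cond_le (@past_m n) (@eps_random n) (@eps_x_independent n) aA aA' A0 A'0.
have -> : (fun w => \sum_i (if eps n w i then A i w else A' i w)) =
    (fun w => `|S (selected n w - z)| ^+ 2).
  apply/funext => w; rewrite /S sqr_norm_block_scale//; apply: eq_bigr => i _.
  have -> : (selected n w - z) i = selected n w i - z i by [].
  by rewrite /selected /A /A'; case: (eps n w i); rewrite ?mul1r// mul0r scale0r addr0.
(* The conditional mean of the weighted squared distance after the selection:
   block i contributes q i * (q i)^-1 = 1 times its moved value and
   (1 - q i) * (q i)^-1 = (q i)^-1 - 1 times its previous one. *)
pose Q w := `|x n w + lambda n *: (step n (x n w) - x n w) - z| ^+ 2
   + `|S (x n w - z)| ^+ 2 - `|x n w - z| ^+ 2.
have QE w : \sum_i (q i * A i w + (1 - q i) * A' i w) = Q w.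
  rewrite /Q /S sqr_norm_block_scale// !hsum_sqr_norm -big_split/= -sumrB.
  apply: eq_bigr => i _; rewrite /A /A'.
  have /andP[qi _] := q_bounds i.
  have -> : (x n w + lambda n *: (step n (x n w) - x n w) - z) i =
    x n w i + lambda n *: (step n (x n w) i - x n w i) - z i by [].
  have -> : (x n w - z) i = x n w i - z i by [].
  by move: (`|_| ^+ 2) (`|x n w i - z i| ^+ 2) => s t; field; rewrite gt_eqF.
have -> : (fun w => \sum_i (fine (P [set w | eps n w i = true]) * A i w
      + (1 - fine (P [set w | eps n w i = true])) * A' i w)) = Q.
  by apply/funext => w; rewrite -QE; apply: eq_bigr => i _; rewrite q_def.
have Q0 w : 0 <= Q w.
  rewrite -QE; apply: sumr_ge0 => i _; have /andP[qi0 qi1] := q_bounds i.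
  by rewrite addr_ge0 ?mulr_ge0// ?subr_ge0// ltW.
move=> YQ.
have mS : measurable_fun setT (fun w => `|S (x n w - z)| ^+ 2).
  exact: (adapted_measurable (@past_m n) (adapted_sqr (@adapted_norm n _ _ cSx))).
have mY : measurable_fun setT (fun w => `|S (selected n w - z)| ^+ 2).
  exact: (measurable_sqr (measurable_continuous (norm_continuous cSx) (@selected_random n))).
have mQ : measurable_fun setT Q.
  rewrite (_ : Q = fun w => \sum_i (q i * A i w + (1 - q i) * A' i w)); last first.
    by apply/funext => w; rewrite QE.
  apply: measurable_sum => i; apply: measurable_funD; apply: measurable_funM;
    try exact: measurable_cst.
    exact: adapted_measurable (@past_m n) (aA i).
  exact: adapted_measurable (@past_m n) (aA' i).
have mG := @gain_measurable n.
have QD w : Q w + fb_gain n (x n w) <= `|S (x n w - z)| ^+ 2.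
  rewrite /Q /fb_gain.
  have := fb_relaxed_estimate f_Gamma0 tau_gt0 g_convex g_differentiable g_lipschitz
    L_bounded theta_bounds (x n w) (gamma_gt0 n) (introT andP (conj (ltW l0) l1)) z_argmin.
  move: (`|_| ^+ 2) (`|_ - z| ^+ 2) (lambda n * _) (`|S _| ^+ 2) => *; lra.
have Y0 w : 0 <= `|S (selected n w - z)| ^+ 2 by exact: exprn_ge0.
exact: (cond_le_absorb (@past_m n) mY mQ mG mS Y0 Q0 (fun w => gain_ge0 n (x n w)) YQ QD).
Qed.

Variables (Ea Ec : nat -> Omega -> \bar R).
Hypotheses (Ea_def : forall n, is_cond_exp P (sigma_upto x n)
      (fun w => (`|a n w| ^+ 2)%:E) (Ea n))
  (Ec_def : forall n, is_cond_exp P (sigma_upto x n)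
      (fun w => (`|c n w| ^+ 2)%:E) (Ec n))
  (Ea_summable : {ae P, forall w, (\sum_(0 <= n <oo) sqrte (Ea n w) < +oo)%E})
  (Ec_summable : {ae P, forall w, (\sum_(0 <= n <oo) sqrte (Ec n w) < +oo)%E}).

(** The random variables e and xi bound the error of the iterate in the weighted
    norm and its conditional second moment; xi is summable because the square
    root of a sum is at most the sum of the square roots. *)
Lemma fb_quasi_fejer : {ae P, forall w,
  cvgn (fun n => `|block_scale (fun i => (q i)^-1) (x n w - z)|) /\
  summable_seq (fun n => fb_gain n (x n w))}.
Proof.
pose K := \sum_i (q i)^-1.
have K0 : 0 <= K by apply: sumr_ge0 => i _; exact: le_trans (@q_ge1 i).
pose ea n w := fine (Ea n w); pose ec n w := fine (Ec n w).
have ea0 n w : 0 <= ea n w by case: (Ea_def n) => h _ _; exact: fine_ge0.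
have ec0 n w : 0 <= ec n w by case: (Ec_def n) => h _ _; exact: fine_ge0.
pose err (s t : R) := K * 2 * s + K * (8 * theta ^+ 2) * t.
have k1 : 0 <= K * 2 by rewrite mulr_ge0.
have k2 : 0 <= K * (8 * theta ^+ 2) by rewrite !mulr_ge0// ltW.
have err0 s t : 0 <= s -> 0 <= t -> 0 <= err s t.
  by move=> s0 t0; rewrite addr_ge0// mulr_ge0.
pose e n w := Num.sqrt (err (`|a n w| ^+ 2) (`|c n w| ^+ 2)).
pose xi n w := Num.sqrt (err (ea n w) (ec n w)).
have msqrt d' (T : measurableType d') (F : T -> R) :
    measurable_fun setT F -> measurable_fun setT (fun w => Num.sqrt (F w)).
  by move=> mF; exact: (measurableT_comp (continuous_measurable_fun (@sqrt_continuous R)) mF).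
have merr d' (T : measurableType d') (F F' : T -> R) : measurable_fun setT F ->
    measurable_fun setT F' -> measurable_fun setT (fun w => err (F w) (F' w)).
  by move=> mF mF'; apply: measurable_funD; apply: measurable_funM => //; exact: measurable_cst.
have cS : continuous (fun u : hsum H => S (u - z)).
  have cz : continuous (fun u : hsum H => u - z).
    by apply: continuous_subc => u; exact: cvg_id.
  by move=> u; exact: (continuous_comp (@cz u) (@S_continuous (u - z))).
have mnorm (X : Omega -> hsum H) : random_vector X -> measurable_fun setT (fun w => `|X w| ^+ 2).
  move=> mX; apply: measurable_sqr.
  apply: (measurable_continuous (phi := fun u => `|u|)) => //.
  exact: (@norm_continuous _ _ (fun u : hsum H => u) (fun u => cvg_id)).
have aea n : adapted (past x n) (ea n) := fine_cond_exp_adapted (@Ea_def n).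
have aec n : adapted (past x n) (ec n) := fine_cond_exp_adapted (@Ec_def n).
have Eafin n : {ae P, forall w, (Ea n w < +oo)%E}.
  apply: filterS Ea_summable => w h.
  by apply: (summable_sqrte _ h).1 => k; case: (Ea_def k) => h0 _ _; exact: h0.
have Ecfin n : {ae P, forall w, (Ec n w < +oo)%E}.
  apply: filterS Ec_summable => w h.
  by apply: (summable_sqrte _ h).1 => k; case: (Ec_def k) => h0 _ _; exact: h0.
apply: (@stochastic_quasi_fejer _ _ _ P (past x) _ _ (fun n w => `|S (x n w - z)|)
  (fun n w => `|S (selected n w - z)|) e xi (fun n w => fb_gain n (x n w))).
- exact: past_m.
- exact: past_nd.
- by move=> n; exact: (@adapted_norm n _ _ cS).
- by [].
- by move=> n; exact: (msqrt _ _ _ (merr _ _ _ _ (@aea n) (@aec n))).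
- by move=> n w; exact: sqrtr_ge0.
- by move=> n; exact: (measurable_continuous (norm_continuous cS) (@selected_random n)).
- by [].
- by move=> n; apply: msqrt; apply: merr; exact: mnorm.
- by move=> n w; exact: sqrtr_ge0.
- by move=> n; exact: gain_measurable.
- by move=> n w; exact: gain_ge0.
- move=> n w; have -> : x n.+1 w - z = (selected n w - z) + (x n.+1 w - selected n w).
    by move: (x n.+1 w) (selected n w) => u v; hilbert_ring.
  rewrite /S block_scaleD; apply: le_trans (ler_normD _ _) _; rewrite lerD2l.
  rewrite -[leLHS]ger0_norm// -sqrtr_sqr ler_wsqrtr//.
  apply: le_trans (block_scale_sqr_le q_ge1 _) _; rewrite /err -/K.
  have := ler_wpM2l K0 (@error_le n w); move/le_trans; apply.
  by rewrite le_eqVlt; apply/orP; left; apply/eqP; ring.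
- exact: selected_decrease.
- move=> n; rewrite (_ : (fun w => e n w ^+ 2) = (fun w => err (`|a n w| ^+ 2) (`|c n w| ^+ 2))); last first.
    by apply/funext => w; rewrite sqr_sqrtr// err0.
  rewrite (_ : (fun w => xi n w ^+ 2) = (fun w => err (ea n w) (ec n w))); last first.
    by apply/funext => w; rewrite sqr_sqrtr// err0.
  have mea := adapted_measurable (@past_m n) (@aea n).
  have mec := adapted_measurable (@past_m n) (@aec n).
  have ck (k : R) : adapted (past x n) (fun=> k) by exact: measurable_cst.
  apply: (cond_leD (@past_m n)).
  + by apply: measurable_funM; [exact: measurable_cst|exact: mnorm].
  + by apply: measurable_funM; [exact: measurable_cst|exact: mea].
  + by apply: measurable_funM; [exact: measurable_cst|exact: mnorm].
  + by apply: measurable_funM; [exact: measurable_cst|exact: mec].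
  + by move=> w; rewrite mulr_ge0 ?exprn_ge0.
  + by move=> w; rewrite mulr_ge0.
  + by move=> w; rewrite mulr_ge0 ?exprn_ge0.
  + by move=> w; rewrite mulr_ge0.
  + apply: cond_leM => //; apply: (cond_exp_cond_le (@past_m n)) => //; first exact: mnorm.
    exact: Ea_def.
  + apply: cond_leM => //; apply: (cond_exp_cond_le (@past_m n)) => //; first exact: mnorm.
    exact: Ec_def.
- apply: filterS2 Ea_summable Ec_summable => w sa sc.
  have Ea0 n : (0 <= Ea n w)%E by case: (Ea_def n) => h _ _; exact: h.
  have Ec0 n : (0 <= Ec n w)%E by case: (Ec_def n) => h _ _; exact: h.
  have [_ [Ma MaP]] := summable_sqrte Ea0 sa; have [_ [Mc McP]] := summable_sqrte Ec0 sc.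
  exists (Num.sqrt K * (2 * Ma + 4 * theta * Mc)) => n.
  have xi_le k : xi k w <= Num.sqrt K * (2 * Num.sqrt (ea k w) + 4 * theta * Num.sqrt (ec k w)).
    have rhs0 : 0 <= 2 * Num.sqrt (ea k w) + 4 * theta * Num.sqrt (ec k w).
      by rewrite addr_ge0 ?mulr_ge0 ?sqrtr_ge0// ltW.
    rewrite -ler_sqr ?nnegrE ?mulr_ge0 ?sqrtr_ge0// exprMn !sqr_sqrtr ?err0//.
    rewrite /err -!(mulrA K) -mulrDr; apply: (ler_wpM2l K0).
    have := sqr_sqrtr (ea0 k w); have := sqr_sqrtr (ec0 k w).
    have := sqrtr_ge0 (ea k w); have := sqrtr_ge0 (ec k w); have := ltW theta_gt0.
    move: (Num.sqrt _) (Num.sqrt _) => s t t0 s0 t'0 <- <-.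
    have : 0 <= theta * s * t by rewrite !mulr_ge0.
    by have := sqr_ge0 (theta * t); have := sqr_ge0 s; lra.
  apply: (@le_trans _ _ (\sum_(k < n) Num.sqrt K *
      (2 * Num.sqrt (ea k w) + 4 * theta * Num.sqrt (ec k w)))).
    by apply: ler_sum => k _; exact: xi_le.
  rewrite -mulr_sumr big_split/= -!mulr_sumr; apply: ler_wpM2l; first exact: sqrtr_ge0.
  apply: lerD; apply: ler_wpM2l; [by []|exact: MaP| |exact: McP].
  by rewrite mulr_ge0// ltW.
Qed.

End one_solution.

End random_forward_backward.

Section forward_backward_path.
Context {R : realType} {m p : nat} {H : 'I_m -> hilbertType R}
  {G : 'I_p -> hilbertType R}.
Variables (f : forall i, H i -> \bar R) (g : forall k, G k -> R)
  (L : forall k i, {linear H i -> G k}) (tau : 'I_p -> R) (theta : R).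
Arguments f : clear implicits.
Arguments g : clear implicits.
Hypotheses (f_Gamma0 : forall i, Gamma0 (f i))
  (tau_gt0 : forall k, 0 < tau k)
  (g_convex : forall k, convex_function [set: convex_lmodType (G k)] (g k))
  (g_differentiable : forall k x, differentiable (g k) x)
  (g_lipschitz : forall k, (tau k).-lipschitz (grad (g k)))
  (L_bounded : forall k i, exists M : R, forall x, `|L k i x| <= M * `|x|)
  (theta_bounds : 0 < theta <=
      (\sum_k tau k * opnorm (fun y : G k => \sum_i L k i (adjoint (L k i) y)))^-1).
Variables (gamma lambda : nat -> R) (gamma0 gamma1 lambda0 : R).
Hypotheses (gamma0_gt0 : 0 < gamma0) (gamma1_lt : gamma1 < 2 * theta)
  (lambda0_gt0 : 0 < lambda0)
  (gamma_ge : forall n, gamma0 <= gamma n) (gamma_le : forall n, gamma n <= gamma1)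
  (lambda_ge : forall n, lambda0 <= lambda n).
Variables (omega : 'I_m -> R) (x : nat -> hsum H) (C : nat -> hsum H).
Hypotheses (omega_ge1 : forall i, 1 <= omega i)
  (C_argmin : forall j, argmin (objective f g L) (C j))
  (C_dense : forall z, argmin (objective f g L) z ->
     forall e, 0 < e -> exists j, `|C j - z| < e)
  (C_cvg : forall j, cvgn (fun n => `|block_scale omega (x n - C j)|))
  (C_gain : summable_seq (fun n => fb_gain f g L theta gamma lambda (C 0) n (x n))).

(** The factors of the gains are bounded away from 0, so summability of the gains
    makes both residuals vanish; the cluster points are then solutions, and
    Opial's argument applies. *)
Lemma forward_backward_path : exists l, [/\ argmin (objective f g L) l, weak_cvg x l &
  (forall i, demiregular (subdiff (f i)) (l i)) \/
  demiregular (fun y => [set coupled_grad g L y]) l -> x @ \oo --> l].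
Proof.
pose B := coupled_grad g L; pose z := C 0.
pose T n := fb_step f g L (gamma n).
have zF : argmin (objective f g L) z := C_argmin 0.
have theta0 : 0 < theta by case/andP: theta_bounds.
have gn0 n : 0 < gamma n := lt_le_trans gamma0_gt0 (gamma_ge n).
have ln0 n : 0 < lambda n := lt_le_trans lambda0_gt0 (lambda_ge n).
have dn n : 0 < 2 * theta - gamma n by rewrite subr_gt0; exact: le_lt_trans (gamma_le n) gamma1_lt.
pose gain n := fb_gain f g L theta gamma lambda z n (x n).
pose P1 n := `|B (x n) - B z| ^+ 2.
pose P2 n := `|x n - T n (x n) - gamma n *: (B (x n) - B z)| ^+ 2.
have gainE n : gain n = lambda n * (gamma n * (2 * theta - gamma n) * P1 n + P2 n) by [].
have P1_0 n : 0 <= P1 n by exact: exprn_ge0.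
have P2_0 n : 0 <= P2 n by exact: exprn_ge0.
have gain1 n : lambda0 * (gamma0 * (2 * theta - gamma1)) * P1 n <= gain n.
  rewrite gainE -mulrA; apply: ler_pM => //; first exact: ltW.
    by rewrite !mulr_ge0// ?subr_ge0 ltW.
  apply: (@le_trans _ _ (gamma n * (2 * theta - gamma n) * P1 n)); last by rewrite lerDl.
  apply: ler_wpM2r => //; apply: ler_pM => //; [exact: ltW|by rewrite subr_ge0 ltW|].
  by rewrite lerD2l lerN2.
have gain2 n : lambda0 * P2 n <= gain n.
  rewrite gainE; apply: ler_pM => //; first exact: ltW.
  by rewrite lerDr !mulr_ge0// ltW.
have gain0 : gain @ \oo --> (0 : R).
  apply: summable_seq_cvg0 C_gain => n; apply: le_trans (gain2 n).
  by rewrite mulr_ge0// ltW.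
have Bd : (fun n => `|B (x n) - B z|) @ \oo --> (0 : R).
  apply: (cvg0_of_sqr _ _ gain1) => //.
  by rewrite !mulr_gt0// subr_gt0.
have Td : (fun n => `|x n - T n (x n) - gamma n *: (B (x n) - B z)|) @ \oo --> (0 : R).
  exact: (cvg0_of_sqr lambda0_gt0 _ gain2).
have Bx : B (x n) @[n --> \oo] --> B z by exact: (cvg_of_dist0 (u := fun n => B (x n))).
have Tx : x n - T n (x n) @[n --> \oo] --> (0 : hsum H).
  apply: (cvg0_shift (k := 2 * theta) _ _ Bd Td) => [|n]; first by rewrite mulr_gt0.
  by rewrite ltW//= -subr_ge0 ltW.
have [M xM] := bounded_of_cvg_dist (le_block_scale omega_ge1) (@C_cvg 0%N).
have [l lF xl] : exists2 l, argmin (objective f g L) l & weak_cvg x l.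
  apply: (@opial _ _ (block_scale omega)).
  - exact: block_scaleB.
  - exact: block_scale_sym.
  - exact: le_block_scale.
  - by exists z.
  - move=> y yF; apply: (@cvg_dist_dense _ _ _ (Num.sqrt (\sum_i omega i)) _ (range C)).
    + exact: block_scaleB.
    + exact: block_scale_le.
    + by move=> e /(C_dense yF)[j jP]; exists (C j) => //; exists j.
    + by move=> _ [j _ <-]; exact: C_cvg.
  - move=> U Uu oU l lU.
    exact: (fb_cluster_argmin f_Gamma0 tau_gt0 g_convex g_differentiable g_lipschitz
      L_bounded theta_bounds gamma0_gt0 gamma_ge Bx Tx Uu oU xM lU).
exists l; split => // dreg.
have bE : B z = B l.
  apply: (cocoercive_weak_closed theta0 _ xM xl Bx) => u v.
  exact: (coupled_grad_cocoercive tau_gt0).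
exact: (fb_strong_cvg f_Gamma0 tau_gt0 g_convex g_differentiable g_lipschitz
  L_bounded gamma0_gt0 gamma_ge Bx Tx lF xl bE dreg).
Qed.

End forward_backward_path.

(** Off a measurable null set that contains the exceptional outcomes, the scalar
    products of the limit are pointwise limits of measurable functions; on that
    set the limit is given a constant value in F. The relation Q carries what else
    is known about the limit. *)
Lemma random_weak_limit {R : realType} d {T : measurableType d} (P : probability T R)
    {V : hilbertType R} (e : nat -> V) (x : nat -> T -> V) (F : set V)
    (Q : T -> V -> Prop) :
  dense_seq e -> F !=set0 -> (forall n, random_vector (x n)) ->
  {ae P, forall w, exists l, [/\ F l, weak_cvg (fun n => x n w) l & Q w l]} ->
  exists xlim : T -> V, [/\ random_vector xlim, forall w, F (xlim w) &
    {ae P, forall w, weak_cvg (fun n => x n w) (xlim w) /\ Q w (xlim w)}].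
Proof.
move=> de [z0 Fz0] mx [N [mN PN badN]].
have good w : ~ N w -> exists l, [/\ F l, weak_cvg (fun n => x n w) l & Q w l].
  by move=> nN; apply: contrapT => bad; exact: nN (badN w bad).
have [xlim xlimP] : {xlim : T -> V & forall w, F (xlim w) /\
    (if w \in N then xlim w = z0 else weak_cvg (fun n => x n w) (xlim w) /\ Q w (xlim w))}.
  apply: (@choice _ _ (fun w l => F l /\ (if w \in N then l = z0
    else weak_cvg (fun n => x n w) l /\ Q w l))) => w.
  have [_|/negP wN] := boolP (w \in N); first by exists z0.
  have [l [Fl wl Ql]] := good w (fun h => wN (mem_set h)).
  by exists l.
exists xlim; split; [|by move=> w; case: (xlimP w)|].
- apply: (random_vector_of_dot de) => h.
  apply: (@measurable_fun_cvg _ _ _ _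
    (fun n w => \1_N w * dot z0 h + \1_(~` N) w * dot (x n w) h)) => [n|w _].
    have mC : measurable (~` N) by exact: measurableC.
    apply: measurable_funD; apply: measurable_funM.
    + exact: measurable_indic.
    + exact: measurable_cst.
    + exact: measurable_indic.
    + exact: measurable_dot.
  have [_] := xlimP w; rewrite !indicE in_setC; case: (w \in N) => [->|[wl _]] /=.
    under eq_cvg do rewrite mul1r mul0r addr0.
    exact: cvg_cst.
  under eq_cvg do rewrite mul0r mul1r add0r.
  exact: wl.
- exists N; split => // w bad; apply: contrapT => nN; apply: bad.
  by have [_] := xlimP w; rewrite memNset.
Qed.

Theorem corollary5p11 (R : realType) (d : measure_display)
    (Omega : measurableType d) (P : probability Omega R)
    (m p : nat) (m_gt0 : (0 < m)%N) (p_gt0 : (0 < p)%N)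
    (H : 'I_m -> hilbertType R) (G : 'I_p -> hilbertType R)
    (H_separable : forall i, separable (H i))
    (G_separable : forall k, separable (G k))
    (f : forall i, H i -> \bar R) (f_Gamma0 : forall i, Gamma0 (f i))
    (tau : 'I_p -> R) (tau_gt0 : forall k, 0 < tau k)
    (g : forall k, G k -> R)
    (g_convex : forall k, convex_function [set: convex_lmodType (G k)] (g k))
    (g_differentiable : forall k x, differentiable (g k) x)
    (g_lipschitz : forall k, (tau k).-lipschitz (grad (g k)))
    (L : forall k i, {linear H i -> G k})
    (L_bounded : forall k i, exists M : R, forall x, `|L k i x| <= M * `|x|)
    (L_neq0 : forall k, 0 < \sum_i opnorm (L k i) ^+ 2)
    (F_nonempty : argmin (objective f g L) !=set0)
    (theta : R)
    (theta_bounds : 0 < theta <=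
      (\sum_k tau k * opnorm (fun y => \sum_i L k i (adjoint (L k i) y)))^-1)
    (gamma : nat -> R) (gamma_bounds : forall n, 0 < gamma n < 2 * theta)
    (gamma_inf : 0 < inf (range gamma))
    (gamma_sup : sup (range gamma) < 2 * theta)
    (lambda : nat -> R) (lambda_bounds : forall n, 0 < lambda n <= 1)
    (lambda_inf : 0 < inf (range lambda))
    (x r a c : nat -> Omega -> hsum H)
    (eps : nat -> Omega -> {ffun 'I_m -> bool})
    (x0_random : random_vector (x 0%N))
    (a_random : forall n, random_vector (a n))
    (c_random : forall n, random_vector (c n))
    (eps_D : forall n w, nonzero_bits m (eps n w))
    (eps_random : forall n, sigma_discrete (eps n) `<=` measurable)
    (eps_identically_distributed : forall n (B : set {ffun 'I_m -> bool}),
      P (eps n @^-1` B) = P (eps 0%N @^-1` B))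
    (r_def : forall n w i, r n w i = (eps n w i)%:R *:
      (x n w i - gamma n *: (coupled_grad g L (x n w) i + c n w i)))
    (x_def : forall n w i, x n.+1 w i = x n w i + ((eps n w i)%:R * lambda n) *:
      (prox (fun y => ((gamma n)%:E * f i y)%E) (r n w i) + a n w i - x n w i))
    (Ea Ec : nat -> Omega -> \bar R)
    (Ea_def : forall n, is_cond_exp P (sigma_upto x n)
      (fun w => (`|a n w| ^+ 2)%:E) (Ea n))
    (Ec_def : forall n, is_cond_exp P (sigma_upto x n)
      (fun w => (`|c n w| ^+ 2)%:E) (Ec n))
    (Ea_summable : {ae P, forall w, (\sum_(0 <= n <oo) sqrte (Ea n w) < +oo)%E})
    (Ec_summable : {ae P, forall w, (\sum_(0 <= n <oo) sqrte (Ec n w) < +oo)%E})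
    (eps_x_independent : forall n,
      independent P (sigma_discrete (eps n)) (sigma_upto x n))
    (eps_gt0 : forall i, (0 < P [set w | eps 0%N w i = true])%E) :
  exists xlim : Omega -> hsum H,
    [/\ random_vector xlim,
        forall w, argmin (objective f g L) (xlim w),
        {ae P, forall w, weak_cvg (fun n => x n w) (xlim w)} &
        (forall z, argmin (objective f g L) z ->
           forall i, demiregular (subdiff (f i)) (z i)) \/
        (forall z, argmin (objective f g L) z ->
           demiregular (fun y => [set coupled_grad g L y]) z) ->
        {ae P, forall w, x n w @[n --> \oo] --> xlim w}].
Proof.
have H_dense : exists E : nat -> hsum H, dense_seq E.
  exact: (hsum_dense_seq (fun i => projT2 (cid (separable_dense_seq (H_separable i))))).
have [E dE] := H_dense.
pose q i := fine (P [set w | eps 0%N w i = true]).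
have mset i : [set w | eps 0%N w i = true] = eps 0%N @^-1` [set D | D i = true] by [].
have m0 i : measurable [set w | eps 0%N w i = true].
  by apply: (eps_random 0%N); exists [set D : {ffun 'I_m -> bool} | D i = true] => //; rewrite setTI.
have q_bounds i : 0 < q i <= 1.
  apply/andP; split.
    by apply: fine_gt0; rewrite eps_gt0/= (le_lt_trans (probability_le1 P (m0 i))) ?ltry.
  by rewrite -lee_fin fineK ?fin_num_measure// probability_le1.
have q_def n i : fine (P [set w | eps n w i = true]) = q i.
  by congr fine; exact: (eps_identically_distributed n [set D | D i = true]).
have q_ge1 i : 1 <= (q i)^-1 by case/andP: (q_bounds i) => q0 q1; rewrite invf_ge1.
have gamma_ge n : inf (range gamma) <= gamma n.
  apply: ge_inf; last by exists n.
  by exists 0 => _ [k _ <-]; case/andP: (gamma_bounds k) => /ltW.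
have gamma_le n : gamma n <= sup (range gamma).
  apply: ub_le_sup; last by exists n.
  by exists (2 * theta) => _ [k _ <-]; case/andP: (gamma_bounds k) => _ /ltW.
have lambda_ge n : inf (range lambda) <= lambda n.
  apply: ge_inf; last by exists n.
  by exists 0 => _ [k _ <-]; case/andP: (lambda_bounds k) => /ltW.
have x_random n : random_vector (x n).
  exact: (iterates_random H_separable f_Gamma0 tau_gt0 g_convex g_differentiable
    g_lipschitz L_bounded theta_bounds gamma_bounds x0_random a_random c_random
    eps_random r_def x_def).
have [C [C_argmin C_dense]] := dense_seq_subset dE F_nonempty.
have good : {ae P, forall w, forall j,
    cvgn (fun n => `|block_scale (fun i => (q i)^-1) (x n w - C j)|) /\
    summable_seq (fun n => fb_gain f g L theta gamma lambda (C j) n (x n w))}.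
  apply: ae_foralln => j.
  exact: (fb_quasi_fejer H_separable f_Gamma0 tau_gt0 g_convex g_differentiable
    g_lipschitz L_bounded theta_bounds gamma_bounds lambda_bounds x0_random a_random
    c_random eps_random r_def x_def q_bounds q_def eps_x_independent (C_argmin j)
    Ea_def Ec_def Ea_summable Ec_summable).
have limits : {ae P, forall w, exists l, [/\ argmin (objective f g L) l,
    weak_cvg (fun n => x n w) l &
    (forall i, demiregular (subdiff (f i)) (l i)) \/
    demiregular (fun y => [set coupled_grad g L y]) l ->
    x n w @[n --> \oo] --> l]}.
  apply: filterS good => w good.
  exact: (forward_backward_path f_Gamma0 tau_gt0 g_convex g_differentiable
    g_lipschitz L_bounded theta_bounds gamma_inf gamma_sup lambda_inf gamma_ge gamma_le
    lambda_ge q_ge1 C_argmin C_dense (fun j => (good j).1) (good 0%N).2).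
have [xlim [xlim_random xlimF xlimP]] := random_weak_limit dE F_nonempty x_random limits.
exists xlim; split => //; first by apply: filterS xlimP => w [].
move=> dreg; apply: filterS xlimP => w [_]; apply.
by case: dreg => dreg; [left|right]; exact: dreg.
Qed.
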